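(* Let $\Bbbk$ be an algebraically closed field with $\operatorname{char}(\Bbbk)\neq2$, let $a\in\Bbbk$ with $a(a-1)\neq0$, and let $B$ be the $\Bbbk$-algebra on (degree-one) generators $x,y,z$ with defining relations $$xy+yx=z^2-y^2,\qquad xy+yx=az^2-x^2,\qquad zx-xz=a(yz-zy).$$ Then $B$ is regular if and only if $a^2-a+1\neq0$; in this case, $B$ is a graded skew Clifford algebra and a twist of a graded Clifford algebra by an automorphism.
   Context: Regular algebras. A graded $\Bbbk$-algebra $A=\bigoplus_{n\ge 0}A_n$ with $A_0=\Bbbk$, generated by the finite-dimensional space $A_1$, is regular (in the sense of Artin–Schelter) of global dimension $d$ if it has finite global dimension $d$, has polynomial growth, and is Gorenstein, i.e. $\operatorname{Ext}^i_A(\Bbbk,A)=0$ for $i\ne d$ and $\operatorname{Ext}^d_A(\Bbbk,A)\cong\Bbbk$ up to a degree shift. Here regular means regular of global dimension three. Twists. If $D$ is a graded algebra and $\phi$ is a graded degree-zero automorphism of $D$, the twist $D^\phi$ of $D$ by $\phi$ has the same underlying graded vector space and multiplication determined by $a*b=a\,\phi(b)$ for $a,b\in D_1$ (in general $a*b=a\,\phi^m(b)$ for $a\in D_m$). Graded skew Clifford algebras ($\operatorname{char}(\Bbbk)\ne2$). Let $\mu=(\mu_{ij})\in M(n,\Bbbk)$ with $\mu_{ij}\in\Bbbk^\times$, $\mu_{ij}\mu_{ji}=1$ for $i\neq j$, $\mu_{ii}=1$. A matrix $M$ is $\mu$-symmetric if $M_{ij}=\mu_{ij}M_{ji}$ for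 all $i,j$. Given $\mu$-symmetric matrices $M_1,\dots,M_n$, an associated graded skew Clifford algebra is a graded $\Bbbk$-algebra on degree-one generators $x_1,\dots,x_n$ and degree-two generators $y_1,\dots,y_n$ with defining relations given by: (a) $x_ix_j+\mu_{ij}x_jx_i=\sum_{k=1}^n (M_k)_{ij}y_k$ for all $i,j$; and (b) the existence of a normalizing sequence $\{r_1,\dots,r_n\}$ of homogeneous degree-two elements spanning $\Bbbk y_1+\cdots+\Bbbk y_n$ (normalizing: the image of $r_{k+1}$ is a normal element in the quotient by $\langle r_1,\dots,r_k\rangle$ for each $k\geq 0$). If $\mu_{ij}=1$ for all $i,j$ and all the $y_k$ are central, the algebra is called a graded Clifford algebra. *)

(* Defs.v *)
From HB Require Import structures.
From mathcomp Require Import all_boot all_order all_algebra.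
From mathcomp Require Import finmap monalg.

Set Implicit Arguments.
Unset Strict Implicit.
Unset Printing Implicit Defensive.

Import GRing.Theory.
Local Open Scope ring_scope.

(* The subgroups G i of V satisfy V = \bigoplus_i G i. *)
Definition direct_grading (I : eqType) (V : zmodType) (G : I -> V -> Prop) :=
  [/\ forall i, G i 0,
      forall i u v, G i u -> G i v -> G i (u - v),
      forall u, exists (s : seq I) (f : I -> V),
        [/\ uniq s, forall i, G i (f i) & u = \sum_(i <- s) f i]
    & forall (s : seq I) (f : I -> V), uniq s -> (forall i, G i (f i)) ->
        \sum_(i <- s) f i = 0 -> forall i, i \in s -> f i = 0].

(* The two-sided ideal generated by S. *)
Definition ideal_gen (R : pzRingType) (S : R -> Prop) (u : R) :=
  exists (m : nat) (l s r : 'I_m -> R),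
    (forall i, S (s i)) /\ u = \sum_(i < m) l i * s i * r i.

Record gralg (k : fieldType) := GrAlg {
  gr_sort :> algType k;
  hom : nat -> gr_sort -> Prop;
  gr_direct : direct_grading hom;
  gr_scale : forall n (c : k) u, hom n u -> hom n (c *: u);
  gr_one : hom 0%N 1;
  gr_mul : forall m n u v, hom m u -> hom n v -> hom (m + n)%N (u * v)
}.
Arguments hom {k A} n%_N u%_R : rename.

(* Negative degrees are zero. *)
Definition homz (k : fieldType) (A : gralg k) (j : int) (u : A) : Prop :=
  match j with Posz n => hom n u | Negz _ => u = 0 end.

Record grmod (k : fieldType) (A : gralg k) := GrMod {
  grm_sort :> lmodType A;
  mhom : int -> grm_sort -> Prop;
  grm_direct : direct_grading mhom;
  grm_scale : forall (m : nat) (j : int) (u : A) (v : grm_sort),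
    hom m u -> mhom j v -> mhom (m%:Z + j) (u *: v)
}.
Arguments mhom {k A M} j%_R v%_R : rename.

(* Modules are left modules. *)

Definition projective (R : pzRingType) (P : lmodType R) :=
  forall (M N : lmodType R) (g : {linear M -> N}) (f : {linear P -> N}),
    (forall v, exists u, g u = v) ->
    exists h : {linear P -> M}, forall p, g (h p) = f p.

Definition projective_resolution (R : pzRingType) (M : lmodType R)
    (P : nat -> lmodType R) (d : forall i, {linear P i.+1 -> P i})
    (e : {linear P 0%N -> M}) :=
  [/\ forall i, projective (P i),
      forall v, exists p, e p = v,
      forall p, e p = 0 <-> exists q, p = d 0%N q
    & forall i p, d i p = 0 <-> exists q, p = d i.+1 q].

Definition pd_le (R : pzRingType) (M : lmodType R) (n : nat) :=
  exists (P : nat -> lmodType R) (d : forall i, {linear P i.+1 -> P i})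
         (e : {linear P 0%N -> M}),
    projective_resolution d e /\ forall i, (n < i)%N -> forall p : P i, p = 0.

Definition gldim_le (R : pzRingType) (n : nat) :=
  forall M : lmodType R, pd_le M n.

Definition gldim_eq (R : pzRingType) (n : nat) :=
  gldim_le R n /\ forall m, (m < n)%N -> ~ gldim_le R m.

Section Regular.
Variables (k : fieldType) (A : gralg k).

(* T is isomorphic to the graded module A / A_{>0}, in degree 0. *)
Definition trivial_module (T : grmod A) :=
  exists t : T,
    [/\ t <> 0, mhom 0 t,
        forall (n : nat) (u : A), (0 < n)%N -> hom n u -> u *: t = 0
      & forall v : T, exists c : k, v = c%:A *: t].

Section Cohomology.
(* The complex Hom_A(P, A); its i-th cohomology is cocycles modulo
   coboundaries, with A acting on the right through the target. *)
Variables (P : nat -> grmod A) (d : forall i, {linear P i.+1 -> P i}).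

Definition cocycle i (f : P i -> A) := forall q, f (d i q) = 0.

Definition coboundary i : (P i -> A) -> Prop :=
  match i with
  | 0%N => fun f => forall p, f p = 0
  | j.+1 => fun f => exists g : {linear P j -> A^o}, forall p, f p = g (d j p)
  end.

Definition cohomology_zero i :=
  forall f : {linear P i -> A^o}, cocycle f -> coboundary f.

(* The i-th cohomology is k(l) for some shift l: it is spanned over k by the
   nonzero class of a homogeneous cocycle, and that class is killed by A_{>0}. *)
Definition cohomology_trivial i :=
  exists (l : int) (f0 : {linear P i -> A^o}),
    [/\ cocycle f0 /\ ~ coboundary f0,
        forall (j : int) (p : P i), mhom j p -> homz (j + l) (f0 p : A),
        forall f : {linear P i -> A^o}, cocycle f ->
          exists c : k, coboundary (fun p => (f p : A) - c *: (f0 p : A))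
      & forall (n : nat) (u : A), (0 < n)%N -> hom n u ->
          coboundary (fun p => (f0 p : A) * u)].
End Cohomology.

(* Ext^i_A(k, A) does not depend on the graded projective resolution of k. *)
Definition gorenstein (n : nat) :=
  exists (T : grmod A) (P : nat -> grmod A)
         (d : forall i, {linear P i.+1 -> P i}) (e : {linear P 0%N -> T}),
    [/\ trivial_module T,
        projective_resolution d e,
        (forall i j (p : P i.+1), mhom j p -> mhom j (d i p)) /\
        (forall j (p : P 0%N), mhom j p -> mhom j (e p)),
        forall i, i <> n -> cohomology_zero d i
      & cohomology_trivial d n].

Definition dim_le (n N : nat) :=
  exists s : 'I_N -> A, (forall i, hom n (s i)) /\
    forall u, hom n u -> exists c : 'I_N -> k, u = \sum_(i < N) c i *: s i.

Definition polynomial_growth :=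
  exists c e : nat, forall n, dim_le n (c * n.+1 ^ e)%N.

Definition connected := forall u : A, hom 0 u -> exists c : k, u = c%:A.

Definition generated_in_degree_one :=
  forall S : A -> Prop,
    S 1 -> (forall (c : k) u v, S u -> S v -> S (c *: u + v)) ->
    (forall u v, S u -> S v -> S (u * v)) -> (forall u, hom 1 u -> S u) ->
    forall u, S u.

Definition regular (n : nat) :=
  [/\ connected /\ generated_in_degree_one, exists N, dim_le 1%N N,
      gldim_eq A n, polynomial_growth & gorenstein n].

End Regular.

Section Presentations.
Variables (k : fieldType) (I : choiceType).

Definition free_alg := {malg k[{fmonom I}]}.

Definition gen (i : I) : free_alg := << fmu i >>.

Definition free_eval (A : algType k) (g : I -> A) (p : free_alg) : A :=
  \sum_(w <- msupp p) p@_w *: \prod_(i <- (w : seq I)) g i.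

Definition free_hom (deg : I -> nat) (n : nat) (p : free_alg) :=
  forall w, w \in msupp p -> (\sum_(i <- (w : seq I)) deg i)%N = n.

(* A is the algebra on generators g i, of degree deg i, with defining
   relations R. *)
Definition presented (deg : I -> nat) (R : free_alg -> Prop)
    (A : gralg k) (g : I -> A) :=
  [/\ forall i, hom (deg i) (g i),
      forall u, exists p, u = free_eval g p
    & forall p, free_eval g p = 0 <-> ideal_gen R p].

End Presentations.
Arguments gen {k I} i.

(* The image of r is a normal element of the quotient by the ideal S generates. *)
Definition normal_mod (R : pzRingType) (S : R -> Prop) (r : R) :=
  (forall u, exists v, ideal_gen S (r * u - v * r)) /\
  (forall u, exists v, ideal_gen S (u * r - r * v)).

Definition preceding (T : Type) (n : nat) (r : 'I_n -> T) (i : 'I_n) (w : T) :=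
  exists2 j : 'I_n, (j < i)%N & w = r j.

Definition normalizing (R : pzRingType) (n : nat) (r : 'I_n -> R) :=
  forall i, normal_mod (preceding r i) (r i).

Section SkewClifford.
Variables (k : fieldType) (n : nat).

Definition skew_parameter (mu : 'M[k]_n) :=
  [/\ forall i j, mu i j != 0,
      forall i j, i != j -> mu i j * mu j i = 1
    & forall i, mu i i = 1].

Definition mu_symmetric (mu M : 'M[k]_n) :=
  forall i j, M i j = mu i j * M j i.

Definition cliff_gens : choiceType := ('I_n + 'I_n)%type.
Definition cliff_deg (g : cliff_gens) : nat := if g is inl _ then 1%N else 2%N.
Definition cliff_free := free_alg k cliff_gens.
Definition genX (i : 'I_n) : cliff_free := gen (inl i).
Definition genY (i : 'I_n) : cliff_free := gen (inr i).

Definition quadratic_rel (mu : 'M[k]_n) (M : 'I_n -> 'M[k]_n)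
    (p : cliff_free) :=
  exists i j, p = genX i * genX j + mu i j *: (genX j * genX i)
                  - \sum_(l < n) M l i j *: genY l.

(* The rows of C give elements r_i of the span of the y's. *)
Definition ycomb (C : 'M[k]_n) (V : lmodType k) (y : 'I_n -> V) (i : 'I_n) : V :=
  \sum_(l < n) C i l *: y l.

(* p states that r_i g = h r_i, or g r_i = r_i h, modulo r_0, ..., r_{i-1},
   for a generator g. *)
Definition normality_rel (C : 'M[k]_n) (p : cliff_free) :=
  let r := ycomb C genY in
  exists (i : 'I_n) (g : cliff_gens) (h w : cliff_free),
    [/\ free_hom cliff_deg (cliff_deg g) h,
        free_hom cliff_deg (cliff_deg g + 2)%N w,
        ideal_gen (preceding r i) w
      & p = r i * gen g - h * r i - w \/ p = gen g * r i - r i * h - w].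

(* The defining relations are the quadratic ones together with a set N of
   relations that make r_i = sum_l C_il y_l a normalizing sequence. N consists of
   normality relations only, so it cannot impose anything unrelated; it may be
   empty when the quadratic relations already make the sequence normalizing. *)
Definition gsca_with (mu : 'M[k]_n) (M : 'I_n -> 'M[k]_n) (C : 'M[k]_n)
    (N : cliff_free -> Prop) (A : gralg k) (x y : 'I_n -> A) :=
  [/\ skew_parameter mu /\ (forall l, mu_symmetric mu (M l)),
      forall p, N p -> normality_rel C p,
      presented cliff_deg (fun p => quadratic_rel mu M p \/ N p)
        (fun g : cliff_gens => match g with inl i => x i | inr i => y i end),
      forall l, exists c : 'I_n -> k, y l = \sum_(i < n) c i *: ycomb C y i
    & normalizing (ycomb C y)].

Definition centrality_rel (p : cliff_free) :=
  exists (l : 'I_n) (g : cliff_gens), p = genY l * gen g - gen g * genY l.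

End SkewClifford.

Definition graded_skew_clifford (k : fieldType) (A : gralg k) :=
  exists (n : nat) (mu : 'M[k]_n) (M : 'I_n -> 'M[k]_n) (C : 'M[k]_n)
         (N : cliff_free k n -> Prop) (x y : 'I_n -> A),
    gsca_with mu M C N x y.

(* The case mu = 1, r_i = y_i, with N saying that the y's are central. *)
Definition graded_clifford (k : fieldType) (A : gralg k) :=
  exists (n : nat) (M : 'I_n -> 'M[k]_n) (x y : 'I_n -> A),
    gsca_with (const_mx 1) M 1%:M (@centrality_rel k n) x y.

Definition graded_automorphism (k : fieldType) (D : gralg k)
    (phi : {lrmorphism D -> D}) :=
  bijective phi /\ forall n u, hom n u -> hom n (phi u).

(* B is isomorphic, as a graded algebra, to the twist of D by phi, whose product
   is a * b = a phi^m(b) for a of degree m. *)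
Definition iso_twist (k : fieldType) (B D : gralg k)
    (phi : {lrmorphism D -> D}) :=
  exists F : {linear B -> D},
    [/\ bijective F, F 1 = 1, forall n u, hom n u -> hom n (F u)
      & forall m (u v : B), hom m u -> F (u * v) = F u * iter m phi (F v)].

Definition relB (k : fieldType) (a : k) (p : free_alg k 'I_3) :=
  let x : free_alg k 'I_3 := gen (inord 0) in
  let y : free_alg k 'I_3 := gen (inord 1) in
  let z : free_alg k 'I_3 := gen (inord 2) in
  [\/ p = (x * y + y * x) - (z * z - y * y),
      p = (x * y + y * x) - (a *: (z * z) - x * x)
    | p = (z * x - x * z) - a *: (y * z - z * y)].

(* Main.v *)
(* Put w = x + ay, w' = w - (2a - 1)y and b = a^2 - a + 1. The relations of B say
   that w commutes with z, that w'^2 = b y^2 and that yw + w'y = z^2.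

   If b = 0, then B acts on the right of A^2, for A the free algebra on y and z, by
   2 x 2 matrices; those of y and z are upper triangular with (1,1) entries y and z.
   Hence the words in y and z are linearly independent in B, which therefore grows
   exponentially.

   If b <> 0, then y^2 and z^2 are central and B is free of rank 8 over the ring of
   polynomials in y^2, z^2 and yz + zy, as is seen on an explicit action on a free
   module of rank 8. From this normal form one reads off polynomial growth and the
   exactness of the Koszul complex 0 -> B -> B^3 -> B^3 -> B -> k -> 0; exactness in
   the middle comes from the Fox derivatives of the relations. The anti-automorphism
   that fixes x, y and z gives the exactness of the dual complex, which is the
   Gorenstein property. For an arbitrary module M, the complex tensored with M over k
   is a resolution of M of length 3, because its differentials are, up to terms of
   lower degree in the factor B, those of the Koszul complex.

   The element yz - zy is normal: it anticommutes with x, y and z. So z^2, y^2 and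
   yz - zy make B a graded skew Clifford algebra, and the twist by z |-> -z makes all
   three central. That the Clifford relations suffice to present either algebra is
   shown by letting B act on the right of the free algebra modulo these relations. *)

From HB Require Import structures.
From mathcomp Require Import all_boot all_order all_algebra finmap monalg.
From mathcomp Require Import boolp classical_sets ring zify.
Require Import Defs.

Set Implicit Arguments.
Unset Strict Implicit.
Unset Printing Implicit Defensive.

Import GRing.Theory.
Local Open Scope ring_scope.

(** * Linear arithmetic in modules over a commutative ring *)

(** The case distinction comes from one cancellation: [b y^2 = w'^2] commutes with [w'], so [y^2]
    does as soon as [b] is invertible, and the centrality of [y^2] and [z^2] follows from there.
    That an element of a presented algebra is nonzero, or that a syzygy has a given form, is always
    read off a right action of the free algebra that respects the relations.

    Global dimension is a condition on all modules, graded or not, so resolving [k] does not give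
    the upper bound. The lower bound is of another kind: if [k] had projective dimension at most 2,
    the last Koszul map would split, which is impossible because its entries have degree one.

    Put [e = 2a - 1], [r1 = zw - wz], [r2 = w^2 - e z^2 - b y^2] and [r3 = yw + w'y - z^2]. Then [-z
    r1 + y r2 + w' r3 = r1 z + r2 y + r3 w'] already in the free algebra. This cubic element is the
    origin of the last differential in the complexes below, and of the symmetry between the Koszul
    complex and its dual. *)

Inductive lexp (K : Type) : Type :=
| LVar of nat
| LZero
| LAdd of lexp K & lexp K
| LOpp of lexp K
| LScale of K & lexp K.
Arguments LVar {K}.
Arguments LZero {K}.

Section Lexp.
Variables (K : comNzRingType) (V : lmodType K).

Fixpoint linterp (l : seq V) (e : lexp K) : V :=
  match e with
  | LVar n => nth 0 l n
  | LZero => 0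
  | LAdd e1 e2 => linterp l e1 + linterp l e2
  | LOpp e1 => - linterp l e1
  | LScale c e1 => c *: linterp l e1
  end.

Fixpoint lcoef (e : lexp K) (n : nat) : K :=
  match e with
  | LVar m => if eqn m n then 1 else 0
  | LZero => 0
  | LAdd e1 e2 => lcoef e1 n + lcoef e2 n
  | LOpp e1 => - lcoef e1 n
  | LScale c e1 => c * lcoef e1 n
  end.

Fixpoint lcoefs_eq (e1 e2 : lexp K) (n : nat) : Prop :=
  if n is m.+1 then lcoef e1 m = lcoef e2 m /\ lcoefs_eq e1 e2 m else True.

Lemma linterpE l e : linterp l e = \sum_(i < size l) lcoef e i *: l`_i.
Proof.
elim: e => [n||e1 IH1 e2 IH2|e IH|c e IH] /=.
- have eqnE' m : eqn n m = (n == m) by [].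
  have [lt_n|le_n] := ltnP n (size l).
    rewrite (bigD1 (Ordinal lt_n)) //= eqnE' eqxx scale1r big1 ?addr0 // => i.
    by rewrite eqnE' eq_sym -val_eqE /= => /negbTE ->; rewrite scale0r.
  rewrite nth_default // big1 // => i _; rewrite eqnE'.
  by rewrite gtn_eqF ?scale0r // (leq_trans (ltn_ord i)).
- by rewrite big1 // => i _; rewrite scale0r.
- by rewrite IH1 IH2 -big_split; apply: eq_bigr => i _; rewrite scalerDl.
- by rewrite IH -sumrN; apply: eq_bigr => i _; rewrite scaleNr.
- by rewrite IH scaler_sumr; apply: eq_bigr => i _; rewrite scalerA.
Qed.

(** After [expand_words], a noncommutative identity is an equality of linear combinations of words.
    The words are opaque atoms, and each coefficient gives an identity in the commutative ring [K],
    which is left to [ring]. *)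
Lemma lexp_eq l e1 e2 :
  lcoefs_eq e1 e2 (size l) -> linterp l e1 = linterp l e2.
Proof.
move=> eq12; rewrite !linterpE.
have coefE i : (i < size l)%N -> lcoef e1 i = lcoef e2 i.
  elim: (size l) eq12 => // n IH /= [eqn12 /IH {}IH].
  by rewrite ltnS leq_eqVlt => /predU1P[->|/IH].
by apply: eq_bigr => i _; rewrite coefE.
Qed.
End Lexp.

(* Atoms are compared up to conversion because rewriting changes the paths of
   canonical structures that a product goes through. *)
Ltac lindex x l :=
  lazymatch l with
  | cons ?y ?t =>
    match constr:(Set) with
    | _ => let _ := lazymatch goal with _ => unify x y end in constr:(O)
    | _ => let n := lindex x t in constr:(S n)
    end
  end.

Ltac ladd x l :=
  match constr:(Set) with
  | _ => let _ := lindex x l in l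
  | _ => constr:(cons x l)
  end.

Ltac latoms e l :=
  lazymatch e with
  | (?a + ?b)%R => let l1 := latoms a l in latoms b l1
  | (- ?a)%R => latoms a l
  | (?c *: ?a)%R => latoms a l
  | (0)%R => l
  | _ => ladd e l
  end.

Ltac lreify K e l :=
  lazymatch e with
  | (?a + ?b)%R => let a' := lreify K a l in let b' := lreify K b l in
                   constr:(@LAdd K a' b')
  | (- ?a)%R => let a' := lreify K a l in constr:(@LOpp K a')
  | (?c *: ?a)%R => let a' := lreify K a l in constr:(@LScale K c a')
  | (0)%R => constr:(@LZero K)
  | _ => let n := lindex e l in constr:(@LVar K n)
  end.

Ltac lin_over K V :=
  lazymatch goal with
  | |- ?a = ?b =>
    let l0 := latoms a (@nil V) in
    let l := latoms b l0 in
    let ea := lreify K a l in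
    let eb := lreify K b l in
    change (@linterp K V l ea = @linterp K V l eb);
    apply: lexp_eq; cbn [lcoefs_eq lcoef size eqn];
    repeat split; first [ring | match goal with |- ?g => idtac "FAIL" g end]
  end.

(** Produces the atoms that [lin_over] compares: left-associated words with their scalars in front.
    The expansion is run twice because extracting a scalar can expose a product that is not yet
    reassociated. *)
Ltac expand_words :=
  rewrite ?(mulrDl, mulrDr, mulrBl, mulrBr, mulNr, mulrN, scalerDr, scalerBr,
            scalerN, mulrA, mul0r, mulr0, mul1r, mulr1) -?(scalerAl, scalerAr)
          ?(mulrDl, mulrDr, mulrBl, mulrBr, mulNr, mulrN, scalerDr, scalerBr,
            scalerN, mulrA, mul0r, mulr0, mul1r, mulr1).

(** * Free modules and free algebras *)

Lemma linear_fun0 (R : pzRingType) (U V : lmodType R) (f : U -> V) :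
  linear f -> f 0 = 0.
Proof. by move=> flin; have := flin (-1) 0 0; rewrite scaler0 addr0 scaleN1r addNr. Qed.

Section MalgExt.
Variables (R : nzRingType) (K : choiceType) (N : lmodType R) (f : K -> N).

Definition malg_ext (p : {malg R[K]}) : N := \sum_(x <- msupp p) p@_x *: f x.

Lemma malg_extEw (d : {fset K}) p :
  (msupp p `<=` d)%fset -> malg_ext p = \sum_(x <- d) p@_x *: f x.
Proof.
move=> le_pd; rewrite [LHS](big_fset_incl _ le_pd) //= => x _ /mcoeff_outdom ->.
by rewrite scale0r.
Qed.

Fact malg_ext_linear : linear malg_ext.
Proof.
move=> c p q; set d := (msupp p `|` msupp q `|` msupp (c *: p + q))%fset.
rewrite !(@malg_extEw d) ?fsubsetUr //.
- rewrite scaler_sumr -big_split; apply: eq_bigr => x _.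
  by rewrite mcoeffD mcoeffZ scalerDl scalerA.
- by rewrite /d -fsetUA fsetUCA fsubsetUl.
- by rewrite /d -fsetUA fsubsetUl.
Qed.
HB.instance Definition _ :=
  GRing.isLinear.Build R {malg R[K]} N _ malg_ext malg_ext_linear.

Lemma malg_extU x : malg_ext << x >> = f x.
Proof. by rewrite (malg_extEw msuppU_le) big_seq_fset1 mcoeffUU scale1r. Qed.
End MalgExt.

Section MalgInd.
Variables (R : nzRingType) (K : choiceType).
Implicit Type p : {malg R[K]}.

Lemma malgU_scale (c : R) (x : K) : << c *g x >> = c *: << x >> :> {malg R[K]}.
Proof. by apply/malgP => y; rewrite mcoeffZ !mcoeffU mulr_natr. Qed.

Lemma malg_lin_ind (P : {malg R[K]} -> Prop) :
  P 0 -> (forall c p q, P p -> P q -> P (c *: p + q)) ->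
  (forall x, P << x >>) -> forall p, P p.
Proof.
move=> P0 Plin PU p; rewrite [p]monalgE; elim/big_ind: _ => //.
  by move=> q r Pq Pr; rewrite -[q]scale1r; apply: Plin.
by move=> x _; rewrite malgU_scale -[_ *: _]addr0; apply: Plin.
Qed.

Lemma malg_linear_eq (N : lmodType R) (f g : {malg R[K]} -> N) :
  linear f -> linear g -> (forall x, f << x >> = g << x >>) -> f =1 g.
Proof.
move=> flin glin fg p.
elim/malg_lin_ind: p => [|c p q IHp IHq|] //; first by rewrite !linear_fun0.
by rewrite flin glin IHp IHq.
Qed.

Lemma free_module_lift (N : lmodType R) (f : K -> N) :
  exists h : {linear {malg R[K]} -> N}, forall x, h << x >> = f x.
Proof. by exists (malg_ext f) => x; apply: malg_extU. Qed.

Lemma projective_malg : projective {malg R[K]}.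
Proof.
move=> M N g f gsurj.
have [h hE] := free_module_lift (fun x => projT1 (cid (gsurj (f << x >>)))).
exists h; apply: malg_linear_eq => [c p q|c p q|x]; rewrite ?linearP //.
by rewrite hE; case: cid.
Qed.
End MalgInd.

(** Restriction of scalars along [f]. The alias keeps the [K]-structure apart from the given
    [S]-structure on the same carrier. *)
Definition restr (K S : pzRingType) (f : {rmorphism K -> S}) (V : lmodType S) : Type := V.

Section Restr.
Variables (K S : pzRingType) (f : {rmorphism K -> S}) (V : lmodType S).
HB.instance Definition _ := GRing.Zmodule.on (restr f V).
Let sc (c : K) (v : restr f V) : restr f V := f c *: (v : V).
Let scA c d v : sc c (sc d v) = sc (c * d) v.
Proof. by rewrite /sc scalerA rmorphM. Qed.
Let sc1 : left_id 1 sc.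
Proof. by move=> v; rewrite /sc rmorph1 scale1r. Qed.
Let scDr : right_distributive sc +%R.
Proof. by move=> c u v; rewrite /sc scalerDr. Qed.
Let scDl v : {morph sc^~ v : c d / c + d}.
Proof. by move=> c d; rewrite /sc rmorphD scalerDl. Qed.
HB.instance Definition _ :=
  GRing.Zmodule_isLmodule.Build K (restr f V) scA sc1 scDr scDl.

Lemma restr_scaleE (c : K) (v : restr f V) : c *: v = f c *: (v : V) :> V.
Proof. by []. Qed.
End Restr.

Lemma malg_mulUU (k : nzRingType) (K : monomType) (x y : K) :
  << x >> * << y >> = << mmul x y >> :> {malg k[K]}.
Proof. by rewrite malgM_def fgmulUU mulr1. Qed.

Lemma malg_scalerAr (k : comNzRingType) (K : monomType) (c : k) (p q : {malg k[K]}) :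
  p * (c *: q) = c *: (p * q).
Proof.
rewrite -!mul_malgC !mulrA; congr (_ * q); rewrite mul_malgC.
elim/malg_lin_ind: p => [|d p r IHp IHr|x]; first by rewrite mul0r scaler0.
- by rewrite mulrDl -scalerAl IHp IHr scalerDr !scalerA [d * c]mulrC.
- by rewrite malgM_def fgmulUU mul1r mulm1 malgU_scale.
Qed.

Section Words.
Variables (k : fieldType) (I : choiceType).
Local Notation F := (free_alg k I).

Definition word (s : seq I) : F := << FMonom s >>.

Lemma wordM s t : word s * word t = word (s ++ t).
Proof.
rewrite /word malg_mulUU; congr << _ >>.
by apply: val_inj; rewrite /= fmM.
Qed.

Lemma word0 : word [::] = 1.
Proof. by rewrite /word -fmoneE. Qed.

Lemma gen_word i : gen i = word [:: i].
Proof. by rewrite /gen fmuE. Qed.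

Lemma word_rcons s i : word (rcons s i) = word s * gen i.
Proof. by rewrite -cats1 gen_word wordM. Qed.

Lemma free_lin_ind (P : F -> Prop) :
  P 0 -> (forall c p q, P p -> P q -> P (c *: p + q)) ->
  (forall s, P (word s)) -> forall p, P p.
Proof. by move=> P0 Plin Pw; apply: malg_lin_ind => // -[s]; apply: Pw. Qed.

(** Generators are added on the right, the side on which the free algebra acts throughout. *)
Lemma free_ind (P : F -> Prop) :
  P 1 -> (forall c p q, P p -> P q -> P (c *: p + q)) ->
  (forall p i, P p -> P (p * gen i)) -> forall p, P p.
Proof.
move=> P1 Plin Pgen; apply: free_lin_ind => //.
  by have := Plin (-1) 1 1 P1 P1; rewrite scaleN1r addNr.
by move=> s; elim/last_ind: s => [|s i IH]; rewrite ?word0 ?word_rcons //; apply: Pgen.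
Qed.
End Words.

Section IdealGen.
Variables (R : pzRingType).
Implicit Types S : R -> Prop.

Lemma ideal_gen0 S : ideal_gen S 0.
Proof.
by exists 0%N, (fun=> 0), (fun=> 0), (fun=> 0); split=> [[]//|]; rewrite big_ord0.
Qed.

Lemma ideal_genD S u v : ideal_gen S u -> ideal_gen S v -> ideal_gen S (u + v).
Proof.
move=> [m [l [s [r [Ss ->]]]]] [n [l' [s' [r' [Ss' ->]]]]].
pose join (T : Type) (f : 'I_m -> T) (g : 'I_n -> T) i :=
  match split i with inl j => f j | inr j => g j end.
exists (m + n)%N, (join _ l l'), (join _ s s'), (join _ r r'); split.
  by move=> i; rewrite /join; case: split.
rewrite big_split_ord /=; congr (_ + _); apply: eq_bigr => i _; rewrite /join.
  by rewrite -[lshift n i]/(unsplit (inl i)) unsplitK.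
by rewrite -[rshift m i]/(unsplit (inr i)) unsplitK.
Qed.

Lemma ideal_genM S u a b : ideal_gen S u -> ideal_gen S (a * u * b).
Proof.
move=> [m [l [s [r [Ss ->]]]]].
exists m, (fun i => a * l i), s, (fun i => r i * b); split=> //.
by rewrite mulr_sumr mulr_suml; apply: eq_bigr => i _; rewrite !mulrA.
Qed.

Lemma ideal_gen_sub S u : S u -> ideal_gen S u.
Proof.
move=> Su; exists 1%N, (fun=> 1), (fun=> u), (fun=> 1); split=> //.
by rewrite big_ord1 mul1r mulr1.
Qed.

Lemma ideal_genMl S a u : ideal_gen S u -> ideal_gen S (a * u).
Proof. by move=> /(@ideal_genM _ _ a 1); rewrite mulr1. Qed.

Lemma ideal_genMr S b u : ideal_gen S u -> ideal_gen S (u * b).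
Proof. by move=> /(@ideal_genM _ _ 1 b); rewrite mul1r. Qed.

Lemma ideal_genN S u : ideal_gen S u -> ideal_gen S (- u).
Proof. by move=> /(@ideal_genMl _ (-1)); rewrite mulN1r. Qed.

Lemma ideal_genB S u v : ideal_gen S u -> ideal_gen S v -> ideal_gen S (u - v).
Proof. by move=> Su /ideal_genN; apply: ideal_genD. Qed.

Lemma ideal_gen_ind S (P : R -> Prop) :
  P 0 -> (forall u v, P u -> P v -> P (u + v)) ->
  (forall l s r, S s -> P (l * s * r)) -> forall u, ideal_gen S u -> P u.
Proof. by move=> P0 PD PM u [m [l [s [r [Ss ->]]]]]; elim/big_ind: _ => // i _; apply: PM. Qed.
End IdealGen.

Lemma ideal_genZ (k : pzRingType) (A : lalgType k) (S : A -> Prop) (c : k) u :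
  ideal_gen S u -> ideal_gen S (c *: u).
Proof. by move=> Su; rewrite -mulr_algl; apply: ideal_genMl. Qed.

(* The free algebra acts on the right of V, each generator i through rho i. *)

Section FreeAction.
Variables (k : fieldType) (I : choiceType) (V : lmodType k).
Variables (rho : I -> V -> V) (rho_lin : forall i, linear (rho i)).
Local Notation F := (free_alg k I).

Definition word_act (s : seq I) (v : V) : V := foldl (fun u i => rho i u) v s.

Definition free_act (p : F) (v : V) : V :=
  malg_ext (fun m : {fmonom I} => word_act m v) p.

Lemma free_act_word s v : free_act (word k s) v = word_act s v.
Proof. exact: malg_extU. Qed.

Lemma free_act_linearl v : linear (free_act^~ v).
Proof. exact: malg_ext_linear. Qed.

Lemma free_act0l v : free_act 0 v = 0.
Proof. exact/linear_fun0/free_act_linearl. Qed.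

Lemma word_act_linear s : linear (word_act s).
Proof. by elim: s => //= i s IH c u v; rewrite /word_act /= rho_lin -/(word_act s _) IH. Qed.

Lemma free_act_linear p : linear (free_act p).
Proof.
move=> c u v; elim/free_lin_ind: p => [|c' p q IHp IHq|s].
- by rewrite !free_act0l scaler0 addr0.
- rewrite !free_act_linearl IHp IHq !scalerDr !scalerA [c' * c]mulrC.
  by rewrite addrACA.
- by rewrite !free_act_word word_act_linear.
Qed.

Lemma free_act0 p : free_act p 0 = 0.
Proof. exact/linear_fun0/free_act_linear. Qed.

Lemma free_actZ p c v : free_act p (c *: v) = c *: free_act p v.
Proof. by have := free_act_linear p c v 0; rewrite free_act0 !addr0. Qed.

Lemma free_actD p u v : free_act p (u + v) = free_act p u + free_act p v.
Proof. by have := free_act_linear p 1 u v; rewrite !scale1r. Qed.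

Lemma free_act1 v : free_act 1 v = v.
Proof. by rewrite -word0 free_act_word. Qed.

Lemma free_act_gen i v : free_act (gen i) v = rho i v.
Proof. by rewrite gen_word free_act_word. Qed.

Lemma free_actM p q v : free_act (p * q) v = free_act q (free_act p v).
Proof.
elim/free_lin_ind: p v => [|c p p' IHp IHq|s] v.
- by rewrite mul0r !free_act0l free_act0.
- rewrite mulrDl -scalerAl !free_act_linearl IHp IHq.
  by rewrite free_actD free_actZ.
elim/free_lin_ind: q v => [|c p p' IHp IHq|t] v.
- by rewrite mulr0 !free_act0l.
- by rewrite mulrDr malg_scalerAr !free_act_linearl IHp IHq.
- by rewrite wordM !free_act_word /word_act foldl_cat.
Qed.

Section Ideal.
Variable (R : F -> Prop) (S : V -> Prop).
Hypotheses (S0 : S 0) (SD : forall u v, S u -> S v -> S (u + v)).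
Hypotheses (SZ : forall c v, S v -> S (c *: v)) (Srho : forall i v, S v -> S (rho i v)).
Hypothesis RS : forall s v, R s -> S (free_act s v).

Lemma free_act_stable p v : S v -> S (free_act p v).
Proof.
elim/free_lin_ind: p v => [|c p p' IHp IHq|s] v Sv.
- by rewrite free_act0l.
- by rewrite free_act_linearl; apply: SD; [apply/SZ/IHp | apply: IHq].
- by rewrite free_act_word; elim: s v Sv => //= i s IH v Sv; apply/IH/Srho.
Qed.

(** Used with three choices of [S]: zero, for modules over a presented algebra; the Koszul syzygies,
    for Fox derivatives; the ideal of the Clifford relations, for the presentations at the end. *)
Lemma free_act_ideal p v : ideal_gen R p -> S (free_act p v).
Proof.
elim/ideal_gen_ind: p / => [|p q Sp Sq|l s r Rs].
- by rewrite free_act0l.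
- by rewrite -[p]scale1r free_act_linearl scale1r; apply: SD.
- by rewrite !free_actM; apply/free_act_stable/RS.
Qed.
End Ideal.
End FreeAction.

Section FreeEval.
Variables (k : fieldType) (I : choiceType) (A : algType k) (g : I -> A).
Local Notation ev := (free_eval g).

Let rho i v := v * g i.
Let rho_lin i : linear (rho i).
Proof. by move=> c u v; rewrite /rho mulrDl scalerAl. Qed.

(** Evaluation is the action by right multiplications, so its linearity and multiplicativity are
    inherited from [free_act]. *)
Lemma free_act_mul (u : A) p : free_act rho p u = u * ev p.
Proof.
rewrite /free_act /malg_ext /free_eval mulr_sumr; apply: eq_bigr => m _.
rewrite -scalerAr; congr (_ *: _); rewrite /word_act.
elim: (m : seq I) u => [|i s IH] u /=; first by rewrite big_nil mulr1.
by rewrite IH big_cons mulrA.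
Qed.

Lemma free_eval_act p : ev p = free_act rho p 1.
Proof. by rewrite free_act_mul mul1r. Qed.

Lemma free_eval_linear : linear ev.
Proof. by move=> c p q; rewrite !free_eval_act free_act_linearl. Qed.
HB.instance Definition _ := GRing.isLinear.Build k (free_alg k I) A _ ev free_eval_linear.

Lemma free_eval_mult : monoid_morphism ev.
Proof.
split; first by rewrite free_eval_act free_act1.
by move=> p q; rewrite free_eval_act (free_actM rho_lin) !free_act_mul mul1r.
Qed.
HB.instance Definition _ := GRing.isMonoidMorphism.Build (free_alg k I) A ev free_eval_mult.

Lemma free_eval_gen i : ev (gen i) = g i.
Proof. by rewrite free_eval_act free_act_gen /rho mul1r. Qed.
End FreeEval.

(** * Graded modules *)

Section DirectGrading.
Variables (I : eqType) (V : zmodType) (G : I -> V -> Prop).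
Hypothesis grG : direct_grading G.

Let G0 i : G i 0. Proof. by case: grG. Qed.
Let GB i u v : G i u -> G i v -> G i (u - v). Proof. by case: grG => _ + _ _; apply. Qed.

Lemma dgN i u : G i u -> G i (- u).
Proof. by move=> Gu; rewrite -[- u]add0r; apply: GB. Qed.

Lemma dgD i u v : G i u -> G i v -> G i (u + v).
Proof. by move=> Gu Gv; rewrite -[v]opprK; apply/GB/dgN. Qed.

Lemma dg_exists u : {p : seq I * (I -> V) |
  [/\ uniq p.1, forall i, G i (p.2 i) & u = \sum_(i <- p.1) p.2 i]}.
Proof. by apply: cid; case: grG => _ _ + _ => /(_ u)[s [f H]]; exists (s, f). Qed.

Definition dgcomp i u : V :=
  let p := sval (dg_exists u) in if i \in p.1 then p.2 i else 0.

(** Independence of the chosen decomposition: the difference of two decompositions, both extended by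
    zero to the union of their supports, is a homogeneous decomposition of 0. *)
Lemma dgcompE u (s : seq I) (f : I -> V) i :
  uniq s -> (forall j, G j (f j)) -> u = \sum_(j <- s) f j ->
  dgcomp i u = if i \in s then f i else 0.
Proof.
move=> s_uniq Gf uE; rewrite /dgcomp; case: (dg_exists u) => -[t g] /= [t_uniq Gg uE'].
pose h (s' : seq I) f' j : V := if j \in s' then f' j else 0.
have sumh (s' r : seq I) f' : uniq s' -> uniq r -> {subset s' <= r} ->
    \sum_(j <- r) h s' f' j = \sum_(j <- s') f' j.
  move=> s'_uniq r_uniq sub; rewrite /h -big_mkcond -big_filter /=.
  apply: perm_big; apply: uniq_perm; rewrite ?filter_uniq // => j.
  by rewrite mem_filter andb_idr // => /sub.
pose r := undup (s ++ t).
have hB j : G j (h t g j - h s f j).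
  by apply: GB; rewrite /h; case: ifP => _ //; exact: G0.
have sum0 : \sum_(j <- r) (h t g j - h s f j) = 0.
  rewrite sumrB !sumh ?undup_uniq // -?uE -?uE' ?subrr // => j js;
    by rewrite mem_undup mem_cat js ?orbT.
have [ir|] := boolP (i \in r).
  case: grG => _ _ _ /(_ _ _ (undup_uniq _) hB sum0 i ir) /eqP.
  by rewrite subr_eq0 => /eqP.
by rewrite mem_undup mem_cat negb_or => /andP[/negbTE -> /negbTE ->].
Qed.

Lemma dgcomp_hom i u : G i (dgcomp i u).
Proof.
rewrite /dgcomp; case: (dg_exists u) => -[t g] [_ Gg _] /=.
by case: ifP => _; [exact: Gg | exact: G0].
Qed.

Lemma dgcomp_sum u : exists2 s : seq I, uniq s & u = \sum_(i <- s) dgcomp i u.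
Proof.
case: (dg_exists u) => -[s f] /= [s_uniq Gf uE]; exists s => //.
rewrite {1}uE; apply: eq_big_seq => i i_s.
by rewrite (dgcompE _ s_uniq Gf uE) i_s.
Qed.

Lemma dgcomp_id i j u : G i u -> dgcomp j u = if j == i then u else 0.
Proof.
move=> Gu; rewrite (@dgcompE u [:: i] (fun l => if l == i then u else 0)) //.
- by rewrite inE; case: eqP.
- by move=> l; case: eqP => [->|_] //; exact: G0.
- by rewrite big_seq1 eqxx.
Qed.

Lemma dgcomp_eq0 u : (forall i, dgcomp i u = 0) -> u = 0.
Proof. by move=> H; have [s _ uE] := dgcomp_sum u; rewrite uE big1. Qed.

Lemma dgcompB i : {morph dgcomp i : u v / u - v}.
Proof.
move=> u v; have [s s_uniq uE] := dgcomp_sum u; have [t t_uniq vE] := dgcomp_sum v.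
have grow w (r : seq I) : w = \sum_(j <- r) dgcomp j w -> uniq r -> forall r' : seq I,
    uniq r' -> {subset r <= r'} -> w = \sum_(j <- r') dgcomp j w.
  move=> wE r_uniq r' r'_uniq sub; rewrite {1}wE.
  rewrite [RHS](bigID (mem r)) /= [X in _ + X]big1 ?addr0; last first.
    move=> j jr; rewrite (dgcompE _ r_uniq (fun l => dgcomp_hom l w) wE).
    by rewrite (negbTE jr).
  rewrite -[RHS]big_filter; apply: perm_big; apply: uniq_perm; rewrite ?filter_uniq //.
  by move=> j; rewrite mem_filter andb_idr // => /sub.
pose r := undup (i :: s ++ t); have r_uniq : uniq r by apply: undup_uniq.
rewrite (@dgcompE (u - v) r (fun j => dgcomp j u - dgcomp j v)) //.
- by rewrite mem_undup inE eqxx.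
- by move=> j; apply: GB; apply: dgcomp_hom.
- rewrite sumrB; congr (_ - _); [apply: (grow u s) | apply: (grow v t)] => // j jt;
    by rewrite mem_undup inE mem_cat jt ?orbT.
Qed.

Lemma dgcomp0 i : dgcomp i 0 = 0.
Proof. by have := dgcompB i 0 0; rewrite !subrr. Qed.

Lemma dgcompN i : {morph dgcomp i : u / - u}.
Proof. by move=> u; rewrite -[- u]add0r dgcompB dgcomp0 add0r. Qed.

Lemma dgcompD i : {morph dgcomp i : u v / u + v}.
Proof. by move=> u v; rewrite -{1}[v]opprK dgcompB dgcompN opprK. Qed.

End DirectGrading.

Section GradedAlgebra.
Variables (k : fieldType) (A : gralg k).
Implicit Types (u v : A) (n : nat).

Lemma hom0 n : hom n (0 : A). Proof. by case: (gr_direct A). Qed.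
Lemma homD n u v : hom n u -> hom n v -> hom n (u + v).
Proof. exact: dgD (gr_direct A) _ _ _. Qed.
Lemma homB n u v : hom n u -> hom n v -> hom n (u - v).
Proof. by case: (gr_direct A) => _ + _ _; apply. Qed.
Lemma homN n u : hom n u -> hom n (- u).
Proof. exact: dgN (gr_direct A) _ _. Qed.
Lemma homZ n (c : k) u : hom n u -> hom n (c *: u). Proof. exact: gr_scale. Qed.

Definition hcomp n u : A := dgcomp (gr_direct A) n u.

Lemma hcomp_hom n u : hom n (hcomp n u).
Proof. exact: (dgcomp_hom (gr_direct A)). Qed.

Lemma hcomp_id m n u : hom m u -> hcomp n u = if n == m then u else 0.
Proof. exact: dgcomp_id. Qed.

Lemma hcomp_eq0 u : (forall n, hcomp n u = 0) -> u = 0.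
Proof. exact: dgcomp_eq0. Qed.

Lemma hcomp_sum u : exists2 s : seq nat, uniq s & u = \sum_(i <- s) hcomp i u.
Proof. exact: dgcomp_sum. Qed.

Lemma hcomp_linear n : linear (hcomp n).
Proof.
move=> c u v; rewrite /hcomp dgcompD; congr (_ + _).
have [s s_uniq uE] := dgcomp_sum (gr_direct A) u.
rewrite (@dgcompE _ _ _ (gr_direct A) (c *: u) s (fun i => c *: hcomp i u)) //.
- rewrite (dgcompE (gr_direct A) n s_uniq (fun i => hcomp_hom i u) uE).
  by case: ifP; rewrite ?scaler0.
- by move=> j; apply/homZ/hcomp_hom.
- by rewrite {1}uE scaler_sumr.
Qed.
HB.instance Definition _ n := GRing.isLinear.Build k A A _ (hcomp n) (hcomp_linear n).

Lemma hcomp_bound u : exists N, forall n, (N <= n)%N -> hcomp n u = 0.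
Proof.
have [s s_uniq uE] := hcomp_sum u.
exists (\max_(i <- s) i.+1)%N => n le_n.
rewrite /hcomp (dgcompE (gr_direct A) n s_uniq (fun i => hcomp_hom i u) uE).
case: ifP => // n_s; move: le_n; rewrite leqNgt.
by rewrite (@leq_bigmax_seq _ s xpredT (fun i => i.+1) n n_s).
Qed.

Lemma hcomp_sum_ord u N : (forall n, (N <= n)%N -> hcomp n u = 0) ->
  u = \sum_(i < N) hcomp i u.
Proof.
move=> uN; apply/eqP; rewrite -subr_eq0; apply/eqP/hcomp_eq0 => n.
rewrite linearB linear_sum /=.
under eq_bigr => i _ do rewrite (hcomp_id _ (hcomp_hom i u)).
have [lt_n|le_n] := ltnP n N; last first.
  rewrite uN // big1 ?subrr // => i _; case: eqP => // ni.
  by have := ltn_ord i; rewrite -ni ltnNge le_n.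
rewrite (bigD1 (Ordinal lt_n)) //= eqxx big1 ?addr0 ?subrr // => i.
by rewrite -val_eqE eq_sym /= => /negbTE ->.
Qed.

Lemma hcompMr m n u v : hom n v -> hcomp (m + n) (u * v) = hcomp m u * v.
Proof.
move=> hv; have [N /hcomp_sum_ord ->] := hcomp_bound u.
rewrite mulr_suml !linear_sum mulr_suml; apply: eq_bigr => i _ /=.
rewrite (hcomp_id _ (gr_mul (hcomp_hom i u) hv)) (hcomp_id _ (hcomp_hom i u)).
by rewrite eqn_add2r; case: ifP; rewrite ?mul0r.
Qed.

Lemma hcompMr_small m n u v : hom n v -> (m < n)%N -> hcomp m (u * v) = 0.
Proof.
move=> hv lt_mn; have [N /hcomp_sum_ord ->] := hcomp_bound u.
rewrite mulr_suml linear_sum big1 // => i _ /=.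
rewrite (hcomp_id _ (gr_mul (hcomp_hom i u) hv)).
by rewrite ltn_eqF // (leq_trans lt_mn) ?leq_addl.
Qed.
End GradedAlgebra.

(** * Algebras given by generators and relations *)

Section Presented.
Variables (k : fieldType) (I : choiceType) (R : free_alg k I -> Prop).
Variables (A : gralg k) (g : I -> A) (deg : I -> nat).
Hypothesis presA : presented deg R g.

Definition plift (u : A) : free_alg k I :=
  projT1 (cid (let: And3 _ H _ := presA in H u)).

Lemma pliftK u : free_eval g (plift u) = u.
Proof. by rewrite /plift; case: cid. Qed.

Lemma pres_hom i : hom (deg i) (g i). Proof. by case: presA. Qed.

Lemma pres_eq0 p : free_eval g p = 0 <-> ideal_gen R p. Proof. by case: presA. Qed.

Lemma pres_rel p : R p -> free_eval g p = 0.
Proof. by move=> Rp; apply/pres_eq0/ideal_gen_sub. Qed.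

Lemma pres_ind (P : A -> Prop) :
  P 1 -> (forall c u v, P u -> P v -> P (c *: u + v)) ->
  (forall u i, P u -> P (u * g i)) -> forall u, P u.
Proof.
move=> P1 Plin Pg u; rewrite -(pliftK u).
elim/free_ind: (plift u) => [|c p q IHp IHq|p i IH].
- by rewrite rmorph1.
- by rewrite linearP; apply: Plin.
- by rewrite rmorphM /= free_eval_gen; apply: Pg.
Qed.

Section Action.
Variables (V : lmodType k) (rho : I -> V -> V).
Hypotheses (rho_lin : forall i, linear (rho i)).
Hypothesis rhoR : forall s v, R s -> free_act rho s v = 0.

Definition pact (u : A) (v : V) : V := free_act rho (plift u) v.

(** Two lifts of an element of [A] differ by an element of the ideal, and this acts as zero because
    the relations do. *)
Lemma pact_eval p v : pact (free_eval g p) v = free_act rho p v.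
Proof.
rewrite /pact; set q := plift _.
have /pres_eq0 idq : free_eval g (q - p) = 0 by rewrite linearB /= pliftK subrr.
rewrite -[q](subrK p) -[q - p]scale1r free_act_linearl scale1r.
rewrite (_ : free_act rho (q - p) v = 0) ?add0r //.
apply: (free_act_ideal rho_lin (S := fun v => v = 0)) idq => //.
- by move=> a b -> ->; rewrite addr0.
- by move=> c a ->; rewrite scaler0.
- by move=> i a ->; apply/linear_fun0/rho_lin.
Qed.

Lemma pact_linearl v : linear (pact^~ v).
Proof.
move=> c u1 u2; rewrite -(pliftK u1) -(pliftK u2) -linearP !pact_eval.
exact: free_act_linearl.
Qed.

Lemma pact1 v : pact 1 v = v.
Proof. by rewrite -(rmorph1 (free_eval g)) pact_eval free_act1. Qed.

Lemma pactM u1 u2 v : pact (u1 * u2) v = pact u2 (pact u1 v).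
Proof.
by rewrite -{1}(pliftK u1) -{1}(pliftK u2) -rmorphM pact_eval free_actM.
Qed.

Lemma pact_gen i v : pact (g i) v = rho i v.
Proof. by rewrite -(free_eval_gen g i) pact_eval free_act_gen. Qed.
End Action.

(** The map is the orbit of 1 when [A] acts on [A'] by right multiplication through [h]. *)
Lemma pres_alg_map (A' : algType k) (h : I -> A') :
  (forall s, R s -> free_eval h s = 0) ->
  exists f : {lrmorphism A -> A'}, forall i, f (g i) = h i.
Proof.
move=> hR; pose rho i (v : A') := v * h i.
have rho_lin i : linear (rho i) by move=> c u v; rewrite /rho mulrDl scalerAl.
have rhoR s v : R s -> free_act rho s v = 0.
  by move=> Rs; rewrite free_act_mul hR ?mulr0.
pose f u := pact rho u 1.
have fE p : f (free_eval g p) = free_eval h p.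
  by rewrite /f (pact_eval rho_lin rhoR) free_eval_act.
have flin : linear f by apply: pact_linearl.
have fmul : monoid_morphism f.
  split; first by rewrite -(rmorph1 (free_eval g)) fE rmorph1.
  by move=> u v; rewrite -(pliftK u) -(pliftK v) -rmorphM !fE rmorphM.
pose fL := GRing.isLinear.Build k A A' _ f flin.
pose fM := GRing.isMonoidMorphism.Build A A' f fmul.
pose F : {lrmorphism A -> A'} := HB.pack f fL fM.
by exists F => i; rewrite /= -(free_eval_gen g i) fE free_eval_gen.
Qed.
End Presented.

(** * The algebra B *)

Section RelB.
Variables (k : fieldType) (a : k).

Definition op3 (T : Type) (X Y Z : T) (i : 'I_3) : T :=
  match val i with 0%N => X | 1%N => Y | _ => Z end.

Lemma op3_0 (T : Type) (X Y Z : T) : op3 X Y Z (inord 0) = X.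
Proof. by rewrite /op3 /= inordK. Qed.
Lemma op3_1 (T : Type) (X Y Z : T) : op3 X Y Z (inord 1) = Y.
Proof. by rewrite /op3 /= inordK. Qed.
Lemma op3_2 (T : Type) (X Y Z : T) : op3 X Y Z (inord 2) = Z.
Proof. by rewrite /op3 /= inordK. Qed.

Lemma ord3_ind (P : 'I_3 -> Prop) :
  P (inord 0) -> P (inord 1) -> P (inord 2) -> forall i, P i.
Proof.
move=> P0 P1 P2 [[|[|[|//]]] lt_i].
- by rewrite (_ : Ordinal _ = inord 0) //; apply/val_inj; rewrite /= inordK.
- by rewrite (_ : Ordinal _ = inord 1) //; apply/val_inj; rewrite /= inordK.
- by rewrite (_ : Ordinal _ = inord 2) //; apply/val_inj; rewrite /= inordK.
Qed.

Lemma op3E (T : Type) (f : 'I_3 -> T) :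
  op3 (f (inord 0)) (f (inord 1)) (f (inord 2)) =1 f.
Proof. by elim/ord3_ind; rewrite ?op3_0 ?op3_1 ?op3_2. Qed.

Local Notation F3 := (free_alg k 'I_3).
Local Notation gx := (gen (inord 0) : F3).
Local Notation gy := (gen (inord 1) : F3).
Local Notation gz := (gen (inord 2) : F3).

Definition relB_poly1 : F3 := (gx * gy + gy * gx) - (gz * gz - gy * gy).
Definition relB_poly2 : F3 := (gx * gy + gy * gx) - (a *: (gz * gz) - gx * gx).
Definition relB_poly3 : F3 := (gz * gx - gx * gz) - a *: (gy * gz - gz * gy).

Section Act.
Variables (V : lmodType k) (X Y Z : V -> V).
Hypotheses (Xlin : linear X) (Ylin : linear Y) (Zlin : linear Z).

Lemma op3_linear i : linear (op3 X Y Z i).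
Proof. by move: i; apply: ord3_ind; rewrite ?op3_0 ?op3_1 ?op3_2. Qed.

Lemma relB_act_poly v :
  [/\ free_act (op3 X Y Z) relB_poly1 v = Y (X v) + X (Y v) - (Z (Z v) - Y (Y v)),
      free_act (op3 X Y Z) relB_poly2 v = Y (X v) + X (Y v) - (a *: Z (Z v) - X (X v))
    & free_act (op3 X Y Z) relB_poly3 v = X (Z v) - Z (X v) - a *: (Z (Y v) - Y (Z v))].
Proof.
have subE p q : free_act (op3 X Y Z) (p - q) v
    = free_act (op3 X Y Z) p v - free_act (op3 X Y Z) q v.
  by rewrite [p - q]addrC -[- q]scaleN1r free_act_linearl scaleN1r addrC.
have addE p q : free_act (op3 X Y Z) (p + q) v
    = free_act (op3 X Y Z) p v + free_act (op3 X Y Z) q v.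
  by rewrite -[p]scale1r free_act_linearl !scale1r.
have scaleE c p : free_act (op3 X Y Z) (c *: p) v
    = c *: free_act (op3 X Y Z) p v.
  by rewrite -[c *: p]addr0 free_act_linearl free_act0l !addr0.
(* The values of the monomials are passed as equations because rewriting with
   products of generators makes the unifier unfold them. *)
have mulE (i j : 'I_3) u u' : op3 X Y Z i v = u -> op3 X Y Z j u = u' ->
    free_act (op3 X Y Z) ((gen i : free_alg k 'I_3) * (gen j : free_alg k 'I_3)) v = u'.
  by move=> <- <-; rewrite (free_actM op3_linear) !free_act_gen.
have e1 p q r t P Q U T : free_act (op3 X Y Z) p v = P ->
    free_act (op3 X Y Z) q v = Q -> free_act (op3 X Y Z) r v = U ->
    free_act (op3 X Y Z) t v = T ->
    free_act (op3 X Y Z) ((p + q) - (r - t)) v = P + Q - (U - T).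
  by move=> <- <- <- <-; rewrite !subE addE.
have e1a p q r t P Q U T : free_act (op3 X Y Z) p v = P ->
    free_act (op3 X Y Z) q v = Q -> free_act (op3 X Y Z) r v = U ->
    free_act (op3 X Y Z) t v = T ->
    free_act (op3 X Y Z) ((p + q) - (a *: r - t)) v = P + Q - (a *: U - T).
  by move=> <- <- <- <-; rewrite !subE addE scaleE.
have e2 p q r t P Q U T : free_act (op3 X Y Z) p v = P ->
    free_act (op3 X Y Z) q v = Q -> free_act (op3 X Y Z) r v = U ->
    free_act (op3 X Y Z) t v = T ->
    free_act (op3 X Y Z) ((p - q) - a *: (r - t)) v = P - Q - a *: (U - T).
  by move=> <- <- <- <-; rewrite !subE scaleE subE.
have m0 u : op3 X Y Z (inord 0) u = X u by rewrite op3_0.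
have m1 u : op3 X Y Z (inord 1) u = Y u by rewrite op3_1.
have m2 u : op3 X Y Z (inord 2) u = Z u by rewrite op3_2.
split.
- exact: e1 (mulE _ _ _ _ (m0 _) (m1 _)) (mulE _ _ _ _ (m1 _) (m0 _))
    (mulE _ _ _ _ (m2 _) (m2 _)) (mulE _ _ _ _ (m1 _) (m1 _)).
- exact: e1a (mulE _ _ _ _ (m0 _) (m1 _)) (mulE _ _ _ _ (m1 _) (m0 _))
    (mulE _ _ _ _ (m2 _) (m2 _)) (mulE _ _ _ _ (m0 _) (m0 _)).
- exact: e2 (mulE _ _ _ _ (m2 _) (m0 _)) (mulE _ _ _ _ (m0 _) (m2 _))
    (mulE _ _ _ _ (m1 _) (m2 _)) (mulE _ _ _ _ (m2 _) (m1 _)).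
Qed.

Lemma relB_act_mod (S : V -> Prop) :
  (forall v, S (Y (X v) + X (Y v) - (Z (Z v) - Y (Y v)))) ->
  (forall v, S (Y (X v) + X (Y v) - (a *: Z (Z v) - X (X v)))) ->
  (forall v, S (X (Z v) - Z (X v) - a *: (Z (Y v) - Y (Z v)))) ->
  forall s v, relB a s -> S (free_act (op3 X Y Z) s v).
Proof.
move=> S1 S2 S3 s v; have [E1 E2 E3] := relB_act_poly v.
by case=> ->; [have := S1 v; rewrite -E1 | have := S2 v; rewrite -E2
  | have := S3 v; rewrite -E3].
Qed.

Lemma relB_act :
  (forall v, Y (X v) + X (Y v) = Z (Z v) - Y (Y v)) ->
  (forall v, Y (X v) + X (Y v) = a *: Z (Z v) - X (X v)) ->
  (forall v, X (Z v) - Z (X v) = a *: (Z (Y v) - Y (Z v))) ->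
  forall s v, relB a s -> free_act (op3 X Y Z) s v = 0.
Proof.
move=> H1 H2 H3; apply: (relB_act_mod (S := fun v => v = 0)) => v.
- by rewrite H1 subrr.
- by rewrite H2 subrr.
- by rewrite H3 subrr.
Qed.
End Act.

(* With w = x + a y the relations of B become zw = wz, w^2 = e z^2 + b y^2 and
   wy + yw = z^2 + e y^2. *)
Definition eB : k := 2%:R * a - 1.
Definition bB : k := a ^+ 2 - a + 1.

(** Actions of the algebra are constructed from an operator for [w], for which the relations are
    simpler; the operator of [x] is then recovered from [x = w - a y]. *)
Lemma relB_actW (V : lmodType k) (W Y Z : V -> V) :
  linear W -> linear Y -> linear Z ->
  (forall v, W (Z v) = Z (W v)) ->
  (forall v, W (W v) = eB *: Z (Z v) + bB *: Y (Y v)) ->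
  (forall v, Y (W v) + W (Y v) = Z (Z v) + eB *: Y (Y v)) ->
  let X v := W v - a *: Y v in
  linear X /\ forall s v, relB a s -> free_act (op3 X Y Z) s v = 0.
Proof.
move=> Wlin Ylin Zlin H1 H2 H3 X.
have Xlin : linear X.
  by move=> c u v; rewrite /X Wlin Ylin; lin_over k V.
have WE (v : V) c u : W (v - c *: u) = W v - c *: W u.
  by rewrite [v - _]addrC -[- (c *: u)]scaleNr Wlin scaleNr addrC.
have YE (v : V) c u : Y (v - c *: u) = Y v - c *: Y u.
  by rewrite [v - _]addrC -[- (c *: u)]scaleNr Ylin scaleNr addrC.
have ZE (v : V) c u : Z (v - c *: u) = Z v - c *: Z u.
  by rewrite [v - _]addrC -[- (c *: u)]scaleNr Zlin scaleNr addrC.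
have {}H3 v : W (Y v) = Z (Z v) + eB *: Y (Y v) - Y (W v).
  by rewrite -H3; lin_over k V.
split=> //; apply: relB_act => // v; rewrite /X ?(WE, YE, ZE) ?H1 ?H2 ?H3 /eB /bB;
  lin_over k V.
Qed.
End RelB.

Section AlgebraB.
Variables (k : fieldType) (a : k) (B : gralg k) (xyz : 'I_3 -> B).
Hypothesis presB : presented (fun=> 1%N) (relB a) xyz.
Local Notation e := (eB a).
Local Notation b := (bB a).

Definition xB : B := xyz (inord 0).
Definition yB : B := xyz (inord 1).
Definition zB : B := xyz (inord 2).
Definition wB : B := xB + a *: yB.
Definition vB : B := wB - e *: yB.
Local Notation x := xB.
Local Notation y := yB.
Local Notation z := zB.
Local Notation w := wB.
Local Notation w' := vB.

Lemma hom_x : hom 1 x. Proof. exact: pres_hom presB _. Qed.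
Lemma hom_y : hom 1 y. Proof. exact: pres_hom presB _. Qed.
Lemma hom_z : hom 1 z. Proof. exact: pres_hom presB _. Qed.
Lemma hom_w : hom 1 w. Proof. exact/(homD hom_x)/homZ/hom_y. Qed.
Lemma hom_w' : hom 1 w'. Proof. exact/(homB hom_w)/homZ/hom_y. Qed.

Let xyz_act (s : free_alg k 'I_3) : relB a s ->
  free_act (op3 (fun u => u * x) (fun u => u * y) (fun u => u * z)) s (1 : B) = 0.
Proof.
move=> /(pres_rel presB); rewrite free_eval_act => <-; congr (free_act _ s 1).
apply: funext => i; rewrite -(op3E xyz i); move: i.
by apply: ord3_ind; rewrite ?op3_0 ?op3_1 ?op3_2.
Qed.

Let mul_lin (u : B) : linear (fun v : B => v * u).
Proof. by move=> c v1 v2; rewrite mulrDl scalerAl. Qed.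

Lemma relB1 : x * y + y * x = z * z - y * y.
Proof.
have [E _ _] := relB_act_poly a (mul_lin x) (mul_lin y) (mul_lin z) 1.
apply/eqP; rewrite -subr_eq0; apply/eqP.
have /xyz_act : relB a (relB_poly1 k) by apply: Or31.
by rewrite E !mul1r.
Qed.

Lemma relB2 : x * y + y * x = a *: (z * z) - x * x.
Proof.
have [_ E _] := relB_act_poly a (mul_lin x) (mul_lin y) (mul_lin z) 1.
apply/eqP; rewrite -subr_eq0; apply/eqP.
have /xyz_act : relB a (relB_poly2 a) by apply: Or32.
by rewrite E !mul1r.
Qed.

Lemma relB3 : z * x - x * z = a *: (y * z - z * y).
Proof.
have [_ _ E] := relB_act_poly a (mul_lin x) (mul_lin y) (mul_lin z) 1.
apply/eqP; rewrite -subr_eq0; apply/eqP.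
have /xyz_act : relB a (relB_poly3 a) by apply: Or33.
by rewrite E !mul1r.
Qed.

Lemma relB_xx : x * x = (a - 1) *: (z * z) + y * y.
Proof. by rewrite -[x * x](subKr (a *: (z * z))) -relB2 relB1; lin_over k B. Qed.

Lemma relB_wz : z * w = w * z.
Proof.
rewrite /w; expand_words.
rewrite -[z * x](subrK (x * z)) relB3; lin_over k B.
Qed.

Lemma relB_ww : w * w = e *: (z * z) + b *: (y * y).
Proof.
rewrite /w; expand_words.
rewrite -[y * x](addKr (x * y)) relB1 relB_xx /e /b; lin_over k B.
Qed.

Lemma relB_wy : y * w = z * z + e *: (y * y) - w * y.
Proof.
rewrite /w; expand_words; rewrite -[y * x](addKr (x * y)) relB1 /e; lin_over k B.
Qed.

Lemma relB_w'w' : w' * w' = b *: (y * y).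
Proof.
move: relB_ww relB_wy; rewrite /w'; move: wB => u uu yu.
expand_words; rewrite uu yu /e /b; lin_over k B.
Qed.

Lemma relB_yw' : y * w' = z * z - e *: (y * y) - w' * y.
Proof.
move: relB_wy; rewrite /w'; move: wB => u yu.
by expand_words; rewrite yu; lin_over k B.
Qed.

Lemma relB_yw : y * w + w' * y = z * z.
Proof.
move: relB_wy; rewrite /w'; move: wB => u yu.
by expand_words; rewrite yu; lin_over k B.
Qed.

Lemma xE : x = w' + (a - 1) *: y.
Proof. by rewrite /w' /w /e; lin_over k B. Qed.

Lemma relB_zw' : w' * z = z * w' - e *: (y * z - z * y).
Proof.
move: relB_wz; rewrite /w'; move: wB => u zu.
by expand_words; rewrite zu; lin_over k B.
Qed.

Lemma B_ind (P : B -> Prop) :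
  P 1 -> (forall c u v, P u -> P v -> P (c *: u + v)) ->
  (forall u, P u -> P (u * w')) -> (forall u, P u -> P (u * y)) ->
  (forall u, P u -> P (u * z)) -> forall u, P u.
Proof.
move=> P1 Plin Pw Py Pz; apply: (pres_ind presB) => // u i Pu; move: i.
apply: ord3_ind; rewrite -/x -/y -/z; [|exact: Py|exact: Pz].
by rewrite xE mulrDr -scalerAr addrC; apply: Plin; [apply: Py|apply: Pw].
Qed.

(** Reversing words preserves the first two relations and changes the sign of both sides of the
    third. Left multiplications by [x], [y], [z] therefore define a right action of [B] on itself,
    and [f] is its orbit map at 1. *)
Lemma antiaut_exists : exists f : {linear B -> B},
  [/\ f x = x, f y = y, f z = z, forall u v, f (u * v) = f v * f u & involutive f].
Proof.
pose X (v : B) := x * v; pose Y (v : B) := y * v; pose Z (v : B) := z * v.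
have lin (u : B) : linear (fun v => u * v) by move=> c v1 v2; rewrite mulrDr scalerAr.
have Xlin : linear X by exact: lin.
have Ylin : linear Y by exact: lin.
have Zlin : linear Z by exact: lin.
have actR s v : relB a s -> free_act (op3 X Y Z) s v = 0.
  move: s v; apply: relB_act => // v; rewrite /X /Y /Z !mulrA.
  - by rewrite -mulrDl addrC relB1 mulrBl.
  - by rewrite -mulrDl addrC relB2 mulrBl -scalerAl.
  - rewrite -!mulrBl [RHS]scalerAl; congr (_ * _).
    by rewrite -[LHS]opprB relB3; lin_over k B.
pose rho := op3 X Y Z; have rho_lin i : linear (rho i) by exact: op3_linear.
pose f u := pact presB rho u 1.
have f1 : f 1 = 1 by exact: pact1.
have rhoE i v : rho i v = xyz i * v.
  by rewrite /rho; move: i; apply: ord3_ind; rewrite ?op3_0 ?op3_1 ?op3_2.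
have fg u i : f (u * xyz i) = xyz i * f u.
  by rewrite /f pactM // pact_gen // rhoE.
have f_lin : linear f by exact: pact_linearl.
(* In this action [u] operates as left multiplication by [f u], which is why [f] reverses
   products. *)
have f_act u v : pact presB rho u v = f u * v.
  elim/(pres_ind presB): u => [|c u1 u2 IH1 IH2|u i IH].
  - by rewrite f1 mul1r pact1.
  - by rewrite pact_linearl // IH1 IH2 f_lin mulrDl scalerAl.
  - by rewrite fg pactM // pact_gen // IH rhoE mulrA.
have fM u v : f (u * v) = f v * f u by rewrite {1}/f pactM // f_act.
have fx i : f (xyz i) = xyz i by rewrite -[xyz i]mul1r fg f1 mulr1 mul1r.
pose F : {linear B -> B} := HB.pack f (GRing.isLinear.Build k B B _ f f_lin).
exists F; split; [exact: fx | exact: fx | exact: fx | exact: fM |].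
move=> u; elim/(pres_ind presB): u => [|c u1 u2 IH1 IH2|u i IH].
- by rewrite /= !f1.
- by rewrite /= !f_lin; congr (_ *: _ + _).
- by rewrite /= fg fM fx; congr (_ * _).
Qed.
End AlgebraB.

(** * Exponential growth when [b = 0] *)

Lemma expn_dominates (c e : nat) : exists n, (c * n.+1 ^ e < 2 ^ n)%N.
Proof.
(* For [n + 1 = 2^m] the left side is [c * 2^(m e) < 2^(c + m e)]. It remains that [c + m e < 2^m],
   and [2^m = (2^j)^2] is at least [(j + 1)^2], which suffices for this [j]. *)
pose j := (c + 2 * e)%N; pose m := (2 * j)%N; exists (2 ^ m).-1.
rewrite prednK ?expn_gt0 // -expnM.
have lt_c : (c < 2 ^ c)%N by exact: ltn_expl.
have le_exp : (c + m * e <= (2 ^ m).-1)%N.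
  rewrite -ltnS prednK ?expn_gt0 // (_ : 2 ^ m = (2 ^ j) ^ 2)%N; last by rewrite -expnM mulnC.
  have lt_j : (j.+1 <= 2 ^ j)%N by exact: ltn_expl.
  apply: (@leq_trans (j.+1 ^ 2)); last by rewrite leq_exp2r.
  rewrite !expnS expn0 muln1 /m /j; nia.
apply: (@leq_trans (2 ^ (c + m * e))); last by rewrite leq_exp2l.
by rewrite expnD ltn_pmul2r // expn_gt0.
Qed.

(** The functionals in [f] are dual to the family [h], so the identity matrix of size [#|T|] factors
    as [C *m S] through dimension [N]. *)
Lemma spanning_size (k : fieldType) (V : lmodType k) (T : finType) (N : nat)
    (s : 'I_N -> V) (f : {linear V -> {ffun T -> k^o}}) (h : T -> V) :
  (forall t, exists c : 'I_N -> k, h t = \sum_(i < N) c i *: s i) ->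
  (forall t t', f (h t) t' = (t == t')%:R) -> (#|T| <= N)%N.
Proof.
move=> span fh.
pose C := \matrix_(i < #|T|, j < N) projT1 (cid (span (enum_val i))) j.
pose S := \matrix_(j < N, i < #|T|) (f (s j) (enum_val i) : k).
have CS : C *m S = 1%:M.
  apply/matrixP => i j; rewrite !mxE.
  under eq_bigr => l _ do rewrite !mxE.
  have := fh (enum_val i) (enum_val j); rewrite (inj_eq enum_val_inj) => <-.
  case: (cid _) => c /= E; rewrite {1}E linear_sum sum_ffunE.
  by apply: eq_bigr => l _; rewrite linearZ ffunE.
have := mxrank1 k #|T|; rewrite -CS => <-.
by apply: leq_trans (mxrankM_maxl _ _) (rank_leq_col _).
Qed.

Definition free_algT (k : fieldType) (I : choiceType) : algType k :=
  HB.pack {malg k[{fmonom I}]}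
    (GRing.Lalgebra_isAlgebra.Build k {malg k[{fmonom I}]}
      (fun c p q => esym (malg_scalerAr c p q))).

Section DegenerateB.
Variables (k : fieldType) (a : k) (B : gralg k) (xyz : 'I_3 -> B).
Hypothesis presB : presented (fun=> 1%N) (relB a) xyz.
Hypothesis b0 : bB a = 0.
Local Notation e := (eB a).

(* B acts on the right of A^2 by the matrices
   y = [[y, P], [0, -y]], z = [[z, 0], [0, z]], w = [[0, e z^2], [1, 0]],
   where P = z^2 + e y^2. *)
Lemma degenerate_B_map (A : algType k) (y z : A) :
  exists f : {linear B -> A}, [/\ f 1 = 1,
    forall u, f (u * yB xyz) = f u * y & forall u, f (u * zB xyz) = f u * z].
Proof.
pose P := z * z + e *: (y * y).
pose W (v : A * A) : A * A := (v.2, e *: (v.1 * (z * z))).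
pose Y (v : A * A) : A * A := (v.1 * y, v.1 * P - v.2 * y).
pose Z (v : A * A) : A * A := (v.1 * z, v.2 * z).
have pair_eq (u v : A * A) : u.1 = v.1 -> u.2 = v.2 -> u = v.
  by case: u v => ? ? [? ?] /= -> ->.
have Wlin : linear W.
  by move=> c u v; apply: pair_eq; rewrite //= ; expand_words; lin_over k A.
have Ylin : linear Y.
  by move=> c u v; apply: pair_eq; rewrite //= ; expand_words; lin_over k A.
have Zlin : linear Z.
  by move=> c u v; apply: pair_eq; rewrite //= ; expand_words; lin_over k A.
have [||| Xlin XR] := @relB_actW k a _ W Y Z Wlin Ylin Zlin.
- by move=> v; apply: pair_eq; rewrite //= ; expand_words; lin_over k A.
(* [W] squares to right multiplication by [e z^2], so this relation forces [b = 0]. *)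
- by move=> v; rewrite b0; apply: pair_eq; rewrite //= ; expand_words; lin_over k A.
- by move=> v; apply: pair_eq; rewrite //= /P; expand_words; lin_over k A.
set X := fun v => _ in Xlin XR.
(* On first components [Y] and [Z] are right multiplication by [y] and [z], whatever the second
   component is, so [f] intertwines them for every [u]. *)
pose f u := (pact presB (op3 X Y Z) u (1, 0)).1.
have rho_lin i := op3_linear Xlin Ylin Zlin i.
have f_lin : linear f by move=> c u v; rewrite /f pact_linearl.
pose F : {linear B -> A} := HB.pack f (GRing.isLinear.Build k B A _ f f_lin).
exists F; split=> [|u|u]; rewrite /= /f.
- by rewrite pact1.
- by rewrite pactM // pact_gen // op3_1.
- by rewrite pactM // pact_gen // op3_2.
Qed.

Lemma degenerate_B_dim n N : dim_le B n N -> (2 ^ n <= N)%N.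
Proof.
case=> s [s_hom s_span].
have [f [f1 fy fz]] := @degenerate_B_map (free_algT k bool) (gen false) (gen true).
pose h (t : seq bool) := foldl (fun u c => u * (if c then zB xyz else yB xyz)) 1 t.
have fh t : f (h t) = word k t.
  elim/last_ind: t => [|t c IH]; first by rewrite /h /= f1 -word0.
  rewrite /h -cats1 foldl_cat /= -/(h t) cats1 word_rcons.
  by case: c; rewrite ?fy ?fz IH.
have hhom t : hom (size t) (h t).
  elim/last_ind: t => [|t c IH]; first exact: gr_one.
  rewrite /h -cats1 foldl_cat /= -/(h t) size_cat; apply: gr_mul => //.
  by case: c; exact: (pres_hom presB).
pose g u : {ffun n.-tuple bool -> k^o} :=
  [ffun t : n.-tuple bool => ((f u : free_alg k bool)@_(FMonom t) : k^o)].
have g_lin : linear g.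
  move=> c u v; apply/ffunP => t; rewrite !ffunE linearP.
  by rewrite (mcoeffD _ (c *: _)) mcoeffZ.
pose G : {linear B -> {ffun n.-tuple bool -> k^o}} :=
  HB.pack g (GRing.isLinear.Build k B _ _ g g_lin).
have := @spanning_size k B _ N s G (fun t => h t); rewrite card_tuple card_bool.
apply=> [t|t t']; first by apply: s_span; rewrite -[X in hom X](size_tuple t).
by rewrite /= /g ffunE fh /word mcoeffU1.
Qed.

Lemma degenerate_B_growth : ~ polynomial_growth B.
Proof.
move=> [c [e' H]]; have [n] := expn_dominates c e'.
by rewrite ltnNge => /negP; apply; apply/degenerate_B_dim/H.
Qed.
End DegenerateB.

(** * Normal form of the elements of B when [b != 0] *)

(* B is free over S = k[T,Z,Y], Z = z^2, Y = y^2, T = yz + zy, on the monomials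
   1, y, z, zy, w', yw', zw', zyw', in this order of coordinates. *)

Section Model.
Variables (S : comNzRingType) (Y Z T e b : S).
Local Notation oct := 'rV[S]_8.

Definition co (i : nat) (m : oct) : S := m ord0 (inord i).
Definition mk8 (s : seq S) : oct := \row_(i < 8) nth 0 s i.
Definition cos (m : oct) : seq S := [seq co i m | i <- iota 0 8].

Lemma co_mk8 i s : (i < 8)%N -> co i (mk8 s) = nth 0 s i.
Proof. by move=> lt_i; rewrite /co mxE inordK. Qed.

Lemma coD i m n : co i (m + n) = co i m + co i n. Proof. by rewrite /co mxE. Qed.
Lemma coZ i c m : co i (c *: m) = c * co i m. Proof. by rewrite /co mxE. Qed.

Lemma cosK m : mk8 (cos m) = m.
Proof.
apply/rowP => i; rewrite mxE (nth_map 0%N) ?size_iota // nth_iota //.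
by rewrite /co add0n inord_val.
Qed.

Lemma mk8K s : size s = 8%N -> cos (mk8 s) = s.
Proof.
move=> size_s; apply: (@eq_from_nth _ 0); rewrite ?size_map ?size_iota // => i lt_i.
by rewrite (nth_map 0%N) ?size_iota // nth_iota // add0n co_mk8.
Qed.

Lemma octP m : exists c0 c1 c2 c3 c4 c5 c6 c7,
  m = mk8 [:: c0; c1; c2; c3; c4; c5; c6; c7].
Proof. by rewrite -(cosK m); do 8!eexists. Qed.

Lemma mk8Z c s : c *: mk8 s = mk8 [seq c * u | u <- s].
Proof.
apply/rowP => i; rewrite !mxE; have [lt_i|le_i] := ltnP i (size s).
  by rewrite (nth_map 0).
by rewrite !nth_default ?size_map // mulr0.
Qed.

Lemma mk8D s t : size s = size t ->
  mk8 s + mk8 t = mk8 [seq u.1 + u.2 | u <- zip s t].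
Proof.
move=> sizes; apply/rowP => i; rewrite !mxE; have [lt_i|le_i] := ltnP i (size s).
  by rewrite (nth_map (0, 0)) ?nth_zip //= size_zip -sizes minnn.
by rewrite !nth_default ?size_map ?size_zip -?sizes ?minnn // addr0.
Qed.

Local Notation "s `_ i" := (nth 0 s i).

(** Right multiplication by [y] in coordinates, with [w'] written [v]: it comes from
    [vy = Z - eY - yv]. Likewise [cos_z] comes from [yz = T - zy] and [vz = zv - e(T - 2zy)], and
    [cos_v] from [vv = bY]. *)
Definition cos_y (s : seq S) : seq S :=
  [:: Y * s`_1 + (Z - e * Y) * s`_4; s`_0 + (Z - e * Y) * s`_5;
      Y * s`_3 + (Z - e * Y) * s`_6; s`_2 + (Z - e * Y) * s`_7;
      - (Y * s`_5); - s`_4; - (Y * s`_7); - s`_6].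
Definition cos_z (s : seq S) : seq S :=
  [:: T * s`_1 + Z * s`_2 - e * (T * s`_4 + Y * Z * s`_7 *+ 2);
      - (Z * s`_3) + e * (Z * s`_6 *+ 2 + T * s`_5);
      s`_0 + T * s`_3 - e * (Y * s`_5 *+ 2 + T * s`_6);
      - s`_1 + e * (s`_4 *+ 2 + T * s`_7);
      T * s`_5 + Z * s`_6; - (Z * s`_7); s`_4 + T * s`_7; - s`_5].
Definition cos_v (s : seq S) : seq S :=
  [:: b * Y * s`_4; b * Y * s`_5; b * Y * s`_6; b * Y * s`_7; s`_0; s`_1; s`_2; s`_3].

Definition oct_y (m : oct) : oct := mk8 (cos_y (cos m)).
Definition oct_z (m : oct) : oct := mk8 (cos_z (cos m)).
Definition oct_v (m : oct) : oct := mk8 (cos_v (cos m)).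
Definition oct_w (m : oct) : oct := oct_v m + e *: oct_y m.
Definition oct1 : oct := mk8 [:: 1; 0; 0; 0; 0; 0; 0; 0].

Lemma oct_yE s : size s = 8%N -> oct_y (mk8 s) = mk8 (cos_y s).
Proof. by move=> size_s; rewrite /oct_y mk8K. Qed.
Lemma oct_zE s : size s = 8%N -> oct_z (mk8 s) = mk8 (cos_z s).
Proof. by move=> size_s; rewrite /oct_z mk8K. Qed.
Lemma oct_vE s : size s = 8%N -> oct_v (mk8 s) = mk8 (cos_v s).
Proof. by move=> size_s; rewrite /oct_v mk8K. Qed.

Ltac oct_ring :=
  rewrite ?(oct_yE, oct_zE, oct_vE, mk8Z, mk8D) //;
  congr mk8; rewrite /cos_y /cos_z /cos_v; cbn [nth map zip fst snd];
  repeat (congr cons; first ring).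

Lemma oct_y_linear : linear oct_y.
Proof.
move=> c m n; have [? [? [? [? [? [? [? [? ->]]]]]]]] := octP m.
by have [? [? [? [? [? [? [? [? ->]]]]]]]] := octP n; oct_ring.
Qed.
Lemma oct_z_linear : linear oct_z.
Proof.
move=> c m n; have [? [? [? [? [? [? [? [? ->]]]]]]]] := octP m.
by have [? [? [? [? [? [? [? [? ->]]]]]]]] := octP n; oct_ring.
Qed.
Lemma oct_v_linear : linear oct_v.
Proof.
move=> c m n; have [? [? [? [? [? [? [? [? ->]]]]]]]] := octP m.
by have [? [? [? [? [? [? [? [? ->]]]]]]]] := octP n; oct_ring.
Qed.
Lemma oct_w_linear : linear oct_w.
Proof.
move=> c m n; rewrite /oct_w oct_v_linear oct_y_linear; lin_over S (oct : lmodType S).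
Qed.

(** With the next two identities, these are the hypotheses of [relB_actW]. They are polynomial
    identities in the coordinates, valid over any commutative ring. *)
Lemma oct_wz m : oct_w (oct_z m) = oct_z (oct_w m).
Proof.
by have [? [? [? [? [? [? [? [? ->]]]]]]]] := octP m; rewrite /oct_w; oct_ring.
Qed.
Lemma oct_ww m : oct_w (oct_w m) = e *: oct_z (oct_z m) + b *: oct_y (oct_y m).
Proof.
by have [? [? [? [? [? [? [? [? ->]]]]]]]] := octP m; rewrite /oct_w; oct_ring.
Qed.
Lemma oct_wy m : oct_y (oct_w m) + oct_w (oct_y m)
  = oct_z (oct_z m) + e *: oct_y (oct_y m).
Proof.
by have [? [? [? [? [? [? [? [? ->]]]]]]]] := octP m; rewrite /oct_w; oct_ring.
Qed.
End Model.

Section ModelDomain.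
Variables (S : idomainType) (Y Z T e b : S).
Hypotheses (Y_neq0 : Y != 0) (Z_neq0 : Z != 0) (b_neq0 : b != 0).
Hypothesis Y_dvd : forall s t, Z * s = Y * t -> exists r, s = Y * r.

Lemma mk8_inj (s t : seq S) : mk8 s = mk8 t -> size s = 8%N -> size t = 8%N -> s = t.
Proof. by move=> E ss st; rewrite -(mk8K ss) E mk8K. Qed.

Lemma mulI0 (c d : S) : c != 0 -> c * d = 0 -> d = 0.
Proof. by move=> c0 /eqP; rewrite mulf_eq0 (negbTE c0) => /eqP. Qed.

(** The last four equations of [cos_z] involve only [c4], ..., [c7] and are solved first. Without
    these unknowns, the first four equations have the same shape in [c0], ..., [c3]. *)
Lemma oct_z_inj m : oct_z Y Z T e m = 0 -> m = 0.
Proof.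
have [c0 [c1 [c2 [c3 [c4 [c5 [c6 [c7 ->]]]]]]]] := octP m.
have -> : 0 = mk8 (nseq 8 0) :> 'rV[S]_8.
  by apply/rowP => i; rewrite !mxE nth_nseq if_same.
rewrite oct_zE // => /mk8_inj/(_ erefl erefl); rewrite /cos_z; cbn [nth nseq ncons iter].
case=> E0 E1 E2 E3 E4 E5 E6 E7.
have c5E : c5 = 0 by apply/eqP; rewrite -oppr_eq0 E7.
have c7E : c7 = 0 by apply: (mulI0 Z_neq0); apply/eqP; rewrite -oppr_eq0 E5.
have c6E : c6 = 0 by apply: (mulI0 Z_neq0); rewrite -E4 c5E; ring.
have c4E : c4 = 0 by rewrite -E6 c7E; ring.
rewrite {}c4E {}c5E {}c6E {}c7E in E0 E1 E2 E3 *.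
have c1E : c1 = 0 by apply/eqP; rewrite -oppr_eq0 -E3; apply/eqP; ring.
have c3E : c3 = 0 by apply: (mulI0 Z_neq0); apply/eqP; rewrite -oppr_eq0 -E1; apply/eqP; ring.
have c0E : c0 = 0 by rewrite -E2 c3E; ring.
have c2E : c2 = 0 by apply: (mulI0 Z_neq0); rewrite -E0 c1E; ring.
by rewrite c0E c1E c2E c3E.
Qed.

(** The coordinates of [u] are forced: the first four are read off [m = u v], the last four off
    [n = u y], provided that [Y] divides [d4] and [d6]. The first and third equations say that
    [Z d4] and [Z d6] are multiples of [Y], whence the hypothesis [Y_dvd]. *)
Lemma oct_vy_syzygy m n : oct_v Y b m = b *: oct_y Y Z e n ->
  exists u, m = oct_v Y b u /\ n = oct_y Y Z e u.
Proof.
have [c0 [c1 [c2 [c3 [c4 [c5 [c6 [c7 ->]]]]]]]] := octP m.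
have [d0 [d1 [d2 [d3 [d4 [d5 [d6 [d7 ->]]]]]]]] := octP n.
rewrite oct_vE // oct_yE // mk8Z => /mk8_inj/(_ erefl erefl).
rewrite /cos_v /cos_y; cbn [nth map].
case; rewrite -!mulrA => /(mulfI b_neq0) E0 /(mulfI b_neq0) E1 /(mulfI b_neq0) E2
  /(mulfI b_neq0) E3 E4 E5 E6 E7.
have [r4 d4E] : exists r, d4 = Y * r.
  apply: (@Y_dvd d4 (c4 - d1 + e * d4)); rewrite !mulrDr E0; ring.
have [r6 d6E] : exists r, d6 = Y * r.
  apply: (@Y_dvd d6 (c6 - d3 + e * d6)); rewrite !mulrDr E2; ring.
have d1E : d1 = c4 - (Z - e * Y) * r4.
  by apply: (mulfI Y_neq0); rewrite mulrBr E0 d4E; ring.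
have d3E : d3 = c6 - (Z - e * Y) * r6.
  by apply: (mulfI Y_neq0); rewrite mulrBr E2 d6E; ring.
exists (mk8 [:: c4; c5; c6; c7; - d5; - r4; - d7; - r6]).
rewrite oct_vE // oct_yE //; split; congr mk8; rewrite /cos_v /cos_y; cbn [nth].
  by rewrite E4 E5 E6 E7 d4E d6E; repeat (congr cons; first ring).
have d0E : d0 = Y * c5 - (Z - e * Y) * d5 by rewrite E1; ring.
have d2E : d2 = Y * c7 - (Z - e * Y) * d7 by rewrite E3; ring.
by rewrite d0E d1E d2E d3E d4E d6E; repeat (congr cons; first ring).
Qed.
End ModelDomain.

Section Relations.
Variables (k : fieldType) (A : algType k) (v y z : A) (e b : k).
Hypothesis b_neq0 : b != 0.
Hypothesis rel_vv : v * v = b *: (y * y).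
Hypothesis rel_yv : y * v = z * z - e *: (y * y) - v * y.
Hypothesis rel_vz : v * z = z * v - e *: (y * z - z * y).

(** [b y^2 = v^2] commutes with [v], and [b] cancels. *)
Lemma rel_yyv : y * y * v = v * y * y.
Proof.
apply: (scalerI b_neq0).
by rewrite scalerAl -rel_vv -[v * v * v]mulrA rel_vv -scalerAr mulrA.
Qed.

(** Moving [v] to the left through [y^2] with [rel_yv] gives [y^2 v = y z^2 - z^2 y + v y^2];
    compare with [rel_yyv]. *)
Lemma rel_zzy : z * z * y = y * z * z.
Proof.
have E : y * y * v = y * z * z - z * z * y + v * y * y.
  have yE u : u * y * v = u * (z * z - e *: (y * y) - v * y) by rewrite -mulrA rel_yv.
  rewrite yE; expand_words; rewrite rel_yv; expand_words; lin_over k A.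
apply/eqP; rewrite -subr_eq0 -oppr_eq0 opprB; apply/eqP.
by rewrite -[LHS](addrK (v * y * y)) -E rel_yyv subrr.
Qed.

Lemma rel_wz : (v + e *: y) * z = z * (v + e *: y).
Proof. by expand_words; rewrite rel_vz; lin_over k A. Qed.

(** [b y^2 = w^2 - e z^2], where [w = v + e y] commutes with [z]. *)
Lemma rel_yyz : y * y * z = z * y * y.
Proof.
pose w := v + e *: y.
have ww : w * w = b *: (y * y) + e *: (z * z).
  rewrite /w; expand_words; rewrite rel_vv rel_yv; lin_over k A.
have wwz : w * w * z = z * (w * w) by rewrite -mulrA rel_wz mulrA rel_wz mulrA.
apply: (scalerI b_neq0).
have E : b *: (y * y) = w * w - e *: (z * z) by rewrite ww addrK.
rewrite scalerAl E mulrBl wwz ww -[z * y * y]mulrA.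
by expand_words; lin_over k A.
Qed.

Lemma rel_zzv : z * z * v = v * z * z.
Proof.
have wzz : (v + e *: y) * (z * z) = z * z * (v + e *: y).
  by rewrite mulrA rel_wz -mulrA rel_wz mulrA.
rewrite -[v in LHS](addrK (e *: y)) mulrBr -wzz -scalerAr rel_zzy.
by expand_words; lin_over k A.
Qed.

Definition tq : A := y * z + z * y.

Lemma tq_y : tq * y = y * tq.
Proof. by rewrite /tq; expand_words; rewrite -rel_yyz; lin_over k A. Qed.

Lemma tq_z : tq * z = z * tq.
Proof. by rewrite /tq; expand_words; rewrite rel_zzy; lin_over k A. Qed.

Local Notation S := {poly {poly {poly k}}}.

Definition cS : {rmorphism k -> S} :=
  [the {rmorphism k -> S} of polyC \o (polyC \o polyC)].
(** [T] is the innermost variable and [Y] the outermost. With this order, divisibility by [Y] is the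
    vanishing of a polynomial at 0, and [S] is evaluated one variable at a time at commuting
    elements. *)
Definition YS : S := 'X.
Definition ZS : S := 'X%:P.
Definition TS : S := 'X%:P%:P.

Let commT : commr_rmorph (in_alg A) tq.
Proof. by move=> c; rewrite /GRing.comm /= mulr_algl mulr_algr. Qed.
Let ev1 : {rmorphism {poly k} -> A} := horner_morph commT.

Let ev1_comm u : GRing.comm u tq -> forall p, GRing.comm u (ev1 p).
Proof.
move=> cu; elim/poly_ind => [|p c IH]; first by rewrite rmorph0; apply: commr0.
rewrite rmorphD rmorphM /= horner_morphX horner_morphC.
by apply: commrD; [apply: commrM | rewrite /GRing.comm /= mulr_algl mulr_algr].
Qed.

Let comm_zz_tq : GRing.comm (z * z) tq.
Proof. by rewrite /GRing.comm -mulrA -tq_z mulrA -tq_z mulrA. Qed.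
Let comm_yy_tq : GRing.comm (y * y) tq.
Proof. by rewrite /GRing.comm -mulrA -tq_y mulrA -tq_y mulrA. Qed.
Let comm_yy_zz : GRing.comm (y * y) (z * z).
Proof. by rewrite /GRing.comm mulrA rel_yyz -mulrA -mulrA [y * (y * z)]mulrA rel_yyz !mulrA. Qed.

Let commZ : commr_rmorph ev1 (z * z).
Proof. by move=> p; apply: ev1_comm. Qed.
Let ev2 : {rmorphism {poly {poly k}} -> A} := horner_morph commZ.

Let ev2_comm u : GRing.comm u tq -> GRing.comm u (z * z) ->
  forall p, GRing.comm u (ev2 p).
Proof.
move=> cu cu'; elim/poly_ind => [|p c IH]; first by rewrite rmorph0; apply: commr0.
rewrite rmorphD rmorphM /= horner_morphX horner_morphC.
by apply: commrD; [apply: commrM | apply: ev1_comm].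
Qed.

Let commY : commr_rmorph ev2 (y * y).
Proof. by move=> p; apply: ev2_comm. Qed.
Definition ev3 : {rmorphism S -> A} := horner_morph commY.

Lemma ev3Y : ev3 YS = y * y. Proof. exact: horner_morphX. Qed.
Lemma ev3Z : ev3 ZS = z * z.
Proof. exact: etrans (horner_morphC commY _) (horner_morphX commZ). Qed.
Lemma ev3T : ev3 TS = tq.
Proof.
exact: etrans (horner_morphC commY _)
  (etrans (horner_morphC commZ _) (horner_morphX commT)).
Qed.
Lemma ev3C c : ev3 (cS c) = c%:A.
Proof.
exact: etrans (horner_morphC commY _)
  (etrans (horner_morphC commZ _) (horner_morphC commT _)).
Qed.

Lemma ev3_ind (P : A -> Prop) m : P 0 -> (forall c u u', P u -> P u' -> P (c *: u + u')) ->
  (forall i j l, P (tq ^+ l * (z * z) ^+ j * (y * y) ^+ i * m)) ->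
  forall s, P (ev3 s * m).
Proof.
move=> P0 Plin Pmon.
have PD u u' : P u -> P u' -> P (u + u') by rewrite -{2}[u]scale1r; apply: Plin.
(* The trailing powers are general so that the induction on a polynomial can absorb each factor of
   its variable. *)
have P1 p l j i : P (ev1 p * tq ^+ l * (z * z) ^+ j * (y * y) ^+ i * m).
  elim/poly_ind: p l => [|p c IH] l; first by rewrite rmorph0 !mul0r.
  rewrite rmorphD rmorphM /= horner_morphX horner_morphC !mulrDl; apply: PD.
    by rewrite -[_ * tq * _]mulrA -exprS; apply: IH.
  rewrite -!mulrA mulr_algl !mulrA -[_ *: _]addr0; apply: Plin => //.
have P2 p j i : P (ev2 p * (z * z) ^+ j * (y * y) ^+ i * m).
  elim/poly_ind: p j => [|p c IH] j; first by rewrite rmorph0 !mul0r.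
  rewrite rmorphD rmorphM /= horner_morphX horner_morphC !mulrDl; apply: PD.
    by rewrite -[_ * (z * z) * _]mulrA -exprS; apply: IH.
  by have := P1 c 0%N j i; rewrite expr0 mulr1.
have P3 p i : P (ev3 p * (y * y) ^+ i * m).
  elim/poly_ind: p i => [|p c IH] i; first by rewrite rmorph0 !mul0r.
  rewrite rmorphD rmorphM /= horner_morphX horner_morphC !mulrDl; apply: PD.
    by rewrite -[_ * (y * y) * _]mulrA -exprS; apply: IH.
  by have := P2 c 0%N i; rewrite expr0 mulr1.
by move=> s; have := P3 s 0%N; rewrite expr0 mulr1.
Qed.

Definition psi4 (c0 c1 c2 c3 : S) : A :=
  ev3 c0 + ev3 c1 * y + ev3 c2 * z + ev3 c3 * (z * y).

(** Realises coordinates as elements of [A]. It carries the octuple operators to right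
    multiplications, and will be a left inverse of the orbit map of [oct1]. *)
Definition Psi (m : 'rV[S]_8) : A :=
  psi4 (co 0 m) (co 1 m) (co 2 m) (co 3 m)
  + psi4 (co 4 m) (co 5 m) (co 6 m) (co 7 m) * v.

Let eS : S := cS e.
Let bS : S := cS b.
Local Notation oy := (oct_y YS ZS eS).
Local Notation oz := (oct_z YS ZS TS eS).
Local Notation ov := (oct_v YS bS).

Lemma psi4_y c0 c1 c2 c3 : psi4 c0 c1 c2 c3 * y = psi4 (YS * c1) c0 (YS * c3) c2.
Proof.
rewrite /psi4 ![YS * _]mulrC !rmorphM ev3Y !mulrDl -!mulrA.
have -> : y * (y * z) = z * (y * y) by rewrite mulrA rel_yyz mulrA.
by rewrite [LHS]addrAC; lin_over k A.
Qed.

Lemma psi4_z c0 c1 c2 c3 : psi4 c0 c1 c2 c3 * z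
  = psi4 (TS * c1 + ZS * c2) (- (ZS * c3)) (c0 + TS * c3) (- c1).
Proof.
rewrite /psi4 ![TS * _]mulrC ![ZS * _]mulrC !(rmorphD, rmorphN, rmorphM) ev3Z ev3T.
have yz : y * z = tq - z * y by rewrite addrK.
have zyz : z * y * z = tq * z - z * z * y.
  by rewrite -mulrA yz mulrBr -tq_z mulrA.
rewrite !mulrDl !mulNr -!mulrA [z * (y * z)]mulrA zyz yz !mulrBr !mulrA.
lin_over k A.
Qed.

Lemma psi4D c0 c1 c2 c3 d0 d1 d2 d3 :
  psi4 c0 c1 c2 c3 + psi4 d0 d1 d2 d3 = psi4 (c0 + d0) (c1 + d1) (c2 + d2) (c3 + d3).
Proof. by rewrite /psi4 !rmorphD !mulrDl; lin_over k A. Qed.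

Lemma psi4N c0 c1 c2 c3 : - psi4 c0 c1 c2 c3 = psi4 (- c0) (- c1) (- c2) (- c3).
Proof. by rewrite /psi4 !rmorphN !mulNr; lin_over k A. Qed.

Lemma psi4Z c c0 c1 c2 c3 :
  c *: psi4 c0 c1 c2 c3 = psi4 (cS c * c0) (cS c * c1) (cS c * c2) (cS c * c3).
Proof. by rewrite /psi4 !rmorphM !ev3C !mulr_algl -!scalerAl !scalerDr. Qed.

Lemma psi4_yy c0 c1 c2 c3 : psi4 c0 c1 c2 c3 * (y * y)
  = psi4 (YS * c0) (YS * c1) (YS * c2) (YS * c3).
Proof. by rewrite mulrA !psi4_y. Qed.

Lemma psi4_zz c0 c1 c2 c3 : psi4 c0 c1 c2 c3 * (z * z)
  = psi4 (ZS * c0) (ZS * c1) (ZS * c2) (ZS * c3).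
Proof. by rewrite mulrA !psi4_z; congr psi4; ring. Qed.

Let PsiE s : size s = 8%N ->
  Psi (mk8 s) = psi4 s`_0 s`_1 s`_2 s`_3 + psi4 s`_4 s`_5 s`_6 s`_7 * v.
Proof. by move=> size_s; rewrite /Psi !co_mk8. Qed.

Lemma Psi_v m : Psi (ov m) = Psi m * v.
Proof.
have [? [? [? [? [? [? [? [? ->]]]]]]]] := octP m.
rewrite oct_vE // !PsiE //= [RHS]mulrDl -[_ * v * v]mulrA rel_vv -scalerAr psi4_yy psi4Z [RHS]addrC.
by congr (psi4 _ _ _ _ + _); rewrite mulrA.
Qed.

Lemma Psi_y m : Psi (oy m) = Psi m * y.
Proof.
have [c0 [c1 [c2 [c3 [c4 [c5 [c6 [c7 ->]]]]]]]] := octP m.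
rewrite oct_yE // !PsiE //= [RHS]mulrDl -[_ * v * y]mulrA.
have -> : v * y = z * z - e *: (y * y) - y * v by rewrite rel_yv; lin_over k A.
rewrite !mulrBr -scalerAr psi4_zz psi4_yy psi4Z [_ * (y * v)]mulrA !psi4_y.
rewrite psi4N !psi4D -[- (_ * v)]mulNr psi4N addrA !psi4D.
by congr (psi4 _ _ _ _ + psi4 _ _ _ _ * v); rewrite -/eS; ring.
Qed.

Lemma Psi_z m : Psi (oz m) = Psi m * z.
Proof.
have [c0 [c1 [c2 [c3 [c4 [c5 [c6 [c7 ->]]]]]]]] := octP m.
rewrite oct_zE // !PsiE //= [RHS]mulrDl -[_ * v * z]mulrA rel_vz mulrBr -scalerAr.
rewrite mulrBr !(mulrA _ _ z, mulrA _ _ y, mulrA _ _ v) !(psi4_y, psi4_z) !(psi4N, psi4D) psi4Z.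
rewrite !psi4N [RHS]addrCA [LHS]addrC psi4D; congr (_ + psi4 _ _ _ _);
  by rewrite -/eS; ring.
Qed.

Lemma Psi_linear c m n : Psi (cS c *: m + n) = c *: Psi m + Psi n.
Proof.
by rewrite /Psi !coD !coZ -!psi4D -!psi4Z; expand_words; lin_over k A.
Qed.

Lemma Psi_oct1 : Psi (oct1 S) = 1.
Proof.
have PsiU c d : ev3 c = 1 -> ev3 d = 0 -> Psi (mk8 [:: c; d; d; d; d; d; d; d]) = 1.
  by move=> c1 d0; rewrite PsiE // /= /psi4 c1 d0 !(mul0r, addr0).
exact: PsiU (rmorph1 ev3) (rmorph0 ev3).
Qed.
End Relations.

Section NormalForm.
Variables (k : fieldType) (a : k) (B : gralg k) (xyz : 'I_3 -> B).
Hypothesis presB : presented (fun=> 1%N) (relB a) xyz.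
Hypothesis b_neq0 : bB a != 0.
Local Notation e := (eB a).
Local Notation b := (bB a).
Local Notation y := (yB xyz).
Local Notation z := (zB xyz).
Local Notation w' := (vB a xyz).
Local Notation S := {poly {poly {poly k}}}.
Local Notation YS := (YS k).
Local Notation ZS := (ZS k).
Local Notation TS := (TS k).
Local Notation oy := (oct_y YS ZS (cS k e)).
Local Notation oz := (oct_z YS ZS TS (cS k e)).
Local Notation ov := (oct_v YS (cS k b)).

Let vv := relB_w'w' presB.
Let yv := relB_yw' presB.
Let vz := relB_zw' presB.
Let PsiB := @Psi k B w' y z e b b_neq0 vv yv vz.

(** The octuples, with scalars restricted to [k] along [c], are a right module over [B]; [f] is the
    orbit map of the first basis vector. *)
Lemma oct_act_exists (S' : comNzRingType) (c : {rmorphism k -> S'}) (Y Z T : S') :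
  exists f : B -> 'rV[S']_8, [/\ f 1 = oct1 S',
      forall d u u', f (d *: u + u') = c d *: f u + f u',
      forall u, f (u * y) = oct_y Y Z (c e) (f u),
      forall u, f (u * z) = oct_z Y Z T (c e) (f u)
    & forall u, f (u * w') = oct_v Y (c b) (f u)].
Proof.
pose V : lmodType k := restr c 'rV[S']_8.
pose oy' : V -> V := oct_y Y Z (c e).
pose oz' : V -> V := oct_z Y Z T (c e).
pose ow' : V -> V := oct_w Y Z (c e) (c b).
have ylin : linear oy' by move=> d u u'; apply: oct_y_linear.
have zlin : linear oz' by move=> d u u'; apply: oct_z_linear.
have wlin : linear ow' by move=> d u u'; apply: oct_w_linear.
have [||| Xlin XR] := @relB_actW k a V ow' oy' oz' wlin ylin zlin.
- exact: oct_wz.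
- exact: oct_ww.
- exact: oct_wy.
set X := fun v => _ in Xlin XR.
have rlin i := op3_linear Xlin ylin zlin i.
pose f u : V := pact presB (op3 X oy' oz') u (oct1 S' : V).
have fy u : f (u * y) = oy' (f u) by rewrite /f pactM // pact_gen // op3_1.
have fz u : f (u * z) = oz' (f u) by rewrite /f pactM // pact_gen // op3_2.
have flin : linear f by apply: pact_linearl.
have fx u : f (u * xB xyz) = X (f u) by rewrite /f pactM // pact_gen // op3_0.
exists f; split; [by rewrite /f pact1 | exact: flin | exact: fy | exact: fz |] => u.
have -> : u * w' = u * xB xyz + (a - e) *: (u * y).
  rewrite /vB /wB; move: xB yB; rewrite /eB => ? ?; expand_words; lin_over k B.
have cancel (U : lmodType k) (p q : U) : (a - e) *: p + (q + e *: p - a *: p) = q.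
  by lin_over k U.
by rewrite addrC flin fy fx; apply: (cancel V).
Qed.

(** [PsiB \o f] is the identity because it fixes 1 and commutes with right multiplication by the
    generators. Hence [f] is injective, and cancellation properties pass from octuples to [B]. *)
Lemma normal_form_exists : exists f : B -> 'rV[S]_8,
  [/\ forall u, PsiB (f u) = u, forall c u u', f (c *: u + u') = cS k c *: f u + f u',
      forall u, f (u * y) = oy (f u), forall u, f (u * z) = oz (f u)
    & forall u, f (u * w') = ov (f u)].
Proof.
have [f [f1 flin fy fz fv]] := oct_act_exists (cS k) YS ZS TS.
exists f; split=> //.
elim/(B_ind presB) => [|c u u' IH IH'|u IH|u IH|u IH].
- by rewrite f1; apply: Psi_oct1.
- by rewrite flin [PsiB _]Psi_linear [X in _ *: X]IH [X in _ + X]IH'.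
- by rewrite fv [PsiB _]Psi_v [X in X * _]IH.
- by rewrite fy [PsiB _]Psi_y [X in X * _]IH.
- by rewrite fz [PsiB _]Psi_z [X in X * _]IH.
Qed.

Let YS_neq0 : YS != 0. Proof. by rewrite /YS polyX_eq0. Qed.
Let ZS_neq0 : ZS != 0. Proof. by rewrite /ZS polyC_eq0 polyX_eq0. Qed.
Let YS_dvd s t : ZS * s = YS * t -> exists r, s = YS * r.
Proof.
move=> E; have /factor_theorem[r ->] : root s 0.
  have : (ZS * s).[0] = 0 by rewrite E hornerM hornerX mul0r.
  rewrite hornerM hornerC => /eqP; rewrite mulf_eq0 => /orP[|//].
  by rewrite polyX_eq0.
by exists r; rewrite subr0 mulrC.
Qed.

Lemma mulz_inj u : u * z = 0 -> u = 0.
Proof.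
have [f [fK flin _ fz _]] := normal_form_exists; move=> uz.
have f0 : f 0 = 0 by have := flin (-1) 0 0; rewrite scaler0 addr0 rmorphN1 scaleN1r addNr.
have : oz (f u) = 0 by rewrite -fz uz.
by move=> /(oct_z_inj ZS_neq0) fu; rewrite -(fK u) fu -f0 fK.
Qed.

Lemma vy_syzygy s t : s * w' = b *: (t * y) -> exists u, s = u * w' /\ t = u * y.
Proof.
have [f [fK flin fy _ fv]] := normal_form_exists; move=> /(congr1 f).
have f0 : f 0 = 0 by have := flin (-1) 0 0; rewrite scaler0 addr0 rmorphN1 scaleN1r addNr.
rewrite -[b *: _]addr0 flin f0 addr0 fv fy.
have bS : cS k b != 0 by rewrite fmorph_eq0.
move=> /(oct_vy_syzygy YS_neq0 bS YS_dvd)[m [sE tE]].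
exists (PsiB m); split.
  by rewrite -(fK s) sE [PsiB _]Psi_v.
by rewrite -(fK t) tE [PsiB _]Psi_y.
Qed.

Lemma B_span_ind (P : B -> Prop) :
  P 0 -> (forall c u u', P u -> P u' -> P (c *: u + u')) ->
  (forall i j l n, (n < 8)%N -> P (tq y z ^+ l * (z * z) ^+ j * (y * y) ^+ i
     * nth 0 [:: 1; y; z; z * y; w'; y * w'; z * w'; z * y * w'] n)) ->
  forall u, P u.
Proof.
move=> P0 Plin Pmon u; have [f [fK _ _ _ _]] := normal_form_exists.
have PD u1 u2 : P u1 -> P u2 -> P (u1 + u2) by rewrite -{2}[u1]scale1r; apply: Plin.
rewrite -(fK u) /PsiB /Psi /psi4 !mulrDl -!(mulrA (ev3 b_neq0 vv yv vz _) _ w').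
have Pm n s : (n < 8)%N -> P (ev3 b_neq0 vv yv vz s
     * nth 0 [:: 1; y; z; z * y; w'; y * w'; z * w'; z * y * w'] n).
  by move=> lt_n; apply: ev3_ind => // i j l; apply: Pmon.
have Pm0 s : P (ev3 b_neq0 vv yv vz s) by rewrite -[X in P X]mulr1; apply: (Pm 0%N s isT).
exact: PD (PD _ _ (PD _ _ (PD _ _ (Pm0 _) (Pm 1%N _ isT)) (Pm 2%N _ isT))
  (Pm 3%N _ isT)) (PD _ _ (PD _ _ (PD _ _ (Pm 4%N _ isT) (Pm 5%N _ isT))
  (Pm 6%N _ isT)) (Pm 7%N _ isT)).
Qed.
End NormalForm.

(** * Syzygies of the generators, and polynomial growth *)

Section Consequences.
Variables (k : fieldType) (a : k) (B : gralg k) (xyz : 'I_3 -> B).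
Hypothesis presB : presented (fun=> 1%N) (relB a) xyz.
Local Notation e := (eB a).
Local Notation b := (bB a).
Local Notation x := (xB xyz).
Local Notation y := (yB xyz).
Local Notation z := (zB xyz).
Local Notation w := (wB a xyz).
Local Notation w' := (vB a xyz).

(* The Fox derivative of p is the second component of (1, 0) p, where B acts on
   the right of B x B^3 by (u, q) x_i = (u x_i, u e_i), up to the relations. *)
Lemma gens_syzygy v1 v2 v3 : v1 * w + v2 * y + v3 * z = 0 ->
  exists s1 s2 s3 : B, [/\ v1 = s1 * z + s2 * w + s3 * y,
    v2 = s3 * w' - b *: (s2 * y) & v3 = - (s1 * w) - e *: (s2 * z) - s3 * z].
Proof.
pose V : lmodType k := (B * (B * B * B))%type.
pose mk (u q1 q2 q3 : B) : V := (u, (q1, q2, q3)).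
have mk_lin c u q1 q2 q3 u' q1' q2' q3' : c *: mk u q1 q2 q3 + mk u' q1' q2' q3'
  = mk (c *: u + u') (c *: q1 + q1') (c *: q2 + q2') (c *: q3 + q3') by [].
have mkB u q1 q2 q3 u' q1' q2' q3' : mk u q1 q2 q3 - mk u' q1' q2' q3'
  = mk (u - u') (q1 - q1') (q2 - q2') (q3 - q3') by [].
have mkD u q1 q2 q3 u' q1' q2' q3' : mk u q1 q2 q3 + mk u' q1' q2' q3'
  = mk (u + u') (q1 + q1') (q2 + q2') (q3 + q3') by [].
have mkZ c u q1 q2 q3 : c *: mk u q1 q2 q3 = mk (c *: u) (c *: q1) (c *: q2) (c *: q3) by [].
have mk1 u q1 q2 q3 : (mk u q1 q2 q3).1 = u by [].
have mk0 : mk 0 0 0 0 = 0 by [].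
have mk_inj u q1 q2 q3 u' q1' q2' q3' :
  mk u q1 q2 q3 = mk u' q1' q2' q3' -> [/\ q1 = q1', q2 = q2' & q3 = q3'] by case.
clearbody mk.
(* The last three components are coordinates with respect to [w], [y], [z]; in them [x = w - a y] is
   [(1, -a, 0)]. *)
pose X (v : V) := mk (v.1 * x) v.1 (- a *: v.1) 0.
pose Y (v : V) := mk (v.1 * y) 0 v.1 0.
pose Z (v : V) := mk (v.1 * z) 0 0 v.1.
have v1D c (u v : V) : (c *: u + v).1 = c *: u.1 + v.1 by [].
have Xlin : linear X.
  move=> c u v; rewrite /X mk_lin v1D; congr mk; rewrite ?scaler0 ?addr0 //.
    by rewrite mulrDl scalerAl.
  by move: u.1 v.1 => p q; lin_over k B.
have Ylin : linear Y.
  move=> c u v; rewrite /Y mk_lin v1D; congr mk; rewrite ?scaler0 ?addr0 //.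
  by rewrite mulrDl scalerAl.
have Zlin : linear Z.
  move=> c u v; rewrite /Z mk_lin v1D; congr mk; rewrite ?scaler0 ?addr0 //.
  by rewrite mulrDl scalerAl.
(* The multiples of [s1], [s2], [s3] are the Fox derivatives of [zw - wz], [ww - e zz - b yy] and
   [yw + w'y - zz]. In these terms the three relations of [B] correspond to [s3], to
   [s2 + (1 - a) s3] and to [s1], hence the witnesses in [rel_S]. *)
pose S (v : V) := exists s1 s2 s3 : B, v = mk 0 (s1 * z + s2 * w + s3 * y)
  (s3 * w' - b *: (s2 * y)) (- (s1 * w) - e *: (s2 * z) - s3 * z).
have S0 : S 0.
  exists 0, 0, 0; by rewrite !mul0r !scaler0 !oppr0 !addr0 mk0.
have Slin c u v : S u -> S v -> S (c *: u + v).
  move=> [s1 [s2 [s3 ->]]] [t1 [t2 [t3 ->]]].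
  exists (c *: s1 + t1), (c *: s2 + t2), (c *: s3 + t3); rewrite mk_lin.
  congr mk; move: (wB a xyz) (vB a xyz) => ? ?; expand_words; lin_over k B.
have SD u v : S u -> S v -> S (u + v) by rewrite -{2}[u]scale1r; apply: Slin.
have SZ c v : S v -> S (c *: v) by move=> Sv; rewrite -[_ *: _]addr0; apply: Slin.
have rel_S s v : relB a s -> S (free_act (op3 X Y Z) s v).
  move: s v; apply: relB_act_mod => // v; rewrite /X /Y /Z !mk1 !(mkD, mkB, mkZ);
    move: (v.1) => u.
  - exists 0, 0, u; congr mk.
    + by rewrite -!mulrA -mulrDr (relB1 presB) mulrBr subrr.
    + by rewrite !mul0r; lin_over k B.
    + rewrite /vB /wB /eB; move: xB yB => ? ?; expand_words; lin_over k B.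
    + by rewrite !mul0r scaler0; lin_over k B.
  - exists 0, u, ((1 - a) *: u); congr mk.
    + have -> : u * x * y + u * y * x = a *: (u * z * z) - u * x * x.
        by rewrite -!mulrA -mulrDr (relB2 presB) mulrBr -scalerAr.
      by rewrite subrr.
    + rewrite /wB; move: xB yB => ? ?; expand_words; lin_over k B.
    + rewrite /vB /wB /eB /bB; move: xB yB => ? ?; expand_words; lin_over k B.
    + rewrite /eB; move: xB yB => ? ?; expand_words; lin_over k B.
  - exists u, 0, 0; congr mk.
    + by rewrite -!mulrA -mulrBr (relB3 presB) -scalerAr mulrBr subrr.
    + by rewrite !mul0r; lin_over k B.
    + by rewrite !mul0r; lin_over k B.
    + rewrite /wB; move: xB yB => ? ?; expand_words; lin_over k B.
have rho_lin i := op3_linear Xlin Ylin Zlin i.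
have Srho i v : S v -> S (op3 X Y Z i v).
  move=> [s1 [s2 [s3 ->]]]; move: i; apply: ord3_ind;
    by rewrite ?op3_0 ?op3_1 ?op3_2 ?/X ?/Y ?/Z mk1 mul0r ?scaler0 mk0.
pose act p := free_act (op3 X Y Z) p (mk 1 0 0 0).
have act1 p : (act p).1 = free_eval xyz p.
  elim/free_ind: p => [|c p q IHp IHq|p i IH].
  - by rewrite /act free_act1 rmorph1.
  - by rewrite /act free_act_linearl v1D -/(act p) -/(act q) IHp IHq linearP.
  - rewrite /act (free_actM rho_lin) free_act_gen rmorphM /= free_eval_gen -IH.
    by move: i; apply: ord3_ind; rewrite ?op3_0 ?op3_1 ?op3_2 /X /Y /Z mk1.
have actD p q : act (p + q) = act p + act q.
  by rewrite /act -{1}[p]scale1r free_act_linearl scale1r.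
have act_gen p i : act (p * gen i) = op3 X Y Z i (act p).
  by rewrite /act (free_actM rho_lin) free_act_gen.
move=> E.
pose l := plift presB; have lK := pliftK presB.
(* A lift of [v1 w + v2 y + v3 z], rewritten on [x], [y], [z]. It lies in the ideal, and its Fox
   derivative with respect to [w], [y], [z] is [(v1, v2, v3)]. *)
pose p := l v1 * gen (inord 0) + l (v2 + a *: v1) * gen (inord 1) + l v3 * gen (inord 2).
have evD p1 p2 p3 : free_eval xyz (p1 + p2 + p3)
    = free_eval xyz p1 + free_eval xyz p2 + free_eval xyz p3 by rewrite !linearD.
have evM u i : free_eval xyz (l u * gen i) = u * xyz i.
  by rewrite rmorphM /= free_eval_gen lK.
have idp : ideal_gen (relB a) p.
  apply/(pres_eq0 presB); apply: etrans (evD _ _ _) _.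
  apply: etrans (congr2 +%R (congr2 +%R (evM _ _) (evM _ _)) (evM _ _)) _.
  rewrite -E /wB -/(xB xyz) -/(yB xyz) -/(zB xyz); move: xB yB => ? ?.
  by expand_words; lin_over k B.
have actD3 p1 p2 p3 : act (p1 + p2 + p3) = act p1 + act p2 + act p3.
  by rewrite !actD.
have act_l u i : act (l u * gen i) = op3 X Y Z i (act (l u)) by exact: act_gen.
have actE : act p = X (act (l v1)) + Y (act (l (v2 + a *: v1))) + Z (act (l v3)).
  apply: etrans (actD3 _ _ _) _.
  apply: etrans (congr2 +%R (congr2 +%R (act_l _ _) (act_l _ _)) (act_l _ _)) _.
  by rewrite op3_0 op3_1 op3_2.
have := free_act_ideal rho_lin S0 SD SZ Srho rel_S (mk 1 0 0 0) idp.
rewrite -/(act p) actE /X /Y /Z !act1 !lK !mkD.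
case=> [s1 [s2 [s3]]] /mk_inj[E1 E2 E3]; exists s1, s2, s3; split.
- by rewrite -E1; lin_over k B.
- by rewrite -E2; lin_over k B.
- by rewrite -E3; lin_over k B.
Qed.

Lemma hom_xyz i : hom 1 (xyz i). Proof. exact: pres_hom presB i. Qed.

Lemma gens_span u : exists c : k, exists v1 v2 v3 : B,
  u = c%:A + (v1 * w + v2 * y + v3 * z).
Proof.
elim/(B_ind presB): u => [|c u u' [d [v1 [v2 [v3 ->]]]] [d' [v1' [v2' [v3' ->]]]]|u _|u _|u _].
- by exists 1, 0, 0, 0; rewrite !mul0r !addr0 scale1r.
- exists (c * d + d'), (c *: v1 + v1'), (c *: v2 + v2'), (c *: v3 + v3').
  by move: (wB a xyz) => ?; expand_words; lin_over k B.
- exists 0, u, (- e *: u), 0; rewrite /vB; move: (wB a xyz) => ?.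
  by expand_words; lin_over k B.
- by exists 0, 0, u, 0; rewrite !mul0r scale0r !add0r addr0.
- by exists 0, 0, 0, u; rewrite !mul0r scale0r !add0r.
Qed.

Lemma B_connected : connected B.
Proof.
move=> u hu; have [c [v1 [v2 [v3 uE]]]] := gens_span u; exists c.
have : hcomp 0 u = u by rewrite (hcomp_id _ hu).
rewrite {1}uE !linearD /= (hcompMr_small v1 (hom_w presB)) //.
rewrite (hcompMr_small v2 (hom_y presB)) // (hcompMr_small v3 (hom_z presB)) //.
rewrite (hcomp_id _ (homZ c (gr_one B))) eqxx !addr0 => <-; exact: erefl.
Qed.

Lemma B_generated : generated_in_degree_one B.
Proof.
move=> S S1 Slin SM Shom; apply: (pres_ind presB) => // u i Su.
by apply: SM => //; apply/Shom/hom_xyz.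
Qed.

Lemma B_dim1 : dim_le B 1 3.
Proof.
exists xyz; split=> [i|u hu]; first exact: hom_xyz.
have [c [v1 [v2 [v3 uE]]]] := gens_span u.
have [c1 v1E] := B_connected (hcomp_hom 0 v1).
have [c2 v2E] := B_connected (hcomp_hom 0 v2).
have [c3 v3E] := B_connected (hcomp_hom 0 v3).
exists (op3 c1 (c2 + a * c1) c3).
have : hcomp 1 u = u by rewrite (hcomp_id _ hu).
have hc (v q : B) : hom 1 q -> hcomp 1 (v * q) = hcomp 0 v * q.
  by move=> hq; rewrite -(hcompMr 0 v hq).
rewrite {1}uE !linearD /= (hc v1 _ (hom_w presB)) (hc v2 _ (hom_y presB)).
rewrite (hc v3 _ (hom_z presB)).
rewrite (hcomp_id _ (homZ c (gr_one B))) /= add0r v1E v2E v3E => <-.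
rewrite !big_ord_recl big_ord0.
have -> : ord0 = inord 0 :> 'I_3 by apply/val_inj; rewrite /= inordK.
have -> : lift (inord 0 : 'I_3) ord0 = inord 1 :> 'I_3 by apply/val_inj; rewrite /= !inordK.
have -> : lift (inord 0 : 'I_3) (lift ord0 ord0) = inord 2 :> 'I_3.
  by apply/val_inj; rewrite /= !inordK.
rewrite op3_0 op3_1 op3_2 -/x -/y -/z /wB; move: xB yB zB => ? ? ?.
by rewrite !mulr_algl; expand_words; lin_over k B.
Qed.
End Consequences.

Lemma dim_le_fin (k : fieldType) (A : gralg k) (n : nat) (T : finType) (s : T -> A) :
  (forall t, hom n (s t)) ->
  (forall u, hom n u -> exists c : T -> k, u = \sum_t c t *: s t) ->
  dim_le A n #|T|.
Proof.
move=> s_hom s_span; exists (s \o enum_val); split=> [i|u /s_span[c ->]] //=.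
by exists (c \o enum_val); rewrite (reindex _ (onW_bij _ (enum_val_bij T))).
Qed.

Lemma hom_exp (k : fieldType) (A : gralg k) (n i : nat) (u : A) :
  hom n u -> hom (n * i) (u ^+ i).
Proof.
move=> hu; elim: i => [|i IH]; first by rewrite muln0; apply: gr_one.
by rewrite exprS mulnS; apply: gr_mul.
Qed.

Section Growth.
Variables (k : fieldType) (a : k) (B : gralg k) (xyz : 'I_3 -> B).
Hypothesis presB : presented (fun=> 1%N) (relB a) xyz.
Hypothesis b_neq0 : bB a != 0.
Local Notation y := (yB xyz).
Local Notation z := (zB xyz).
Local Notation w' := (vB a xyz).

Lemma B_polynomial_growth : polynomial_growth B.
Proof.
exists 8%N, 3%N => n.
pose T : finType := ('I_n.+1 * 'I_n.+1 * 'I_n.+1 * 'I_8)%type.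
have -> : (8 * n.+1 ^ 3)%N = #|T| by rewrite !card_prod !card_ord; nia.
pose mon i j l m : B := tq y z ^+ l * (z * z) ^+ j * (y * y) ^+ i
     * nth 0 [:: 1; y; z; z * y; w'; y * w'; z * w'; z * y * w'] m.
have hy := hom_y presB; have hz := hom_z presB; have hw := hom_w' presB.
have mon_hom i j l m : (m < 8)%N -> exists2 d, (2 * l + 2 * j + 2 * i <= d)%N &
    hom d (mon i j l m).
  move=> lt_m; pose d := (2 * l + 2 * j + 2 * i)%N.
  exists (d + nth 0%N [:: 0; 1; 1; 2; 1; 2; 2; 3]%N m)%N; first exact: leq_addr.
  apply: gr_mul.
    apply: gr_mul; [apply: gr_mul|]; apply: hom_exp; try exact: (gr_mul (m := 1) (n := 1)).
    by apply: homD; exact: (gr_mul (m := 1) (n := 1)).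
  move: m lt_m => [|[|[|[|[|[|[|[|//]]]]]]]] _ /=; first exact: gr_one.
  - exact: hy.
  - exact: hz.
  - exact: (gr_mul (m := 1) (n := 1)).
  - exact: hw.
  - exact: (gr_mul (m := 1) (n := 1)).
  - exact: (gr_mul (m := 1) (n := 1)).
  - exact: (gr_mul (m := 2) (n := 1) (gr_mul (m := 1) (n := 1) hz hy)).
(* Projecting every monomial to degree [n] avoids selecting those of degree [n]: the others become
   0. A monomial of degree [n] has all its exponents at most [n]. *)
pose s (t : T) := hcomp n (mon t.1.1.1 t.1.1.2 t.1.2 t.2).
apply: (@dim_le_fin _ _ _ T s) => [t|u hu]; first exact: hcomp_hom.
suff [c E] : exists c : T -> k, hcomp n u = \sum_t c t *: s t.
  by exists c; rewrite -E (hcomp_id _ hu) eqxx.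
elim/(B_span_ind presB b_neq0): u {hu} => [|c u u' [d E] [d' E']|i j l m lt_m].
- by exists (fun=> 0); rewrite linear0 big1 // => t _; rewrite scale0r.
- exists (fun t => c * d t + d' t); rewrite hcomp_linear E E' scaler_sumr -big_split.
  by apply: eq_bigr => t _; rewrite scalerDl scalerA.
have [d le_d hmon] := mon_hom i j l _ lt_m.
rewrite -/(mon i j l m).
have [lt_nd|le_dn] := ltnP n d.
  exists (fun=> 0); rewrite (hcomp_id _ hmon) ltn_eqF //.
  by rewrite big1 // => t _; rewrite scale0r.
have [lt_i [lt_j lt_l]] : (i < n.+1)%N /\ (j < n.+1)%N /\ (l < n.+1)%N by lia.
pose t0 : T := (Ordinal lt_i, Ordinal lt_j, Ordinal lt_l, Ordinal lt_m).
exists (fun t => (t == t0)%:R); rewrite (bigD1 t0) //= eqxx scale1r big1 ?addr0 //.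
by move=> t /negbTE ->; rewrite scale0r.
Qed.
End Growth.

(** * Homological algebra *)

Definition mklin (R : pzRingType) (U V : lmodType R) (f : U -> V) (fL : linear f) :
  {linear U -> V} := HB.pack f (GRing.isLinear.Build R U V _ f fL).

Section Homological.
Variable R : nzRingType.
Implicit Types M N P Q : lmodType R.

Lemma projective_prod P Q : projective P -> projective Q -> projective (P * Q)%type.
Proof.
move=> projP projQ M N g f gsurj.
have inlL : linear (fun p : P => (p, 0 : Q)).
  by move=> c u v; congr pair; rewrite /= scaler0 addr0.
have inrL : linear (fun q : Q => (0 : P, q)).
  by move=> c u v; congr pair; rewrite /= scaler0 addr0.
have fstL : linear (fun p : P * Q => p.1) by [].
have sndL : linear (fun p : P * Q => p.2) by [].
have [h1 h1E] := projP _ _ g [the {linear P -> N} of f \o mklin inlL] gsurj.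
have [h2 h2E] := projQ _ _ g [the {linear Q -> N} of f \o mklin inrL] gsurj.
have hL : linear (fun p : P * Q => h1 p.1 + h2 p.2).
  by move=> c u v; rewrite /= !linearP scalerDr addrACA.
exists (mklin hL) => -[p q] /=; rewrite linearD h1E h2E /= -linearD.
by congr (f (_, _)); rewrite ?addr0 ?add0r.
Qed.

Lemma projective_regular : projective R^o.
Proof.
move=> M N g f gsurj; have [m mE] := gsurj (f 1).
have hL : linear (fun r : R^o => (r : R) *: m).
  by move=> c u v; rewrite scalerDl -scalerA.
by exists (mklin hL) => r; rewrite /= linearZ mE -linearZ /= [_ *: 1]mulr1.
Qed.

Lemma projective_zero P : (forall p : P, p = 0) -> projective P.
Proof.
move=> P0 M N g f _.
have zL : linear (fun _ : P => 0 : M) by move=> c u v; rewrite scaler0 addr0.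
by exists (mklin zL) => p; rewrite (P0 p) !linear0.
Qed.

(* P is a direct summand of the free module L on the set P, and f lifts along L. *)
Lemma projective_lift P N N' (d : {linear N -> N'}) (f : {linear P -> N'}) :
  projective P -> (forall p, exists n, d n = f p) ->
  exists h : {linear P -> N}, forall p, d (h p) = f p.
Proof.
move=> projP im_f.
have [pi piE] := free_module_lift (id : P -> P).
have [g gE] := free_module_lift (fun p => projT1 (cid (im_f p))).
have dg l : d (g l) = f (pi l).
  move: l; apply: malg_linear_eq => [c p q|c p q|x]; rewrite ?linearP //.
  by rewrite gE piE; case: (cid _).
have [s sE] := projP _ _ pi [the {linear P -> P} of idfun] (fun p => ex_intro _ << p >> (piE p)).
by exists [the {linear P -> N} of g \o s] => p; rewrite /= dg sE.
Qed.

Lemma linear_sub M N (f g : M -> N) : linear f -> linear g -> linear (fun u => f u - g u).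
Proof. by move=> fL gL c u v; rewrite fL gL scalerBr opprD addrACA. Qed.

Lemma linear_comp M N P (f : {linear N -> P}) (g : {linear M -> N}) :
  linear (fun u => f (g u)).
Proof. by move=> c u v; rewrite !linearP. Qed.

Lemma linear_id M : linear (fun u : M => u).
Proof. by []. Qed.

Section Comparison.
Variables (M : lmodType R) (P : nat -> lmodType R).
Variables (d : forall i, {linear P i.+1 -> P i}) (e : {linear P 0%N -> M}).
Hypothesis res : projective_resolution d e.

(** Comparison with a resolution [P'] of length 2: chain maps [f], [g] between the two and a
    homotopy [h] from [g f] to the identity. On the image of [d 2] the homotopy formula loses both
    other terms: [d 1] vanishes there, and [f2] sends it into the image of [P' 3 = 0]. When [d 2] is
    injective, [h] splits it. *)
Lemma pd_le2_split : pd_le M 2 ->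
  exists h : {linear P 2%N -> P 3%N}, forall p, d 2%N (h (d 2%N p)) = d 2%N p.
Proof.
move=> [P' [d' [e' [[projP' e'_surj ker_e' ker_d'] P'0]]]].
have [projP e_surj ker_e ker_d] := res.
have dd i p : d i (d i.+1 p) = 0 by apply/ker_d; exists p.
have ed p : e (d 0%N p) = 0 by apply/ker_e; exists p.
have dd' i p : d' i (d' i.+1 p) = 0 by apply/ker_d'; exists p.
have ed' p : e' (d' 0%N p) = 0 by apply/ker_e'; exists p.
have [f0 f0E] := projective_lift (projP 0%N) (fun p => e'_surj (e p)).
have [f1 f1E] : exists f1 : {linear P 1%N -> P' 1%N},
    forall p, d' 0%N (f1 p) = f0 (d 0%N p).
  apply: (@projective_lift _ _ _ _ [the {linear _ -> _} of f0 \o d 0%N] (projP _)) => p.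
  have [q qE] : exists q, f0 (d 0%N p) = d' 0%N q.
    by apply/ker_e'; rewrite f0E ed.
  by exists q.
have [f2 f2E] : exists f2 : {linear P 2%N -> P' 2%N},
    forall p, d' 1%N (f2 p) = f1 (d 1%N p).
  apply: (@projective_lift _ _ _ _ [the {linear _ -> _} of f1 \o d 1%N] (projP _)) => p.
  have [q qE] : exists q, f1 (d 1%N p) = d' 1%N q.
    by apply/ker_d'; rewrite f1E dd linear0.
  by exists q.
have [g0 g0E] := projective_lift (projP' 0%N) (fun p => e_surj (e' p)).
have [g1 g1E] : exists g1 : {linear P' 1%N -> P 1%N},
    forall p, d 0%N (g1 p) = g0 (d' 0%N p).
  apply: (@projective_lift _ _ _ _ [the {linear _ -> _} of g0 \o d' 0%N] (projP' _)) => p.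
  have [q qE] : exists q, g0 (d' 0%N p) = d 0%N q.
    by apply/ker_e; rewrite g0E ed'.
  by exists q.
have [g2 g2E] : exists g2 : {linear P' 2%N -> P 2%N},
    forall p, d 1%N (g2 p) = g1 (d' 1%N p).
  apply: (@projective_lift _ _ _ _ [the {linear _ -> _} of g1 \o d' 1%N] (projP' _)) => p.
  have [q qE] : exists q, g1 (d' 1%N p) = d 1%N q.
    by apply/ker_d; rewrite g1E dd' linear0.
  by exists q.
have [h0 h0E] : exists h0 : {linear P 0%N -> P 1%N},
    forall p, d 0%N (h0 p) = p - g0 (f0 p).
  have L := linear_sub (@linear_id _) (linear_comp g0 f0).
  apply: (projective_lift (f := mklin L) (projP _)) => p.
  have [q qE] : exists q, p - g0 (f0 p) = d 0%N q.
    by apply/ker_e; rewrite linearB /= g0E f0E subrr.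
  by exists q.
have [h1 h1E] : exists h1 : {linear P 1%N -> P 2%N},
    forall p, d 1%N (h1 p) = p - g1 (f1 p) - h0 (d 0%N p).
  have L := linear_sub (linear_sub (@linear_id _) (linear_comp g1 f1))
    (linear_comp h0 (d 0%N)).
  apply: (projective_lift (f := mklin L) (projP _)) => p.
  have [q qE] : exists q, p - g1 (f1 p) - h0 (d 0%N p) = d 1%N q.
    by apply/ker_d; rewrite !linearB /= g1E f1E h0E subrr.
  by exists q.
have [h2 h2E] : exists h2 : {linear P 2%N -> P 3%N},
    forall p, d 2%N (h2 p) = p - g2 (f2 p) - h1 (d 1%N p).
  have L := linear_sub (linear_sub (@linear_id _) (linear_comp g2 f2))
    (linear_comp h1 (d 1%N)).
  apply: (projective_lift (f := mklin L) (projP _)) => p.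
  have [q qE] : exists q, p - g2 (f2 p) - h1 (d 1%N p) = d 2%N q.
    by apply/ker_d; rewrite !linearB /= g2E f2E h1E dd linear0 subr0 subrr.
  by exists q.
exists h2 => p; rewrite h2E dd linear0 subr0.
have [q qE] : exists q, f2 (d 2%N p) = d' 2%N q.
  by apply/ker_d'; rewrite f2E dd linear0.
by rewrite qE (P'0 3%N isT q) [d' _ 0]linear0 [g2 0]linear0 subr0.
Qed.
End Comparison.

Lemma pd_leW M m n : (m <= n)%N -> pd_le M m -> pd_le M n.
Proof.
move=> le_mn [P [d [e [res P0]]]]; exists P, d, e; split=> // i lt_ni.
exact/P0/(leq_ltn_trans le_mn).
Qed.
End Homological.

(** ** Perturbation of exact sequences of graded groups *)

Definition additive_fun (U V : zmodType) (f : U -> V) := forall u v, f (u - v) = f u - f v.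

Lemma additive_fun0 (U V : zmodType) (f : U -> V) : additive_fun f -> f 0 = 0.
Proof. by move=> fB; rewrite -(subrr 0) fB subrr. Qed.

Lemma additive_funN (U V : zmodType) (f : U -> V) : additive_fun f ->
  forall u, f (- u) = - f u.
Proof. by move=> fB u; rewrite -[- u]add0r fB additive_fun0 ?add0r. Qed.

Lemma additive_funD (U V : zmodType) (f : U -> V) : additive_fun f ->
  forall u v, f (u + v) = f u + f v.
Proof. by move=> fB u v; rewrite -{1}[v]opprK fB (additive_funN fB v) opprK. Qed.

(** A grading by natural numbers given through its projections. The third condition bounds the
    degree of an element; the inductions below are on this bound. *)
Definition components (V : zmodType) (c : nat -> V -> V) :=
  [/\ forall n, additive_fun (c n),
      forall m n v, c m (c n v) = if m == n then c n v else 0,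
      forall v, exists N, forall n, (N <= n)%N -> c n v = 0
    & forall v, (forall n, c n v = 0) -> v = 0].

Section Perturbation.
Variables (X Y Z : zmodType) (cX : nat -> X -> X) (cY : nat -> Y -> Y).
Hypotheses (compX : components cX) (compY : components cY).
Variables (d' : Y -> Z) (R A : X -> Y).
Let d x := R x + A x.
Hypotheses (d'B : additive_fun d') (RB : additive_fun R) (AB : additive_fun A).
Hypotheses (RS : forall n x, cY n.+1 (R x) = R (cX n x)) (R0 : forall x, cY 0 (R x) = 0).
Hypothesis AC : forall n x, cY n (A x) = A (cX n x).
Hypothesis d'd : forall x, d' (d x) = 0.
Hypothesis topR : forall N y, d' y = 0 -> (forall n, (N < n)%N -> cY n y = 0) ->
  exists x, R x = cY N y.

(** Induction on a bound for the degree: the top component of a cycle is [R u], and subtracting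
    [d u] removes it because [A] does not raise the degree. The hypothesis [topR] concerns top
    components of cycles of [d'], rather than a leading part of [d'], so that it also covers an
    augmentation without one. *)
Lemma perturbed_exact y : d' y = 0 -> exists x, d x = y.
Proof.
have [cXB cXX cXN cX0] := compX; have [cYB cYY cYN cY0] := compY.
have [N] := cYN y; elim: N y => [|N IH] y yN d'y.
  exists 0; rewrite /d (additive_fun0 RB) (additive_fun0 AB) addr0.
  by apply/esym/cY0 => n; apply: yN.
have [u uE] := topR d'y yN.
(* Only the part of [u] one degree below [N] contributes to degree [N]; for [N = 0] there is none,
   since [R] misses degree 0. *)
pose u' := if N is n.+1 then cX n u else 0.
have u'0 m : (N <= m)%N -> cX m u' = 0.
  rewrite /u'; case: (N) => [|n] lt_nm; first exact/additive_fun0/cXB.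
  by rewrite cXX gtn_eqF.
have u'E : R u' = cY N y.
  rewrite -[RHS](_ : cY N (cY N y) = _); last by rewrite cYY eqxx.
  rewrite -uE /u'; case: (N) => [|n]; last by rewrite RS.
  by rewrite R0 (additive_fun0 RB).
have [||x xE] := IH (y - d u').
- move=> m le_Nm; rewrite cYB /d.
  rewrite (additive_funD (cYB m)).
  rewrite AC u'0 // (additive_fun0 AB) addr0 u'E cYY.
  have [->|ne_mN] := eqVneq; first by rewrite subrr.
  by rewrite yN ?subrr // ltn_neqAle eq_sym ne_mN.
- by rewrite d'B d'd d'y subrr.
exists (x + u').
rewrite /d (additive_funD RB) (additive_funD AB) -[RHS](subrK (d u')) -xE /d.
by rewrite addrACA.
Qed.
End Perturbation.

(** If [y] has top degree at most [N], the component of degree [N + 1] of [R' y + A' y] is [R'] of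
    the top component, so this is a cycle of the leading complex and exactness there gives
    [topR]. *)
Lemma perturbed_exact2 (X Y Z : zmodType) (cX : nat -> X -> X) (cY : nat -> Y -> Y)
    (cZ : nat -> Z -> Z) (R' A' : Y -> Z) (R A : X -> Y) :
  components cX -> components cY -> components cZ ->
  additive_fun R -> additive_fun A -> additive_fun R' -> additive_fun A' ->
  (forall n x, cY n.+1 (R x) = R (cX n x)) -> (forall x, cY 0 (R x) = 0) ->
  (forall n x, cY n (A x) = A (cX n x)) ->
  (forall n y, cZ n.+1 (R' y) = R' (cY n y)) ->
  (forall n y, cZ n (A' y) = A' (cY n y)) ->
  (forall x, R' (R x + A x) + A' (R x + A x) = 0) ->
  (forall y, R' y = 0 -> exists x, R x = y) ->
  forall y, R' y + A' y = 0 -> exists x, R x + A x = y.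
Proof.
move=> compX compY compZ RB AB R'B A'B RS R0 AC RS' AC' d'd ex y.
have [_ _ _ cZ0] := compZ; have [cZB _ _ _] := compZ.
apply: (perturbed_exact compX compY (d' := fun y => R' y + A' y)) => //.
  by move=> u v; rewrite R'B A'B opprD addrACA.
move=> N y' d'y y'N; apply: ex; rewrite -RS'.
have := congr1 (cZ N.+1) d'y.
rewrite (additive_funD (cZB _)) (additive_fun0 (cZB _)) AC' y'N //.
by rewrite (additive_fun0 A'B) addr0.
Qed.

Lemma perturbed_injective (X Y : zmodType) (cX : nat -> X -> X) (cY : nat -> Y -> Y)
    (R A : X -> Y) :
  components cX -> components cY -> additive_fun A ->
  (forall n x, cY n.+1 (R x) = R (cX n x)) -> (forall n x, cY n (A x) = A (cX n x)) ->
  (forall x, R x = 0 -> x = 0) -> forall x, R x + A x = 0 -> x = 0.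
Proof.
move=> [_ _ cXN cX0] [cYB _ _ _] AB RS AC Rinj x dx.
have [N] := cXN x; elim: N => [|N IH] xN; first by apply: cX0 => n; apply: xN.
apply: IH => n; rewrite leq_eqVlt => /predU1P[<-|/xN//].
apply: Rinj; rewrite -RS; have := congr1 (cY N.+1) dx.
by rewrite (additive_funD (cYB _)) AC xN // (additive_fun0 AB) addr0 (additive_fun0 (cYB _)).
Qed.

(** * Bases of vector spaces of any dimension *)

Section HamelBasis.
Variables (k : fieldType) (V : lmodType k).

Let comb : {malg k[V]} -> V := malg_ext id.
Let indep (A : set V) := forall c, (forall x, x \in msupp c -> A x) -> comb c = 0 -> c = 0.

Let maximal_indep : exists A, indep A /\ forall B, (A `<` B)%classic -> ~ indep B.
Proof.
apply: Zorn_bigcup => F Findep Fchain c cF.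
suff [E|[X FX cX]] : (msupp c = fset0)%fset \/
    exists2 X, F X & forall x, x \in msupp c -> X x.
- by move=> _; apply/malgP => x; rewrite mcoeff0 mcoeff_outdom // E.
- exact: Findep FX c cX.
(* A finite subset of the union of a chain lies in one member. The empty support is set apart
   because the chain may be empty. *)
suff : forall s : seq V, (forall x, x \in s -> x \in msupp c) -> s = [::] \/
    exists2 X, F X & forall x, x \in s -> X x.
  move=> /(_ (msupp c) (fun _ H => H))[E|]; last by right.
  by left; apply/fsetP => x; rewrite -[x \in msupp c]/(x \in (msupp c : seq V)) E.
elim=> [|x s IH] sc; first by left.
have [Y FY Yx] := cF x (sc x (mem_head _ _)); right.
have [->|[X FX sX]] := IH (fun y ys => sc y (mem_behead (s := x :: s) ys)).
  by exists Y => // y; rewrite inE => /eqP ->.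
have [XY|YX] := Fchain X Y FX FY.
  by exists Y => // y; rewrite inE => /predU1P[->//|/sX/XY].
by exists X => // y; rewrite inE => /predU1P[->|/sX//]; apply: YX.
Qed.

(** [J] is a maximal independent set made into a type. Independence was stated for combinations of
    all vectors of [V], into which [push] embeds those indexed by [J]. *)
Lemma hamel_basis : exists (J : choiceType) (m : J -> V) (coord : V -> {malg k[J]}),
  [/\ linear coord, forall v, malg_ext m (coord v) = v & forall j, coord (m j) = << j >>].
Proof.
have [A [indepA maxA]] := maximal_indep.
have spanA v : exists2 c, (forall x, x \in msupp c -> A x) & comb c = v.
  apply: contrapT => nspan.
  have nAv : ~ A v.
    move=> Av; apply: nspan; exists << v >>; last exact: malg_extU.
    by move=> x /(fsubsetP msuppU_le); rewrite inE => /eqP ->.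
  apply: (maxA (A `|` [set v])%classic).
    split=> [x Ax|]; first by left.
    by move=> /(_ v (or_intror erefl)).
  move=> c cAv c0.
  have [cv0|cv_neq0] := eqVneq (c@_v) 0.
    apply: indepA => // x x_c; case: (cAv x x_c) => // xv.
    by move: x_c; rewrite xv -mcoeff_neq0 cv0 eqxx.
  (* A dependence in which [v] occurs, solved for [v]. *)
  case: nspan; exists (- (c@_v)^-1 *: (c - c@_v *: << v >>)).
    move=> x /(fsubsetP (msuppZ_le _ _)) x_c.
    have nxv : x != v.
      apply/eqP => xv; move: x_c.
      by rewrite xv -mcoeff_neq0 mcoeffB mcoeffZ mcoeffUU mulr1 subrr eqxx.
    have : x \in msupp c.
      move: x_c; rewrite -!mcoeff_neq0 mcoeffB mcoeffZ mcoeffU [v == x]eq_sym (negbTE nxv).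
      by rewrite mulr0 subr0.
    by move=> /cAv[//|/eqP]; rewrite (negbTE nxv).
  rewrite /comb linearZ linearB linearZ /= malg_extU -/(comb c) c0 sub0r.
  by rewrite scaleNr scalerN opprK scalerA mulVf // scale1r.
pose pA : pred V := fun x => `[< A x >].
pose J : choiceType := {x : V | pA x}.
pose m (j : J) : V := val j.
pose push : {malg k[J]} -> {malg k[V]} := malg_ext (fun j => << m j >>).
have pushE c j : (push c)@_(m j) = c@_j.
  elim/malg_lin_ind: c => [|d c c' IH IH'|i].
  - by rewrite /push linear0 !mcoeff0.
  - by rewrite /push linearP !mcoeffD !mcoeffZ -IH -IH'.
  - by rewrite /push malg_extU !mcoeffU (inj_eq val_inj).
have push_supp c x : x \in msupp (push c) -> A x.
  apply: contraPP => nAx; apply/negP; rewrite -mcoeff_eq0; apply/eqP.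
  elim/malg_lin_ind: c => [|d c c' IH IH'|i].
  - by rewrite /push linear0 mcoeff0.
  - by rewrite /push linearP mcoeffD mcoeffZ -/(push c) -/(push c') IH IH' mulr0 addr0.
  - rewrite /push malg_extU mcoeffU; case: eqP => // ix.
    by case: nAx; rewrite -ix; apply/asboolP/(valP i).
have comb_push c : comb (push c) = malg_ext m c.
  move: c; apply: malg_linear_eq => [c p q|c p q|x]; rewrite /push /comb.
  - by rewrite !linearP.
  - by rewrite linearP.
  - by rewrite !malg_extU.
have inj c c' : malg_ext m c = malg_ext m c' -> c = c'.
  move=> E; apply/malgP => j; rewrite -!pushE; congr (_@__).
  apply/eqP; rewrite -subr_eq0; apply/eqP; rewrite -linearB.
  apply: indepA => [x|]; first exact: push_supp.
  by rewrite comb_push linearB /= E subrr.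
have surj v : exists c, malg_ext m c = v.
  have [c cA <-] := spanA v.
  exists (\sum_(x <- msupp c) c@_x *: (if insub x is Some j then << j >> else 0)).
  rewrite linear_sum /comb /malg_ext big_seq [RHS]big_seq; apply: eq_bigr => x x_c.
  rewrite -/(malg_ext m _) linearZ; congr (_ *: _).
  case: insubP => [j _ <-|]; first exact: malg_extU.
  by case/negP; apply/asboolP/cA.
pose coord v := projT1 (cid (surj v)).
have coordK v : malg_ext m (coord v) = v by rewrite /coord; case: cid.
exists J, m, coord; split=> // [c u v|j]; apply: inj.
  by rewrite [RHS]linearP /= !coordK.
by rewrite coordK malg_extU.
Qed.
End HamelBasis.

(** * Resolution of an arbitrary module *)

Lemma linear_add (R : pzRingType) (M N : lmodType R) (f g : M -> N) :
  linear f -> linear g -> linear (fun u => f u + g u).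
Proof. by move=> fL gL c u v; rewrite fL gL scalerDr addrACA. Qed.

Lemma linear_opp (R : pzRingType) (M N : lmodType R) (f : M -> N) :
  linear f -> linear (fun u => - f u).
Proof. by move=> fL c u v; rewrite fL scalerN opprD. Qed.

Lemma linear_pair (R : pzRingType) (M N P : lmodType R) (f : M -> N) (g : M -> P) :
  linear f -> linear g -> linear (fun u => (f u, g u) : (N * P)%type).
Proof. by move=> fL gL c u v; rewrite fL gL. Qed.

Lemma linear_precomp (R : pzRingType) (M N P : lmodType R) (f : N -> P) (g : M -> N) :
  linear f -> linear g -> linear (fun u => f (g u)).
Proof. by move=> fL gL c u v; rewrite gL fL. Qed.

Lemma linear_additive (R : pzRingType) (M N : lmodType R) (f : M -> N) :
  linear f -> additive_fun f.
Proof.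
by move=> fL u v; rewrite addrC -scaleN1r fL scaleN1r addrC.
Qed.

Lemma pd_le3_intro (R : nzRingType) (M P0 P1 P2 P3 : lmodType R)
    (e : P0 -> M) (d1 : P1 -> P0) (d2 : P2 -> P1) (d3 : P3 -> P2) :
  linear e -> linear d1 -> linear d2 -> linear d3 ->
  projective P0 -> projective P1 -> projective P2 -> projective P3 ->
  (forall v, exists p, e p = v) ->
  (forall p, e (d1 p) = 0) -> (forall p, d1 (d2 p) = 0) -> (forall p, d2 (d3 p) = 0) ->
  (forall p, e p = 0 -> exists q, d1 q = p) ->
  (forall p, d1 p = 0 -> exists q, d2 q = p) ->
  (forall p, d2 p = 0 -> exists q, d3 q = p) ->
  (forall p, d3 p = 0 -> p = 0) -> pd_le M 3.
Proof.
move=> eL d1L d2L d3L pP0 pP1 pP2 pP3 e_surj ed dd12 dd23 ex0 ex1 ex2 ex3.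
pose O : lmodType R := 'rV[R]_0.
have O0 (p : O) : p = 0 by apply/rowP => -[].
pose P i : lmodType R :=
  match i with 0%N => P0 | 1%N => P1 | 2%N => P2 | 3%N => P3 | _ => O end.
have zL (U V : lmodType R) : linear (fun _ : U => 0 : V).
  by move=> c u v; rewrite scaler0 addr0.
pose d i : {linear P i.+1 -> P i} :=
  match i return {linear P i.+1 -> P i} with
  | 0%N => mklin d1L | 1%N => mklin d2L | 2%N => mklin d3L
  | 3%N => mklin (zL _ _) | _ => mklin (zL _ _) end.
exists P, d, (mklin eL); split; last by move=> [|[|[|[|i]]]] // _ p; apply: O0.
split=> //.
- by move=> [|[|[|[|i]]]] //; apply: projective_zero.
- move=> p; split=> [/ex0[q <-]|[q ->]]; [by exists q | exact: ed].
- move=> [|[|[|[|i]]]] p; split=> /=.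
  + by move=> /ex1[q <-]; exists q.
  + by move=> [q ->]; apply: dd12.
  + by move=> /ex2[q <-]; exists q.
  + by move=> [q ->]; apply: dd23.
  + by move=> /ex3 ->; exists 0.
  + by move=> [q ->]; apply: linear_fun0.
  + by move=> _; exists 0; apply: O0.
  + by [].
  + by move=> _; exists 0; apply: O0.
  + by [].
Qed.

Section MalgTools.
Variables (R : nzRingType) (J : choiceType).
Local Notation F := {malg R[J]}.

Lemma malg_add_ind (P : F -> Prop) : P 0 -> (forall p q, P p -> P q -> P (p + q)) ->
  (forall c j, P (c *: << j >>)) -> forall p, P p.
Proof.
move=> P0 PD PU p; rewrite [p]monalgE; elim/big_ind: _ => // j _.
by rewrite malgU_scale.
Qed.

Lemma malg_build (D : {fset J}) (f : J -> R) : (forall j, j \notin D -> f j = 0) ->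
  exists p : F, forall j, p@_j = f j.
Proof.
move=> fD; exists (\sum_(i <- D) << f i *g i >>) => j.
rewrite raddf_sum /=; have [jD|jD] := boolP (j \in D).
  rewrite (big_fsetD1 j) //= mcoeffUU big1_fset ?addr0 // => i.
  by rewrite in_fsetD1 mcoeffU => /andP[/negbTE ->].
rewrite fD // big1_fset // => i iD _; rewrite mcoeffU; case: eqP => // ij.
by case/negP: jD; rewrite -ij.
Qed.
End MalgTools.

Lemma components_prod (X Y : zmodType) cX cY : components cX -> components cY ->
  components (fun n (p : X * Y) => (cX n p.1, cY n p.2)).
Proof.
move=> [cXB cXX cXN cX0] [cYB cYY cYN cY0]; split.
- by move=> n u v; rewrite /= cXB cYB.
- by move=> m n [u v] /=; rewrite cXX cYY; case: eqP.
- move=> [u v]; have [N1 H1] := cXN u; have [N2 H2] := cYN v.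
  exists (maxn N1 N2) => n; rewrite geq_max => /andP[n1 n2] /=.
  by rewrite H1 // H2.
- move=> [u v] H; congr pair.
    by apply: cX0 => n; have /= [->] := H n.
  by apply: cY0 => n; have /= [_ ->] := H n.
Qed.

Section FreeGraded.
Variables (k : fieldType) (B : gralg k) (J : choiceType).
Local Notation F := {malg B[J]}.

(** The degree is that of the factor [B] in [B (x) M]: basis vectors have degree 0, since an
    arbitrary module carries no grading. *)
Definition fcomp n (v : F) : F := \sum_(j <- msupp v) << hcomp n v@_j *g j >>.

Lemma fcompE n v j : (fcomp n v)@_j = hcomp n v@_j.
Proof.
rewrite /fcomp raddf_sum /=; have [jD|jD] := boolP (j \in msupp v).
  rewrite (big_fsetD1 j) //= mcoeffUU big1_fset ?addr0 // => i.
  by rewrite in_fsetD1 mcoeffU => /andP[/negbTE ->].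
rewrite (mcoeff_outdom jD) linear0 big1_fset // => i iD _; rewrite mcoeffU; case: eqP => // ij.
by case/negP: jD; rewrite -ij.
Qed.

Lemma fcomp_components : components fcomp.
Proof.
split.
- by move=> n u v; apply/malgP => j; rewrite !(fcompE, mcoeffB) linearB.
- move=> m n v; apply/malgP => j; rewrite !fcompE (hcomp_id _ (hcomp_hom _ _)).
  by case: eqP; rewrite ?fcompE ?mcoeff0.
- move=> v.
  have [N HN] : exists N : J -> nat, forall j n, (N j <= n)%N -> hcomp n v@_j = 0.
    have [N HN] := choice (fun j => hcomp_bound (v@_j : B)).
    by exists N.
  exists (\max_(j <- msupp v) N j)%N => n le_n; apply/malgP => j.
  rewrite fcompE mcoeff0; have [jD|jD] := boolP (j \in msupp v).
    by apply/HN/(leq_trans _ le_n); rewrite (leq_bigmax_seq (F := N)).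
  by rewrite (mcoeff_outdom jD) linear0.
- move=> v H; apply/malgP => j; rewrite mcoeff0; apply: hcomp_eq0 => n.
  by rewrite -fcompE H mcoeff0.
Qed.

Lemma fcompD n : {morph fcomp n : u v / u + v}.
Proof. by move=> u v; apply/malgP => j; rewrite !(fcompE, mcoeffD) linearD. Qed.
End FreeGraded.

Section KoszulExactness.
Variables (k : fieldType) (a : k) (B : gralg k) (xyz : 'I_3 -> B).
Hypothesis presB : presented (fun=> 1%N) (relB a) xyz.
Hypothesis b_neq0 : bB a != 0.
Local Notation e := (eB a).
Local Notation b := (bB a).
Local Notation y := (yB xyz).
Local Notation z := (zB xyz).
Local Notation w := (wB a xyz).
Local Notation w' := (vB a xyz).

(** [vy_syzygy] yields [u] with [v2 = u y] and [v3 = u w']. As [yw + w'y = z^2], the first equation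
    becomes [(v1 + u z) z = 0], and [z] is regular. *)
Lemma koszul_syzygy v1 v2 v3 : v1 * z + v2 * w + v3 * y = 0 ->
  v3 * w' = b *: (v2 * y) ->
  exists u, [/\ v1 = - (u * z), v2 = u * y & v3 = u * w'].
Proof.
move=> E1 /(vy_syzygy presB b_neq0)[u [v3E v2E]]; exists u; split=> //.
apply/eqP; rewrite -subr_eq0 opprK; apply/eqP/(mulz_inj presB b_neq0).
rewrite mulrDl -[u * z * z]mulrA -(relB_yw presB) mulrDr !mulrA -v2E -v3E.
by rewrite addrA.
Qed.

Lemma gens_span_hom n u : hom n.+1 u ->
  exists v1 v2 v3 : B, v1 * w + v2 * y + v3 * z = u.
Proof.
move=> hu; have [c [v1 [v2 [v3 uE]]]] := gens_span presB u.
exists v1, v2, v3; have : hcomp 0 u = 0 by rewrite (hcomp_id _ hu).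
rewrite {1}uE !linearD /= (hcompMr_small v1 (hom_w presB)) //.
rewrite (hcompMr_small v2 (hom_y presB)) // (hcompMr_small v3 (hom_z presB)) //.
rewrite (hcomp_id _ (homZ c (gr_one B))) eqxx !addr0 => c0.
by rewrite uE [c%:A]c0 add0r.
Qed.
End KoszulExactness.

Section ModuleResolution.
Variables (k : fieldType) (B : gralg k) (M : lmodType B) (J : choiceType).
Let kM : lmodType k := restr (in_alg B) M.
Variables (m : J -> kM) (coord : kM -> {malg k[J]}).
Hypotheses (coord_lin : linear coord) (coordK : forall v, malg_ext m (coord v) = v).
Hypothesis coord_m : forall j, coord (m j) = << j >>.
Local Notation F := {malg B[J]}.
Let kF : lmodType k := restr (in_alg B) F.

Let incl : {malg k[J]} -> kF := malg_ext (fun j => << j >> : kF).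
(** With [F] read as [B (x) M] over [k], this is [v |-> 1 (x) v], and [eps] below is the action map
    [u (x) v |-> u v]. *)
Let iota (v : M) : F := incl (coord v).

Let eps : F -> M := malg_ext (m : J -> M).

Let inclU j : incl << j >> = << j >>. Proof. exact: malg_extU. Qed.
Let incl_lin : linear incl. Proof. exact: malg_ext_linear. Qed.
Let iota_lin : linear (iota : kM -> kF).
Proof. by move=> c u v; rewrite /iota coord_lin incl_lin. Qed.

Let eps_iota v : eps (iota v) = v.
Proof.
have epsk : linear (eps : kF -> kM).
  by move=> c p q; rewrite /eps [LHS]linearP.
rewrite -[RHS]coordK /iota; move: (coord v).
apply: (@malg_linear_eq _ _ kM (eps \o incl)) => [c p q|c p q|j].
- by rewrite /= incl_lin epsk.
- by rewrite linearP.
- by rewrite /= inclU /eps !malg_extU.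
Qed.

(* opR u and opA u are right multiplication by u on B and left multiplication by
   u on M, on B (x) M. They are sealed because comparing them by unfolding is
   expensive. *)
Lemma opR_sig (u : B) : {f : F -> F | linear f & forall j, f << j >> = u *: << j >>}.
Proof.
exists (malg_ext (fun j => u *: << j >> : F)); first exact: malg_ext_linear.
by move=> j; apply: malg_extU.
Qed.

Lemma opA_sig (u : B) :
  {f : F -> F | linear f & forall j, f << j >> = iota (u *: (m j : M))}.
Proof.
exists (malg_ext (fun j => iota (u *: (m j : M)))); first exact: malg_ext_linear.
by move=> j; apply: malg_extU.
Qed.

Definition opR (u : B) : F -> F := s2val (opR_sig u).
Definition opA (u : B) : F -> F := s2val (opA_sig u).

Lemma opR_lin u : linear (opR u). Proof. exact: s2valP (opR_sig u). Qed.
Lemma opA_lin u : linear (opA u). Proof. exact: s2valP (opA_sig u). Qed.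
Lemma opRU u j : opR u << j >> = u *: << j >>. Proof. exact: s2valP' (opR_sig u) j. Qed.
Lemma opAU u j : opA u << j >> = iota (u *: (m j : M)).
Proof. exact: s2valP' (opA_sig u) j. Qed.

Let linZ (N N' : lmodType B) (f : N -> N') : linear f -> forall c v, f (c *: v) = c *: f v.
Proof. by move=> fL c v; rewrite -[c *: v]addr0 fL linear_fun0 ?addr0. Qed.

Lemma opR_coef u (v : F) j : (opR u v)@_j = v@_j * u.
Proof.
elim/malg_add_ind: v => [|p q IHp IHq|c i].
- by rewrite (linear_fun0 (opR_lin u)) mcoeff0 mul0r.
- by rewrite (additive_funD (linear_additive (opR_lin u))) !mcoeffD IHp IHq mulrDl.
- rewrite (linZ (opR_lin u)) opRU !mcoeffZ mcoeffU.
  by case: eqP; rewrite ?mulr1 // mulr0n !mulr0 mul0r.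
Qed.

Lemma eq_linear (N : lmodType B) (f g : F -> N) : linear f -> linear g ->
  (forall j, f << j >> = g << j >>) -> forall v, f v = g v.
Proof. by move=> fL gL fg v; apply: malg_linear_eq. Qed.

Lemma opA_iota u v : opA u (iota v) = iota (u *: v).
Proof.
rewrite -{2}[v]coordK /iota; move: (coord v).
have opAk : linear (opA u : kF -> kF) by move=> c p q; rewrite [LHS]opA_lin.
apply: (@malg_linear_eq _ _ kF (opA u \o incl)
  (fun c => incl (coord (u *: (malg_ext m c : M) : M)))) => [c p q|c p q|j].
- by rewrite /= incl_lin opAk.
- rewrite linearP -incl_lin -coord_lin; congr (incl (coord _)).
  rewrite [u *: _]scalerDr; congr (_ + _).
  by rewrite !restr_scaleE !scalerA /= mulr_algl mulr_algr.
- by rewrite /= inclU opAU malg_extU.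
Qed.

Lemma opR_iota u v : opR u (iota v) = u *: iota v.
Proof.
rewrite /iota; move: (coord v) => c; apply/malgP => j; rewrite opR_coef mcoeffZ.
elim/malg_lin_ind: c j => [|d p q IHp IHq|i] j.
- by rewrite (linear_fun0 incl_lin) mcoeff0 mul0r mulr0.
- rewrite incl_lin restr_scaleE mcoeffD mcoeffZ mulrDl mulrDr IHq /= -!mulrA IHp.
  by rewrite !mulrA mulr_algl mulr_algr.
- by rewrite inclU mcoeffU; case: eqP; rewrite ?mulr0n ?mulr0 ?mul0r // mulr1 mul1r.
Qed.

Lemma opRR u t v : opR u (opR t v) = opR (t * u) v.
Proof. by apply/malgP => j; do 3!rewrite opR_coef; rewrite mulrA. Qed.

Lemma opAA u t v : opA u (opA t v) = opA (u * t) v.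
Proof.
move: v; apply: eq_linear => [||j]; [exact/linear_precomp/opA_lin/opA_lin|exact: opA_lin|].
by rewrite !opAU opA_iota scalerA.
Qed.

Lemma opAR u t v : opA u (opR t v) = opR t (opA u v).
Proof.
move: v; apply: eq_linear => [||j];
  [exact/linear_precomp/opR_lin/opA_lin|exact/linear_precomp/opA_lin/opR_lin|].
by rewrite opRU opAU opR_iota (linZ (opA_lin u)) opAU.
Qed.

Lemma opR1 v : opR 1 v = v.
Proof. by apply/malgP => j; rewrite opR_coef mulr1. Qed.

Lemma opA1 v : opA 1 v = v.
Proof.
move: v; apply: eq_linear => [||j] //; first exact: opA_lin.
by rewrite opAU scale1r /iota coord_m inclU.
Qed.

Lemma opR_linl c u u' v : opR (c *: u + u') v = c *: (opR u v : kF) + opR u' v :> kF.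
Proof.
apply/malgP => j; rewrite restr_scaleE mcoeffD mcoeffZ; do 3!rewrite opR_coef.
by rewrite mulrDr /= mulr_algl scalerAr.
Qed.

Lemma opA_linl c u u' v : opA (c *: u + u') v = c%:A *: opA u v + opA u' v.
Proof.
move: v; apply: eq_linear => [||j]; first exact: opA_lin.
  apply: linear_add; last exact: opA_lin.
  by move=> d p q; rewrite opA_lin scalerDr !scalerA mulr_algl mulr_algr.
rewrite !opAU; pose q : kM := u *: (m j : M); pose q' : kM := u' *: (m j : M).
have -> : (c *: u + u') *: (m j : M) = (c *: q + q' : kM).
  by rewrite scalerDl /q restr_scaleE scalerA /= mulr_algl.
exact: iota_lin c q q'.
Qed.

Lemma opR_comp n u v : hom 1 u -> fcomp n.+1 (opR u v) = opR u (fcomp n v).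
Proof.
move=> hu; apply/malgP => j; rewrite !(fcompE, opR_coef) -addn1.
exact: hcompMr.
Qed.

Lemma opR_comp0 u v : hom 1 u -> fcomp 0 (opR u v) = 0.
Proof.
move=> hu; apply/malgP => j; rewrite !(fcompE, opR_coef) mcoeff0.
exact: hcompMr_small hu _.
Qed.

Let fcompZ_iota n c v : fcomp n (c *: iota v) = hcomp n c *: iota v.
Proof.
rewrite /iota; move: (coord v) => d; apply/malgP => j; rewrite fcompE !mcoeffZ.
elim/malg_lin_ind: d j => [|d p q IHp IHq|i] j.
- by rewrite (linear_fun0 incl_lin) mcoeff0 !mulr0 linear0.
- rewrite incl_lin restr_scaleE mcoeffD mcoeffZ !mulrDr [hcomp n _]linearD /= IHq.
  by congr (_ + _); rewrite mulr_algl -!scalerAr [hcomp n _]linearZ /= IHp.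
- by rewrite inclU mcoeffU; case: eqP; rewrite ?mulr0n ?mulr0 ?linear0 ?mulr1.
Qed.

Let iota_m j : iota (m j) = << j >>. Proof. by rewrite /iota coord_m inclU. Qed.

Lemma opA_comp n u v : fcomp n (opA u v) = opA u (fcomp n v).
Proof.
have opAD := additive_funD (linear_additive (opA_lin u)).
elim/malg_add_ind: v => [|p q IHp IHq|c j].
- have fcomp0 : fcomp n (0 : F) = 0 by apply/malgP => j; rewrite fcompE mcoeff0 linear0.
  by rewrite (linear_fun0 (opA_lin u)) fcomp0 (linear_fun0 (opA_lin u)).
- by rewrite opAD !fcompD opAD IHp IHq.
- rewrite (linZ (opA_lin u)) opAU fcompZ_iota -iota_m fcompZ_iota.
  by rewrite iota_m (linZ (opA_lin u)) opAU.
Qed.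

Lemma eps_lin : linear eps. Proof. exact: malg_ext_linear. Qed.

(** Both sides send [c (x) m] to [(c u) m]. Hence the first differential, a combination of terms
    [opR u - opA u], composes to 0 with [eps]. *)
Lemma eps_opR u v : eps (opR u v) = eps (opA u v).
Proof.
move: v; apply: eq_linear => [||j];
  [exact/linear_precomp/opR_lin/eps_lin|exact/linear_precomp/opA_lin/eps_lin|].
by rewrite opRU opAU (linZ eps_lin) eps_iota /eps malg_extU.
Qed.

Lemma eps_surj v : exists p, eps p = v.
Proof. by exists (iota v); apply: eps_iota. Qed.

Let incl_coef d j : (incl d)@_j = (d@_j)%:A.
Proof.
elim/malg_lin_ind: d => [|c p q IHp IHq|i].
- by rewrite (linear_fun0 incl_lin) !mcoeff0 scale0r.
- by rewrite incl_lin restr_scaleE !mcoeffD !mcoeffZ IHp IHq scalerDl -scalerA /= mulr_algl.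
- by rewrite inclU !mcoeffU; case: eqP; rewrite ?scale1r ?scale0r.
Qed.

Let coord_ext d : coord (malg_ext m d) = d.
Proof.
apply: (@malg_linear_eq _ _ _ (coord \o malg_ext m) id) => [c p q|c p q|j] //=.
  by rewrite linearP coord_lin.
by rewrite malg_extU coord_m.
Qed.

Let eps_incl d : eps (incl d) = malg_ext m d.
Proof. by rewrite -[incl d]/(incl d) -{1}[d]coord_ext; apply: eps_iota. Qed.

(** In degree 0 the coefficients are scalars, so [v] has the form [1 (x) u], and [eps] recovers
    [u]. *)
Let fcomp_iota v : connected B -> (forall n, (0 < n)%N -> fcomp n v = 0) ->
  v = iota (eps v).
Proof.
move=> connB v0.
have v0E : fcomp 0 v = v.
  apply/malgP => j; rewrite fcompE.
  rewrite [RHS](@hcomp_sum_ord _ _ _ 1) ?big_ord1 // => n n_gt0.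
  by rewrite -fcompE v0 // mcoeff0.
have [c cE] : exists c : J -> k, forall j, v@_j = (c j)%:A.
  have H j : exists c : k, v@_j = c%:A.
    by apply: connB; rewrite -v0E fcompE; apply: hcomp_hom.
  by exists (fun j => projT1 (cid (H j))) => j; case: cid.
pose c' j := if j \in msupp v then c j else 0.
have [d dE] := @malg_build k J (msupp v) c' (fun j jv => ifN _ _ jv).
have -> : v = incl d.
  apply/malgP => j; rewrite incl_coef dE /c'; case: ifP => // /negbT jv.
  by rewrite scale0r mcoeff_outdom.
by rewrite eps_incl /iota coord_ext.
Qed.
Lemma eps_degree0_inj v : connected B -> (forall n, (0 < n)%N -> fcomp n v = 0) ->
  eps v = 0 -> v = 0.
Proof. by move=> connB /(fcomp_iota connB) vE v0; rewrite vE v0; apply: (linear_fun0 iota_lin). Qed.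
End ModuleResolution.

(* The identities behind d o d = 0, for commuting right and left actions R and A. *)

Section OperatorIdentities.
Variables (k : fieldType) (B : algType k) (w y z : B) (e b : k) (V : lmodType k).
Hypothesis ww : w * w = e *: (z * z) + b *: (y * y).
Hypothesis yw : y * w = z * z + e *: (y * y) - w * y.
Hypothesis zw : z * w = w * z.
Variables R A : B -> V -> V.
Hypotheses (RB : forall u, additive_fun (R u)) (AB : forall u, additive_fun (A u)).
Hypotheses (RR : forall u t v, R u (R t v) = R (t * u) v).
Hypotheses (AA : forall u t v, A u (A t v) = A (u * t) v).
Hypotheses (AR : forall u t v, A u (R t v) = R t (A u v)).
Hypotheses (R1 : forall v, R 1 v = v) (A1 : forall v, A 1 v = v).
Hypotheses (Rl : forall v, linear (R^~ v)) (Al : forall v, linear (A^~ v)).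
Hypothesis (RZ : forall c u v, R u (c *: v) = c *: R u v).
Local Notation w' := (w - e *: y).

Let RD u p q : R u (p + q) = R u p + R u q := additive_funD (RB u) p q.
Let AD u p q : A u (p + q) = A u p + A u q := additive_funD (AB u) p q.
Let RN u p : R u (- p) = - R u p := additive_funN (RB u) p.
Let AN u p : A u (- p) = - A u p := additive_funN (AB u) p.

(** Common normal form for [op_ring]: the actions commute, so every composite is one [RA u t],
    bilinear in [u] and [t], and the identities reduce to those of [B] in each argument. *)
Let RA u t v := R u (A t v).
Let toRA u t v : R u (A t v) = RA u t v. Proof. by []. Qed.
Let toR u v : R u v = RA u 1 v. Proof. by rewrite /RA A1. Qed.
Let toA u v : A u v = RA 1 u v. Proof. by rewrite /RA R1. Qed.
Let RA_linl c u u' t v : RA (c *: u + u') t v = c *: RA u t v + RA u' t v.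
Proof. exact: Rl. Qed.
Let RA_linr c u t t' v : RA u (c *: t + t') v = c *: RA u t v + RA u t' v.
Proof. by rewrite /RA Al RD RZ. Qed.
Let RA_Dl u u' t v : RA (u + u') t v = RA u t v + RA u' t v.
Proof. by have := RA_linl 1 u u' t v; rewrite !scale1r. Qed.
Let RA_Dr u t t' v : RA u (t + t') v = RA u t v + RA u t' v.
Proof. by have := RA_linr 1 u t t' v; rewrite !scale1r. Qed.
Let RA_Zl c u t v : RA (c *: u) t v = c *: RA u t v.
Proof.
rewrite -[c *: u]addr0 RA_linl (_ : RA 0 t v = 0) ?addr0 //.
exact: linear_fun0 (Rl _).
Qed.
Let RA_Zr c u t v : RA u (c *: t) v = c *: RA u t v.
Proof.
rewrite -[c *: t]addr0 RA_linr (_ : RA u 0 v = 0) ?addr0 //.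
by rewrite /RA (linear_fun0 (Al _)) (additive_fun0 (RB u)).
Qed.
Let RA_Nl u t v : RA (- u) t v = - RA u t v.
Proof. by rewrite -[- u]scaleN1r RA_Zl scaleN1r. Qed.
Let RA_Nr u t v : RA u (- t) v = - RA u t v.
Proof. by rewrite -[- t]scaleN1r RA_Zr scaleN1r. Qed.

Ltac op_ring :=
  rewrite ?(RD, AD, RN, AN) ?(RR, AA, AR) ?toRA ?toR ?toA;
  expand_words; rewrite ?(ww, yw, zw); expand_words;
  rewrite ?(RA_Dl, RA_Dr, RA_Zl, RA_Zr, RA_Nl, RA_Nr);
  move: RA => RA'; lin_over k V.

Lemma operator_dd1 v1 v2 v3 t1 t2 t3 :
  t1 = (R z v1 + R w v2 + R y v3) + (- A z v1 + A w v2 + A y v3) ->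
  t2 = (R w' v3 - R (b *: y) v2) + (A w' v3 - A (b *: y) v2) ->
  t3 = (- R w v1 - R (e *: z) v2 - R z v3) + (A w v1 - A (e *: z) v2 - A z v3) ->
  (R w t1 + R y t2 + R z t3) - (A w t1 + A y t2 + A z t3) = 0.
Proof. by move=> -> -> ->; op_ring. Qed.

Lemma operator_dd2 u v1 v2 v3 :
  v1 = - R z u - A z u -> v2 = R y u - A y u -> v3 = R w' u - A w' u ->
  [/\ (R z v1 + R w v2 + R y v3) + (- A z v1 + A w v2 + A y v3) = 0,
      (R w' v3 - R (b *: y) v2) + (A w' v3 - A (b *: y) v2) = 0
    & (- R w v1 - R (e *: z) v2 - R z v3) + (A w v1 - A (e *: z) v2 - A z v3) = 0].
Proof. by move=> -> -> ->; split; op_ring. Qed.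
End OperatorIdentities.

Section ModuleKoszul.
Variables (k : fieldType) (B : gralg k) (w y z : B) (e b : k).
Hypotheses (hw : hom 1 w) (hy : hom 1 y) (hz : hom 1 z).
Hypothesis ww : w * w = e *: (z * z) + b *: (y * y).
Hypothesis yw : y * w = z * z + e *: (y * y) - w * y.
Hypothesis zw : z * w = w * z.
Local Notation w' := (w - e *: y).
Hypothesis connB : connected B.
Hypothesis ex0 : forall n (u : B), hom n.+1 u ->
  exists v1 v2 v3 : B, v1 * w + v2 * y + v3 * z = u.
Hypothesis ex1 : forall v1 v2 v3 : B, v1 * w + v2 * y + v3 * z = 0 ->
  exists s1 s2 s3 : B, [/\ v1 = s1 * z + s2 * w + s3 * y,
    v2 = s3 * w' - b *: (s2 * y) & v3 = - (s1 * w) - e *: (s2 * z) - s3 * z].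
Hypothesis ex2 : forall v1 v2 v3 : B, v1 * z + v2 * w + v3 * y = 0 ->
  v3 * w' = b *: (v2 * y) ->
  exists u, [/\ v1 = - (u * z), v2 = u * y & v3 = u * w'].
Hypothesis ex3 : forall u : B, u * z = 0 -> u = 0.

Variables (M : lmodType B) (J : choiceType).
Local Notation kM := (restr (in_alg B) M).
Local Notation F := {malg B[J]}.
Let kF : lmodType k := restr (in_alg B) F.
Variables (m : J -> kM) (coord : kM -> {malg k[J]}).
Hypotheses (coord_lin : linear coord) (coordK : forall v, malg_ext m (coord v) = v).
Hypothesis coord_m : forall j, coord (m j) = << j >>.

Local Notation R := (@opR k B J).
Local Notation A := (@opA k B M J m coord).
Let F3 : lmodType B := (F * F * F)%type.

Let D1R (t : F3) : F := R w t.1.1 + R y t.1.2 + R z t.2.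
Let D1A (t : F3) : F := - (A w t.1.1 + A y t.1.2 + A z t.2).
(** Two-sided Fox derivatives of the relations in [w], [y], [z]: a word [pq] contributes [R p] to
    the coordinate of [q], collected in [D2R], and [A q] to the coordinate of [p], collected in
    [D2A]. The [R] part is the Koszul differential on coefficients and raises the degree by one; the
    [A] part preserves it. *)
Let D2R (v : F3) : F3 := (R z v.1.1 + R w v.1.2 + R y v.2,
  R w' v.2 - R (b *: y) v.1.2, - R w v.1.1 - R (e *: z) v.1.2 - R z v.2).
Let D2A (v : F3) : F3 := (- A z v.1.1 + A w v.1.2 + A y v.2,
  A w' v.2 - A (b *: y) v.1.2, A w v.1.1 - A (e *: z) v.1.2 - A z v.2).
(** [D3R] carries the left factors [-z], [y], [w'] of the cubic identity [-z r1 + y r2 + w' r3 = r1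
    z + r2 y + r3 w'] between the relations, and [D3A] the right factors, negated. *)
Let D3R (u : F) : F3 := (- R z u, R y u, R w' u).
Let D3A (u : F) : F3 := (- A z u, - A y u, - A w' u).
Let eps : F -> M := malg_ext (m : J -> M).

Let epsL : linear eps := eps_lin m.
Let Rlin := @opR_lin k B J.
Let Alin u : linear (A u) := opA_lin m coord u.
Let pr1 : linear (fun t : F3 => t.1.1). Proof. by []. Qed.
Let pr2 : linear (fun t : F3 => t.1.2). Proof. by []. Qed.
Let pr3 : linear (fun t : F3 => t.2). Proof. by []. Qed.

Let RP u (V : lmodType B) (f : V -> F) : linear f -> linear (fun v => R u (f v)).
Proof. exact/linear_precomp/Rlin. Qed.
Let AP u (V : lmodType B) (f : V -> F) : linear f -> linear (fun v => A u (f v)).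
Proof. exact/linear_precomp/Alin. Qed.

Ltac lin_auto := repeat first [exact: linear_id | exact: pr1 | exact: pr2 | exact: pr3
  | apply: linear_pair | apply: RP | apply: AP | apply: linear_add | apply: linear_opp ].

Let D1R_lin : linear D1R. Proof. by rewrite /D1R; lin_auto. Qed.
Let D1A_lin : linear D1A. Proof. by rewrite /D1A; lin_auto. Qed.
Let D2R_lin : linear D2R. Proof. by rewrite /D2R; lin_auto. Qed.
Let D2A_lin : linear D2A. Proof. by rewrite /D2A; lin_auto. Qed.
Let D3R_lin : linear D3R.
Proof. by rewrite /D3R; lin_auto. Qed.
Let D3A_lin : linear D3A.
Proof. by rewrite /D3A; lin_auto. Qed.

Let RB u : additive_fun (R u : kF -> kF).
Proof. exact: linear_additive (Rlin u). Qed.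
Let AB u : additive_fun (A u : kF -> kF).
Proof. exact: linear_additive (Alin u). Qed.
Let AA u t (v : kF) : A u (A t v) = A (u * t) v. Proof. exact: opAA. Qed.
Let AR u t (v : kF) : A u (R t v) = R t (A u v). Proof. exact: opAR. Qed.
Let A1 (v : kF) : A 1 v = v. Proof. exact: opA1. Qed.
Let Rl v : linear (fun u => R u v : kF).
Proof. by move=> c u t; apply: opR_linl. Qed.
Let Al v : linear (fun u => A u v : kF).
Proof. by move=> c u t; apply: (opA_linl m coord_lin). Qed.
Let RZ c u (v : kF) : R u (c *: v) = c *: (R u v : kF).
Proof.
have := Rlin u c%:A v 0; rewrite !addr0 (linear_fun0 (Rlin u)) addr0; exact.
Qed.

Let d1d2 v : D1R (D2R v + D2A v) + D1A (D2R v + D2A v) = 0.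
Proof.
case: v => -[v1 v2] v3.
exact: (@operator_dd1 k B w y z e b kF ww yw zw R A RB AB (@opRR k B J) AA AR
  (@opR1 k B J) A1 Rl Al RZ v1 v2 v3 _ _ _ erefl erefl erefl).
Qed.

Let pair3_eq (p q : F3) : p.1.1 = q.1.1 -> p.1.2 = q.1.2 -> p.2 = q.2 -> p = q.
Proof. by case: p q => -[? ?] ? [[? ?] ?] /= -> -> ->. Qed.

Let d2d3 u : D2R (D3R u + D3A u) + D2A (D3R u + D3A u) = 0.
Proof.
have [E1 E2 E3] := @operator_dd2 k B w y z e b kF ww yw zw R A RB AB (@opRR k B J) AA AR
  (@opR1 k B J) A1 Rl Al RZ u _ _ _ erefl erefl erefl.
by apply: pair3_eq; [exact: E1 | exact: E2 | exact: E3].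
Qed.

(** Solutions are chosen coefficient by coefficient; the zero solution outside [D] keeps the
    supports finite. *)
Lemma build3 (D : {fset J}) (P : J -> B -> B -> B -> Prop) :
  (forall j, exists s1 s2 s3, P j s1 s2 s3) -> (forall j, j \notin D -> P j 0 0 0) ->
  exists p1 p2 p3 : F, forall j, P j p1@_j p2@_j p3@_j.
Proof.
move=> exP P0.
have {}exP j : exists s : B * B * B, P j s.1.1 s.1.2 s.2.
  by have [s1 [s2 [s3 Ps]]] := exP j; exists (s1, s2, s3).
pose s j := projT1 (cid (exP j)); have sP j : P j (s j).1.1 (s j).1.2 (s j).2.
  by rewrite /s; case: cid.
have build (f : J -> B) : exists p : F, forall j, p@_j = if j \in D then f j else 0.
  by apply: (malg_build (D := D)) => j /negbTE ->.
have [p1 p1E] := build (fun j => (s j).1.1).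
have [p2 p2E] := build (fun j => (s j).1.2).
have [p3 p3E] := build (fun j => (s j).2).
by exists p1, p2, p3 => j; rewrite p1E p2E p3E; case: ifPn => // /P0.
Qed.

Let exR1 t : D1R t = 0 -> exists v, D2R v = t.
Proof.
move=> t0; pose D := (msupp t.1.1 `|` msupp t.1.2 `|` msupp t.2)%fset.
have [||v1 [v2 [v3 vE]]] := @build3 D (fun j s1 s2 s3 =>
  [/\ t.1.1@_j = s1 * z + s2 * w + s3 * y, t.1.2@_j = s3 * w' - b *: (s2 * y)
    & t.2@_j = - (s1 * w) - e *: (s2 * z) - s3 * z]).
- move=> j; apply: ex1; have := congr1 (mcoeff j) t0.
  by rewrite /D1R !mcoeffD mcoeff0; do 3!rewrite opR_coef.
- move=> j; rewrite !inE !negb_or -!andbA => /and3P[j1 j2 j3].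
  rewrite !mcoeff_outdom // !mul0r !scaler0 !oppr0 !addr0; by split.
exists (v1, v2, v3); apply: pair3_eq; apply/malgP => j; have [E1 E2 E3] := vE j;
  rewrite /D2R /= ?(mcoeffD, mcoeffN, opR_coef).
- by rewrite E1.
- by rewrite E2 scalerAr.
- by rewrite E3 scalerAr.
Qed.

Let exR2 v : D2R v = 0 -> exists u, D3R u = v.
Proof.
case: v => -[v1 v2] v3 v0.
have E1 : R z v1 + R w v2 + R y v3 = 0 := congr1 (fun p : F3 => p.1.1) v0.
have E2 : R w' v3 - R (b *: y) v2 = 0 := congr1 (fun p : F3 => p.1.2) v0.
have [||u [_ [_ uE]]] := @build3 (msupp v1 `|` msupp v2 `|` msupp v3)%fset
  (fun j s1 _ _ => [/\ v1@_j = - (s1 * z), v2@_j = s1 * y & v3@_j = s1 * w']).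
- move=> j; have [||u [u1 u2 u3]] := @ex2 v1@_j v2@_j v3@_j.
  + by have := congr1 (mcoeff j) E1; rewrite !mcoeffD mcoeff0; do 3!rewrite opR_coef.
  + apply/eqP; rewrite -subr_eq0; have := congr1 (mcoeff j) E2.
    rewrite mcoeffD mcoeffN mcoeff0; do 2!rewrite opR_coef.
    by rewrite -scalerAr => ->.
  by exists u, 0, 0.
- move=> j; rewrite !inE !negb_or -!andbA => /and3P[j1 j2 j3].
  by rewrite !mcoeff_outdom // !mul0r oppr0.
exists u; apply: pair3_eq; apply/malgP => j; have [H1 H2 H3] := uE j;
  by rewrite /D3R /= ?mcoeffN opR_coef.
Qed.

Let exR3 u : D3R u = 0 -> u = 0.
Proof.
move=> u0; have E1 : - R z u = 0 := congr1 (fun p : F3 => p.1.1) u0.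
apply/malgP => j; rewrite mcoeff0; apply: ex3.
by rewrite -opR_coef -[opR _ _]opprK E1 oppr0 mcoeff0.
Qed.

Let compF := @fcomp_components k B J.
Let comp3 := components_prod (components_prod compF compF) compF.

Let hby : hom 1 (b *: y). Proof. exact/homZ/hy. Qed.
Let hez : hom 1 (e *: z). Proof. exact/homZ/hz. Qed.
Let hw' : hom 1 w'. Proof. exact/homB/homZ/hy. Qed.
Let fcB n p q : fcomp n (p - q : F) = fcomp n p - fcomp n q.
Proof. by have [H _ _ _] := compF; apply: H. Qed.
Let fcN n p : fcomp n (- p : F) = - fcomp n p.
Proof. exact: (additive_funN (fcB n)). Qed.
Let fcR n u p : hom 1 u -> fcomp n.+1 (R u p) = R u (fcomp n p).
Proof. by move=> hu; apply: opR_comp. Qed.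
Let fcR0 u p : hom 1 u -> fcomp 0 (R u p) = 0.
Proof. by move=> hu; apply: opR_comp0. Qed.
Let fcA n u p : fcomp n (A u p) = A u (fcomp n p).
Proof. exact: opA_comp. Qed.
Let fc3 n (p : F3) : F3 := (fcomp n p.1.1, fcomp n p.1.2, fcomp n p.2).

Let epsR u v : eps (R u v) = eps (A u v). Proof. exact: eps_opR. Qed.
Let epsd1 t : eps (D1R t + D1A t) = 0.
Proof.
have epsD := additive_funD (linear_additive epsL).
have epsN := additive_funN (linear_additive epsL).
by rewrite /D1R /D1A !(epsD, epsN) !epsR subrr.
Qed.

Let eps_ker v : eps v = 0 -> exists t, D1R t + D1A t = v.
Proof.
apply: (perturbed_exact comp3 compF (d' := eps) (R := D1R) (A := D1A)) => //.
- exact: linear_additive epsL.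
- exact: linear_additive D1R_lin.
- exact: linear_additive D1A_lin.
- by move=> n t; rewrite /D1R !fcompD !fcR.
- by move=> t; rewrite /D1R !fcompD !fcR0 // !addr0.
- by move=> n t; rewrite /D1A fcN !fcompD !fcA.
(* A cycle concentrated in degree 0 is [1 (x) eps v], hence zero. In positive degree the top
   coefficients lie in [Bw + By + Bz]. *)
move=> [|n] {}v v0 vN.
  have -> : v = 0 by exact: (eps_degree0_inj coord_lin coordK coord_m connB vN v0).
  by exists 0; rewrite (linear_fun0 D1R_lin) (additive_fun0 (fcB 0)).
have [||v1 [v2 [v3 vE]]] := @build3 (msupp (fcomp n.+1 v))
  (fun j s1 s2 s3 => s1 * w + s2 * y + s3 * z = (fcomp n.+1 v)@_j).
- by move=> j; apply: (ex0 (n := n)); rewrite fcompE; apply: hcomp_hom.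
- by move=> j /mcoeff_outdom ->; rewrite !mul0r !addr0.
exists (v1, v2, v3); apply/malgP => j; rewrite -vE /D1R /= !mcoeffD.
by do 3!rewrite opR_coef.
Qed.

Lemma pd_le3_module : pd_le M 3.
Proof.
have D1B := linear_additive D1R_lin; have D1B' := linear_additive D1A_lin.
have D2B := linear_additive D2R_lin; have D2B' := linear_additive D2A_lin.
have D3B := linear_additive D3R_lin; have D3B' := linear_additive D3A_lin.
have projF : projective (F : lmodType B) by exact: projective_malg.
have projF3 : projective F3 by apply/projective_prod/projF/projective_prod.
have D1S n t : fcomp n.+1 (D1R t) = D1R (fc3 n t) by rewrite /D1R !fcompD !fcR.
have D1C n t : fcomp n (D1A t) = D1A (fc3 n t) by rewrite /D1A fcN !fcompD !fcA.
have D2S n t : fc3 n.+1 (D2R t) = D2R (fc3 n t).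
  by apply: pair3_eq; rewrite /= ?(fcompD, fcB, fcN) !fcR.
have D2C n t : fc3 n (D2A t) = D2A (fc3 n t).
  by apply: pair3_eq; rewrite /= ?(fcompD, fcB, fcN) !fcA.
have D20 t : fc3 0 (D2R t) = 0.
  by apply: pair3_eq; rewrite /= ?(fcompD, fcB, fcN) !fcR0 ?oppr0 ?addr0.
have D3S n u : fc3 n.+1 (D3R u) = D3R (fcomp n u).
  by apply: pair3_eq; rewrite /= ?fcN !fcR.
have D3C n u : fc3 n (D3A u) = D3A (fcomp n u).
  by apply: pair3_eq; rewrite /= ?fcN !fcA.
have D30 u : fc3 0 (D3R u) = 0.
  by apply: pair3_eq; rewrite /= ?fcN !fcR0 ?oppr0.
apply: (@pd_le3_intro B M F F3 F3 F eps (fun t => D1R t + D1A t)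
  (fun v => D2R v + D2A v) (fun u => D3R u + D3A u) epsL
  (linear_add D1R_lin D1A_lin) (linear_add D2R_lin D2A_lin)
  (linear_add D3R_lin D3A_lin) projF projF3 projF3 projF
  (eps_surj coordK) epsd1 d1d2 d2d3 eps_ker).
- exact: (perturbed_exact2 comp3 comp3 compF D2B D2B' D1B D1B' D2S D20 D2C D1S D1C d1d2 exR1).
- exact: (perturbed_exact2 compF comp3 comp3 D3B D3B' D2B D2B' D3S D30 D3C D2S D2C d2d3 exR2).
- exact: (perturbed_injective compF comp3 D3B' D3S D3C exR3).
Qed.
End ModuleKoszul.

Lemma B_gldim_le3 (k : fieldType) (a : k) (B : gralg k) (xyz : 'I_3 -> B) :
  presented (fun=> 1%N) (relB a) xyz -> bB a != 0 -> gldim_le B 3.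
Proof.
move=> presB b_neq0 M.
have [J [m [coord [coord_lin coordK coord_m]]]] := hamel_basis (restr (in_alg B) M).
apply: (pd_le3_module (hom_w presB) (hom_y presB) (hom_z presB) (relB_ww presB)
  (relB_wy presB) (relB_wz presB) (B_connected presB) _ _ _ _ coord_lin coordK coord_m).
- exact: gens_span_hom presB.
- exact: gens_syzygy presB.
- exact: koszul_syzygy presB b_neq0.
- exact: mulz_inj presB b_neq0.
Qed.

(** * The graded Koszul resolution *)

Section Gradings.
Variable I : eqType.

(** The sum formula is required over every list containing a given one, so that two elements, such
    as the components of a pair, can be decomposed over a common list. *)
Definition grading_proj (V : zmodType) (G : I -> V -> Prop) (c : I -> V -> V) :=
  [/\ forall i, additive_fun (c i), forall i u, G i (c i u),
      forall i u v, G i u -> G i v -> G i (u - v),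
      forall i j u, G i u -> c j u = if j == i then u else 0
    & forall u, exists s : seq I, forall r : seq I, uniq r -> {subset s <= r} ->
        u = \sum_(i <- r) c i u].

Lemma grading_proj_direct (V : zmodType) (G : I -> V -> Prop) c :
  grading_proj G c -> direct_grading G.
Proof.
move=> [cB Gc GB cG cS]; split=> //.
- by move=> i; rewrite -(additive_fun0 (cB i)); apply: Gc.
- move=> u; have [s sE] := cS u; exists (undup s), (fun i => c i u).
  split; [exact: undup_uniq | by move=> i; apply: Gc |].
  by apply: sE => [|i]; rewrite ?undup_uniq ?mem_undup.
move=> s f s_uniq Gf f0 i i_s.
have cD := additive_funD (cB i); have c0 := additive_fun0 (cB i).
have := congr1 (c i) f0; rewrite (big_morph (c i) cD c0) c0.
rewrite (bigD1_seq i) //= (cG i i _ (Gf i)) eqxx big1 ?addr0 // => j ne_ji.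
by rewrite (cG j i _ (Gf j)) eq_sym (negbTE ne_ji).
Qed.

Lemma direct_grading_proj (V : zmodType) (G : I -> V -> Prop) (grG : direct_grading G) :
  grading_proj G (dgcomp grG).
Proof.
split.
- by move=> i u v; apply: dgcompB.
- by move=> i u; apply: dgcomp_hom.
- by case: grG.
- by move=> i j u; apply: dgcomp_id.
move=> u; have [s s_uniq uE] := dgcomp_sum grG u; exists s => r r_uniq sub.
rewrite {1}uE [RHS](bigID (mem s)) /= [X in _ + X]big1 ?addr0; last first.
  move=> j js; rewrite (dgcompE grG _ s_uniq (fun l => dgcomp_hom grG l u) uE).
  by rewrite (negbTE js).
rewrite -[RHS]big_filter; apply: perm_big; apply: uniq_perm; rewrite ?filter_uniq //.
by move=> j; rewrite mem_filter andb_idr // => /sub.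
Qed.

Lemma grading_proj_prod (V V' : zmodType) (G : I -> V -> Prop) (G' : I -> V' -> Prop) c c' :
  grading_proj G c -> grading_proj G' c' ->
  grading_proj (fun i (p : V * V') => G i p.1 /\ G' i p.2) (fun i p => (c i p.1, c' i p.2)).
Proof.
move=> [cB Gc GB cG cS] [cB' Gc' GB' cG' cS']; split.
- by move=> i u v; rewrite /= cB cB'.
- by move=> i u; split; [apply: Gc | apply: Gc'].
- by move=> i u v [u1 u2] [v1 v2]; split; [apply: GB | apply: GB'].
- by move=> i j [u u'] [/= Gu Gu']; rewrite (cG i j u Gu) (cG' i j u' Gu'); case: eqP.
move=> [u u']; have [s sE] := cS u; have [s' sE'] := cS' u'; exists (s ++ s') => r r_uniq sub.
have sub1 : {subset s <= r} by move=> i i_s; apply: sub; rewrite mem_cat i_s.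
have sub2 : {subset s' <= r} by move=> i i_s; apply: sub; rewrite mem_cat i_s orbT.
rewrite {1}(sE r r_uniq sub1) {1}(sE' r r_uniq sub2) /=.
elim/big_rec3: _ => //= i p p1 p2 _; by move=> <-.
Qed.
End Gradings.

Lemma grading_proj_reindex (I J : eqType) (f : I -> J) (g : J -> I) (V : zmodType)
    (G : I -> V -> Prop) c : cancel f g -> cancel g f ->
  grading_proj G c -> grading_proj (fun j => G (g j)) (fun j => c (g j)).
Proof.
move=> fK gK [cB Gc GB cG cS]; split=> //.
- by move=> j; apply: GB.
- by move=> i j u Gu; rewrite (cG (g i) (g j) u Gu) (can_eq gK).
move=> u; have [s sE] := cS u; exists (map f s) => r r_uniq sub.
have gr_uniq : uniq (map g r) by rewrite (map_inj_uniq (can_inj gK)).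
rewrite [LHS](sE _ gr_uniq) ?big_map // => i i_s.
by rewrite -(fK i); apply/map_f/sub/map_f.
Qed.

Section GradedModules.
Variables (k : fieldType) (B : gralg k).

Lemma homz0 j : homz j (0 : B). Proof. by case: j => n //; apply: hom0. Qed.

Lemma homzB j (u v : B) : homz j u -> homz j v -> homz j (u - v).
Proof. by case: j => n /=; [apply: homB | move=> -> ->; rewrite subr0]. Qed.

Lemma homzN j (u : B) : homz j u -> homz j (- u).
Proof. by rewrite -sub0r; apply/homzB/homz0. Qed.

Lemma homzD j (u v : B) : homz j u -> homz j v -> homz j (u + v).
Proof. by move=> hu /homzN; rewrite -{2}[v]opprK; apply: homzB. Qed.

Lemma homzZ j (c : k) (u : B) : homz j u -> homz j (c *: u).
Proof. by case: j => n /=; [apply: homZ | move=> ->; rewrite scaler0]. Qed.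

Lemma homzM m j (u v : B) : hom m u -> homz j v -> homz (m%:Z + j) (u * v).
Proof.
case: j => n /= hu hv; first exact: gr_mul.
by rewrite hv mulr0; apply: homz0.
Qed.

Lemma homzM1 j (u v : B) : homz j u -> hom 1 v -> homz (j + 1) (u * v).
Proof.
case: j => n /= hu hv; first exact: gr_mul.
by rewrite hu mul0r; apply: homz0.
Qed.

Lemma homz_proj : exists c, grading_proj (fun j (u : B) => homz j u) c.
Proof.
have [cB Gc GB cG cS] := direct_grading_proj (gr_direct B).
pose c (j : int) (u : B) : B := if j is Posz n then hcomp n u else 0.
exists c; split.
- by move=> [n|n] u v /=; [apply: cB | rewrite subr0].
- by move=> [n|n] u /=; [apply: Gc | ].
- exact: homzB.
- move=> [m|m] [n|n] u /= hu; rewrite ?hu /hcomp ?dgcomp0 //; last by case: eqP.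
  by rewrite (cG m).
move=> u; have [N uN] := hcomp_bound u.
exists (map Posz (iota 0 N)) => r r_uniq sub.
rewrite {1}(hcomp_sum_ord uN) (bigID (mem (map Posz (iota 0 N)))) /=.
rewrite [X in _ + X]big1 ?addr0; last first.
  move=> [n|n] nr //=; apply: uN; rewrite leqNgt; apply: contra nr => lt_n.
  by apply: map_f; rewrite mem_iota.
rewrite -[RHS]big_filter (perm_big (map Posz (iota 0 N))) ?big_map.
  by rewrite -(big_mkord xpredT (fun i => hcomp i u)) /index_iota subn0.
apply: uniq_perm; rewrite ?filter_uniq //.
  by rewrite map_inj_uniq ?iota_uniq // => i j [].
by move=> j; rewrite mem_filter andb_idr // => /sub.
Qed.

Lemma shift_proj (V : zmodType) (G : int -> V -> Prop) (s : int) :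
  (exists c, grading_proj G c) -> exists c, grading_proj (fun j => G (j - s)) c.
Proof.
move=> [c Gc]; exists (fun j => c (j - s)).
exact: (grading_proj_reindex (addrK s) (subrK s) Gc).
Qed.

Lemma shift1_direct s : direct_grading (fun j (u : B^o) => homz (j - s) (u : B)).
Proof. by have [c /grading_proj_direct] := shift_proj s homz_proj. Qed.

Lemma shift1_scale s (m : nat) (j : int) (u : B) (v : B^o) :
  hom m u -> homz (j - s) (v : B) -> homz (m%:Z + j - s) (u *: v : B).
Proof. by move=> hu hv; rewrite -addrA; apply: homzM. Qed.

(** The free module [B(-s)], whose generator sits in degree [s]. *)
Definition shift1 (s : int) : grmod B := GrMod (shift1_direct s) (@shift1_scale s).

Let hom3 s j (p : B^o * B^o * B^o) :=
  (homz (j - s) (p.1.1 : B) /\ homz (j - s) (p.1.2 : B)) /\ homz (j - s) (p.2 : B).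

Lemma shift3_direct s : direct_grading (hom3 s).
Proof.
have [c Gc] := shift_proj s homz_proj.
exact: (grading_proj_direct (grading_proj_prod (grading_proj_prod Gc Gc) Gc)).
Qed.

Lemma shift3_scale s (m : nat) (j : int) (u : B) (p : B^o * B^o * B^o) :
  hom m u -> hom3 s j p -> hom3 s (m%:Z + j) (u *: p).
Proof. by move=> hu [[h1 h2] h3]; do !split; apply: shift1_scale. Qed.

Definition shift3 (s : int) : grmod B := GrMod (shift3_direct s) (@shift3_scale s).

Lemma zero_direct : direct_grading (fun (j : int) (u : 'rV[B]_0) => True).
Proof.
have O0 (p : 'rV[B]_0) : p = 0 by apply/rowP => -[].
split=> // u.
by exists [::], (fun=> 0); split=> //; rewrite big_nil; apply: O0.
Qed.

Definition zero_grmod : grmod B :=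
  GrMod zero_direct (fun (m : nat) (j : int) (u : B) (v : 'rV[B]_0) _ _ => I).

Section Trivial.
Variable aug : {rmorphism B -> k}.
Hypothesis aug_hom : forall n (u : B), (0 < n)%N -> hom n u -> aug u = 0.
Hypothesis aug_scalar : forall c : k, aug c%:A = c.

Let triv_mod : lmodType B := restr aug k^o.
Let triv_hom (j : int) (c : triv_mod) := j = 0 \/ c = 0.

Lemma triv_direct : direct_grading triv_hom.
Proof.
apply: (@grading_proj_direct _ _ _ (fun (j : int) c => if j == 0 then c else 0)); split.
- by move=> j u v; case: eqP => // _; rewrite subr0.
- by move=> j u; case: eqP => [->|_]; [left | right].
- by move=> j u v [->|->]; [left | move=> [->|->]; [left | right; rewrite subr0]].
- move=> i j u [->|->] //; by rewrite !if_same.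
move=> u; exists [:: 0] => r r_uniq sub.
have r0 : (0 : int) \in r by apply: sub; rewrite inE.
by rewrite (bigD1_seq 0) //= big1 ?addr0 // => j /negbTE ->.
Qed.

Lemma triv_scale (m : nat) (j : int) (u : B) (v : triv_mod) :
  hom m u -> triv_hom j v -> triv_hom (m%:Z + j) (u *: v).
Proof.
move=> hu [->|->]; last by right; rewrite scaler0.
case: m hu => [|m] hu; [by left | right].
by rewrite restr_scaleE (aug_hom _ hu) // scale0r.
Qed.

Definition triv_grmod : grmod B := GrMod triv_direct triv_scale.

Lemma triv_grmodP : trivial_module triv_grmod.
Proof.
exists (1 : k); split.
- by apply/eqP; apply: oner_neq0.
- by left.
- by move=> n u n_gt0 hu; rewrite [u *: _]restr_scaleE (aug_hom n_gt0 hu) scale0r.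
- move=> c; exists c; rewrite [c%:A *: _]restr_scaleE aug_scalar.
  by rewrite [_ *: _]mulr1.
Qed.
End Trivial.
End GradedModules.

(** * The Gorenstein property and the global dimension *)

Section KoszulComplex.
Variables (k : fieldType) (B : gralg k) (w w' y z : B) (e b : k).
Hypotheses (hw : hom 1 w) (hw' : hom 1 w') (hy : hom 1 y) (hz : hom 1 z).
Hypotheses (wE : w = w' + e *: y) (ww : w * w = e *: (z * z) + b *: (y * y)).
Hypotheses (w'w' : w' * w' = b *: (y * y)) (yw : y * w + w' * y = z * z).
Hypothesis zw : z * w = w * z.
Local Notation B3 := (B^o * B^o * B^o)%type.

Definition kd1 (t : B3) : B^o := (t.1.1 : B) * w + (t.1.2 : B) * y + (t.2 : B) * z.
(** The rows are the relations [zw - wz], [ww - e zz - b yy] and [yw + w'y - zz] without their last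
    letters, sorted by that letter. So [kd1 (kd2 v)] evaluates the relations. *)
Definition kd2 (v : B3) : B3 :=
  ((v.1.1 : B) * z + (v.1.2 : B) * w + (v.2 : B) * y,
   (v.2 : B) * w' - b *: ((v.1.2 : B) * y),
   - ((v.1.1 : B) * w) - e *: ((v.1.2 : B) * z) - (v.2 : B) * z).
(** The left factors in [-z r1 + y r2 + w' r3 = r1 z + r2 y + r3 w']. Without their last letters,
    the terms on the right are relations, whence [kd2 (kd3 u) = 0]. *)
Definition kd3 (u : B^o) : B3 := (- ((u : B) * z), (u : B) * y, (u : B) * w').

Let lmul_linear (q : B) : linear (fun u : B^o => (u : B) * q : B^o).
Proof. by move=> c u v; rewrite mulrDl -mulrA. Qed.
Let zmul_linear (c : k) (q : B) : linear (fun u : B^o => c *: ((u : B) * q) : B^o).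
Proof. by move=> d u v; rewrite mulrDl scalerDr -mulrA scalerAr. Qed.
Let p1_linear : linear (fun t : B3 => t.1.1). Proof. by []. Qed.
Let p2_linear : linear (fun t : B3 => t.1.2). Proof. by []. Qed.
Let p3_linear : linear (fun t : B3 => t.2). Proof. by []. Qed.

Lemma kd1_linear : linear kd1.
Proof.
apply: linear_add; [apply: linear_add|].
- exact: linear_precomp (lmul_linear w) p1_linear.
- exact: linear_precomp (lmul_linear y) p2_linear.
- exact: linear_precomp (lmul_linear z) p3_linear.
Qed.

Lemma kd2_linear : linear kd2.
Proof.
apply: linear_pair; [apply: linear_pair|].
- apply: linear_add; [apply: linear_add|].
  + exact: linear_precomp (lmul_linear z) p1_linear.
  + exact: linear_precomp (lmul_linear w) p2_linear.
  + exact: linear_precomp (lmul_linear y) p3_linear.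
- apply: linear_sub.
  + exact: linear_precomp (lmul_linear w') p3_linear.
  + exact: linear_precomp (zmul_linear b y) p2_linear.
- apply: linear_sub; [apply: linear_sub|].
  + exact: linear_opp (linear_precomp (lmul_linear w) p1_linear).
  + exact: linear_precomp (zmul_linear e z) p2_linear.
  + exact: linear_precomp (lmul_linear z) p3_linear.
Qed.

Lemma kd3_linear : linear kd3.
Proof.
apply: linear_pair; [apply: linear_pair|].
- exact: linear_opp (lmul_linear z).
- exact: lmul_linear.
- exact: lmul_linear.
Qed.

Definition kosz (i : nat) : grmod B := match i with
  0%N => shift1 B 0 | 1%N => shift3 B 1 | 2%N => shift3 B 2 | 3%N => shift1 B 3
  | _ => zero_grmod B end.

Let zero_linear (M N : lmodType B) : linear (fun _ : M => 0 : N).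
Proof. by move=> c u v; rewrite scaler0 addr0. Qed.

Definition kdiff (i : nat) : {linear kosz i.+1 -> kosz i} :=
  match i return {linear kosz i.+1 -> kosz i} with
  | 0%N => mklin kd1_linear | 1%N => mklin kd2_linear | 2%N => mklin kd3_linear
  | _ => mklin (@zero_linear _ _) end.

Variable aug : {rmorphism B -> k}.
Hypothesis aug_hom : forall n (u : B), (0 < n)%N -> hom n u -> aug u = 0.
Hypothesis aug_scalar : forall c : k, aug c%:A = c.
Let T : grmod B := triv_grmod aug_hom.

Definition kaug_fun (u : B^o) : T := aug u.
Lemma kaug_linear : linear kaug_fun.
Proof. by move=> c u v; rewrite /kaug_fun rmorphD rmorphM. Qed.
Definition kaug : {linear kosz 0 -> T} := mklin kaug_linear.

Hypothesis span : forall u : B, exists c : k, exists v1 v2 v3 : B,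
  u = c%:A + (v1 * w + v2 * y + v3 * z).
Hypothesis syz1 : forall v1 v2 v3 : B, v1 * w + v2 * y + v3 * z = 0 ->
  exists s1 s2 s3 : B, [/\ v1 = s1 * z + s2 * w + s3 * y,
    v2 = s3 * w' - b *: (s2 * y) & v3 = - (s1 * w) - e *: (s2 * z) - s3 * z].
Hypothesis syz2 : forall v1 v2 v3 : B, v1 * z + v2 * w + v3 * y = 0 ->
  v3 * w' = b *: (v2 * y) ->
  exists u, [/\ v1 = - (u * z), v2 = u * y & v3 = u * w'].
Hypothesis zreg : forall u : B, u * z = 0 -> u = 0.

Let pair3 (M : Type) (p1 p2 p3 q1 q2 q3 : M) : p1 = q1 -> p2 = q2 -> p3 = q3 ->
  (p1, p2, p3) = (q1, q2, q3).
Proof. by move=> -> -> ->. Qed.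

Lemma kd12 v : kd1 (kd2 v) = 0.
Proof.
suff H (v1 v2 v3 : B) : kd1 (kd2 (v1, v2, v3)) = 0 :> B by case: v => [[v1 v2] v3]; apply: H.
rewrite /kd1 /kd2 /=.
have -> : 0 = v1 * (z * w - w * z) + v2 * (w * w - e *: (z * z) - b *: (y * y))
    + v3 * (y * w + w' * y - z * z) :> B.
  by rewrite zw ww yw; clear; expand_words; lin_over k B.
by clear; expand_words; lin_over k B.
Qed.

Lemma kd23 (u : B) : kd2 (kd3 u) = 0.
Proof.
rewrite /kd2 /kd3 /=; apply: pair3.
- have -> : 0 = u * (y * w + w' * y - z * z) :> B by rewrite yw subrr mulr0.
  by clear; expand_words; lin_over k B.
- by rewrite -!mulrA w'w' -scalerAr subrr.
- have -> : 0 = u * (z * w - w * z) :> B by rewrite zw subrr mulr0.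
  by rewrite wE; clear; expand_words; lin_over k B.
Qed.

Lemma aug_gen (u v : B) : hom 1 v -> aug (u * v) = 0.
Proof. by move=> hv; rewrite rmorphM (aug_hom _ hv) // mulr0. Qed.

Lemma aug_gen_r (u v : B) : hom 1 v -> aug (v * u) = 0.
Proof. by move=> hv; rewrite rmorphM (aug_hom _ hv) // mul0r. Qed.

Lemma kosz_resolution : projective_resolution kdiff kaug.
Proof.
have proj3 : projective (B3 : lmodType B).
  by do 2!(apply: projective_prod; last exact: projective_regular); apply: projective_regular.
split.
- case=> [|[|[|[|i]]]]; [exact: projective_regular | exact: proj3 | exact: proj3
    | exact: projective_regular |].
  by apply: projective_zero => p; apply/rowP => -[].
- by move=> c; exists (c%:A : B); apply: aug_scalar.
- move=> u; split=> [|[v ->]].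
    have [c [v1 [v2 [v3 ->]]]] := span u => au.
    exists ((v1, v2, v3) : B3); move: au; rewrite /= /kaug_fun !rmorphD aug_scalar.
    by rewrite !aug_gen // !addr0 => ->; rewrite scale0r add0r.
  by rewrite /= /kaug_fun /kd1 !rmorphD !aug_gen // !addr0.
case=> [|[|[|i]]].
- move=> [[v1 v2] v3]; split=> [|[v ->]]; last exact: kd12.
  by move=> /syz1[s1 [s2 [s3 [E1 E2 E3]]]]; exists ((s1, s2, s3) : B3); apply: pair3.
- move=> [[v1 v2] v3]; split=> [|[v ->]]; last exact: kd23.
  move=> [E1 E2 _]; have [|u [F1 F2 F3]] := syz2 E1; last by exists (u : B^o); apply: pair3.
  by apply/eqP; rewrite -subr_eq0; apply/eqP.
- move=> u; split=> [[]|[v ->]]; last by rewrite [LHS]linear0.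
  move=> /eqP; rewrite oppr_eq0 => /eqP/zreg -> _ _.
  by exists 0; rewrite linear0.
- move=> u; split=> // _; exists 0; apply/rowP => -[] //.
Qed.

Lemma kdiff_hom i j (p : kosz i.+1) : mhom j p -> mhom j (kdiff i p).
Proof.
case: i p => [|[|[|i]]] //.
- move=> [[v1 v2] v3] [[h1 h2] h3].
  have -> : j = j - 1 + 1 by rewrite subrK.
  rewrite /mhom /= subr0.
  by do !apply: homzD; apply: homzM1.
- move=> [[v1 v2] v3] [[h1 h2] h3].
  have -> : j = j - 2 + 1 + 1 by rewrite -addrA subrK.
  rewrite /mhom /= addrK; split; [split|].
  + by do !apply: homzD; apply: homzM1.
  + by apply: homzB; [|apply: homzZ]; apply: homzM1.
  + by do !apply: homzB; [apply: homzN|apply: homzZ|]; apply: homzM1.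
- move=> u hu; have -> : j = j - 3 + 1 + 2 by rewrite -addrA subrK.
  rewrite /mhom /= addrK; split; [split|]; [apply: homzN| |]; exact: homzM1.
- move=> u _; case: i u => [|i] u /=; last exact: I.
  exact: homz0.
Qed.

Lemma kaug_hom j (p : kosz 0) : mhom j p -> mhom j (kaug p).
Proof.
rewrite /mhom /= subr0; case: j => [[|n]|n] hp; [by left|right|right].
  exact: aug_hom hp.
by rewrite hp /kaug_fun rmorph0.
Qed.

(** Otherwise [pd_le2_split] and the injectivity of [kd3] give a linear [h] with [h (kd3 1) = 1].
    But [kd3 1] has entries in the augmentation ideal, so [aug] sends [h (kd3 1)] to 0. *)
Lemma kosz_pd : ~ pd_le T 2.
Proof.
move=> /(pd_le2_split kosz_resolution)[h /(_ (1 : B))] hE.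
have {}hE : h (kd3 (1 : B)) = 1 :> B.
  have /= [/eqP E _ _] := hE; move: E; rewrite eqr_opp -subr_eq0 -mulrBl.
  by move=> /eqP/zreg/eqP; rewrite subr_eq0 => /eqP.
have : aug (h (kd3 (1 : B)) : B) = 0; last first.
  by rewrite hE rmorph1 => /eqP; rewrite oner_eq0.
have -> : kd3 (1 : B) = (- z) *: ((1, 0, 0) : B3) + (y *: ((0, 1, 0) : B3)
    + w' *: ((0, 0, 1) : B3)).
  by apply: pair3; rewrite /= ?mul1r ![_ *: 1]mulr1 ![_ *: 0]mulr0 ?add0r ?addr0.
rewrite !linearP /= [h (w' *: _)]linearZ /=.
move: (h _) (h _) (h _) => c3 c2 c1.
suff : aug (- z * c1 + (y * c2 + w' * c3)) = 0 by [].
by rewrite !rmorphD mulNr rmorphN !aug_gen_r // oppr0 !addr0.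
Qed.

Hypothesis span_r : forall u : B, exists c : k, exists v1 v2 v3 : B,
  u = c%:A + (w * v1 + y * v2 + z * v3).
Hypothesis syz1_r : forall v1 v2 v3 : B, w * v1 + y * v2 + z * v3 = 0 ->
  exists s1 s2 s3 : B, [/\ v1 = z * s1 + w * s2 + y * s3,
    v2 = w' * s3 - b *: (y * s2) & v3 = - (w * s1) - e *: (z * s2) - z * s3].
Hypothesis vy_r : forall s t : B, w' * s = b *: (y * t) ->
  exists u, s = w' * u /\ t = y * u.
Hypothesis zreg_r : forall u : B, z * u = 0 -> u = 0.

Lemma linear1E (f : {linear B^o -> B^o}) (p : B) : f p = p * (f (1 : B) : B) :> B.
Proof. by apply: etrans (linearZ_LR f p 1); rewrite [_ *: 1]mulr1. Qed.

Lemma linear3E (f : {linear B3 -> B^o}) (p1 p2 p3 : B) :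
  f (p1, p2, p3) = p1 * (f (1, 0, 0) : B) + p2 * (f (0, 1, 0) : B) + p3 * (f (0, 0, 1) : B)
  :> B.
Proof.
have fZ := linearZ_LR f.
apply: etrans (congr2 +%R (congr2 +%R (fZ p1 _) (fZ p2 _)) (fZ p3 _)).
rewrite -!linearD; congr (f _); apply: pair3;
  by rewrite /= ![_ *: 1]mulr1 ![_ *: 0]mulr0 ?add0r ?addr0.
Qed.

Lemma mul_linear (c : B) : linear (fun p : B^o => (p : B) * c : B^o).
Proof. exact: lmul_linear. Qed.

Lemma mul3_linear (c1 c2 c3 : B) :
  linear (fun p : B3 => (p.1.1 : B) * c1 + (p.1.2 : B) * c2 + (p.2 : B) * c3 : B^o).
Proof.
apply: linear_add; [apply: linear_add|].
- exact: linear_precomp (lmul_linear c1) p1_linear.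
- exact: linear_precomp (lmul_linear c2) p2_linear.
- exact: linear_precomp (lmul_linear c3) p3_linear.
Qed.

Lemma kosz_cohomology0 : cohomology_zero kdiff 0.
Proof.
move=> f fd p; have := fd ((0, 0, 1) : B3); rewrite [LHS]linear1E [X in X * _]/=.
rewrite /kd1 /= !mul0r !add0r mul1r => /zreg_r f1.
by rewrite [LHS]linear1E f1 mulr0.
Qed.

Lemma kosz_cohomology1 : cohomology_zero kdiff 1.
Proof.
move=> f fd.
have fE (p1 p2 p3 : B) := linear3E f p1 p2 p3.
move: (f (1, 0, 0)) (f (0, 1, 0)) (f (0, 0, 1)) fE => c1 c2 c3 fE.
have {}fd v1 v2 v3 := etrans (esym (fE _ _ _)) (fd ((v1, v2, v3) : B3)).
have := fd 1 0 0; rewrite /= !(mul0r, scaler0, mul1r, addr0, add0r, oppr0, subr0).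
move=> E1.
have := fd 0 1 0; rewrite /= !(mul0r, scaler0, mul1r, addr0, add0r, oppr0, subr0) => E2.
have := fd 0 0 1; rewrite /= !(mul0r, scaler0, mul1r, addr0, add0r, oppr0, subr0) => E3.
(* Since [w = w' + e y], the combination [E2 - e E3] eliminates [c3] and reads
   [w' (c1 - e c2) = b y c2]. *)
have [|c0 [c1E c2E]] := @vy_r (c1 - e *: c2) c2.
  apply/eqP; rewrite -subr_eq0; apply/eqP.
  move: (congr2 (fun p q => p - e *: q) E2 E3); rewrite scaler0 subr0 => <-.
  by rewrite wE; clear; expand_words; lin_over k B.
have {}c1E : c1 = w * c0.
  by rewrite -[c1](subrK (e *: c2)) c1E c2E wE mulrDl scalerAl.
have c3E : c3 = z * c0.
  apply/eqP; rewrite -subr_eq0; apply/eqP/zreg_r.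
  rewrite mulrBr mulrA -yw; apply/eqP; rewrite -oppr_eq0 -E3 c1E c2E; apply/eqP.
  by clear; expand_words; lin_over k B.
exists (mklin (mul_linear c0)) => -[[p1 p2] p3].
by rewrite fE /= /kd1 /= c1E c2E c3E !mulrDl !mulrA.
Qed.

Lemma kosz_cohomology2 : cohomology_zero kdiff 2.
Proof.
move=> f fd.
have fE (p1 p2 p3 : B) := linear3E f p1 p2 p3.
move: (f (1, 0, 0)) (f (0, 1, 0)) (f (0, 0, 1)) fE => c1 c2 c3 fE.
have := etrans (esym (fE _ _ _)) (fd (1 : B)); rewrite !mul1r => E.
(* Substituting [w' = w - e y] in [-z c1 + y c2 + w' c3 = 0] gives a right syzygy of [w], [y], [z]:
   up to a change of coordinates, the dual complex is the Koszul complex of the other side. *)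
have [|s1 [s2 [s3 [c3E c2E c1E]]]] := @syz1_r c3 (c2 - e *: c3) (- c1).
  by rewrite -[RHS]E wE; clear; expand_words; lin_over k B.
exists (mklin (mul3_linear (e *: s2 + s3) s2 (- s1))) => -[[p1 p2] p3].
rewrite fE /= -[c2](subrK (e *: c3)) c2E -[c1]opprK c1E c3E wE.
by clear; expand_words; lin_over k B.
Qed.

Lemma kosz_cohomology4 i : cohomology_zero kdiff i.+4.
Proof.
move=> f fd; exists (mklin (@zero_linear _ _)) => p /=.
have -> : p = 0 by apply/rowP => -[].
by rewrite linear0.
Qed.

(** Maps from the last term [B] are right multiplications, and coboundaries are those by elements of
    [wB + yB + zB]; the quotient is [k]. *)
Lemma kosz_cohomology3 : cohomology_trivial kdiff 3.
Proof.
have cob (r1 r2 r3 : B) : exists g : {linear kosz 2 -> B^o}, forall p : kosz 3,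
    g (kdiff 2 p) = (p : B) * (w * r1 + y * r2 + z * r3).
  exists (mklin (mul3_linear (- r3) (r2 + e *: r1) r1)) => p.
  by rewrite /= wE; clear; expand_words; lin_over k B.
(* The generator of the last term has degree 3 and the identity sends it to 1, of degree 0. *)
exists (- 3), (mklin (@linear_id _ _)); split.
- split=> [q|[g /(_ (1 : B))]]; first by rewrite linear0.
  move=> /(congr1 (fun u : B^o => aug (u : B))); rewrite [LHS]rmorph1.
  have -> : kdiff 2 (1 : B) = ((- z, y, w') : B3) by rewrite /= /kd3 !mul1r.
  rewrite linear3E !rmorphD mulNr rmorphN !aug_gen_r // oppr0 !addr0 => /eqP.
  by rewrite oner_eq0.
- by [].
- move=> f _; have [c [r1 [r2 [r3 cE]]]] := span_r (f (1 : B)).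
  have [g gE] := cob r1 r2 r3; exists c, g => p; rewrite gE [f p]linear1E cE /=.
  by rewrite mulrDr mulr_algr addrC addKr.
- move=> n u n_gt0 hu; have [c [r1 [r2 [r3 uE]]]] := span_r u.
  have [g gE] := cob r1 r2 r3; exists g => p; rewrite gE /= {1}uE.
  have : aug u = 0 by exact: aug_hom hu.
  rewrite uE !rmorphD aug_scalar !aug_gen_r // !addr0 => ->.
  by rewrite scale0r add0r.
Qed.

Lemma kosz_gorenstein : gorenstein B 3.
Proof.
exists T, kosz, kdiff, kaug; split.
- exact: triv_grmodP.
- exact: kosz_resolution.
- by split; [apply: kdiff_hom | apply: kaug_hom].
- move=> [|[|[|[|i]]]] // _; [exact: kosz_cohomology0 | exact: kosz_cohomology1
    | exact: kosz_cohomology2 | exact: kosz_cohomology4].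
- exact: kosz_cohomology3.
Qed.
End KoszulComplex.

(** * Regularity of B *)

Section RegularB.
Variables (k : fieldType) (a : k) (B : gralg k) (xyz : 'I_3 -> B).
Hypothesis presB : presented (fun=> 1%N) (relB a) xyz.
Local Notation e := (eB a).
Local Notation b := (bB a).
Local Notation y := (yB xyz).
Local Notation z := (zB xyz).
Local Notation w := (wB a xyz).
Local Notation w' := (vB a xyz).

Lemma B_alg_map (A : algType k) (X Y Z : A) :
  X * Y + Y * X = Z * Z - Y * Y -> X * Y + Y * X = a *: (Z * Z) - X * X ->
  Z * X - X * Z = a *: (Y * Z - Z * Y) ->
  exists f : {lrmorphism B -> A}, [/\ f (xB xyz) = X, f y = Y & f z = Z].
Proof.
move=> E1 E2 E3; have mul_lin (u : A) : linear (fun v : A => v * u).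
  by move=> c v1 v2; rewrite mulrDl scalerAl.
have [|f fE] := pres_alg_map presB (h := op3 X Y Z); last first.
  by exists f; split; rewrite fE ?op3_0 ?op3_1 ?op3_2.
move=> s Rs; rewrite free_eval_act.
have -> : (fun i (v : A) => v * op3 X Y Z i) =
    op3 (fun v => v * X) (fun v => v * Y) (fun v => v * Z).
  by apply: funext; apply: ord3_ind; apply: funext => v; rewrite ?op3_0 ?op3_1 ?op3_2.
apply: (relB_act (mul_lin X) (mul_lin Y) (mul_lin Z)) Rs => v; rewrite -!mulrA.
- by rewrite -mulrDr E1 mulrBr.
- by rewrite -mulrDr E2 mulrBr -scalerAr.
- by rewrite -!mulrBr E3 -scalerAr.
Qed.

Lemma B_augmentation : exists f : {rmorphism B -> k},
  (forall n (u : B), (0 < n)%N -> hom n u -> f u = 0) /\ forall c : k, f c%:A = c.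
Proof.
have [|||f [fx fy fz]] := @B_alg_map k^o 0 0 0.
1-3: by rewrite mul0r ?subr0 ?addr0 ?subrr ?scaler0.
exists (f : {rmorphism B -> k}); split=> [[//|n] u _ hu|c].
  have [v1 [v2 [v3 <-]]] := gens_span_hom presB hu.
  have fw : f w = 0 by rewrite linearD linearZ /= fx fy scaler0 addr0.
  rewrite /= !linearD /= !rmorphM /=.
  by rewrite [X in _ * X + _ + _]fw [X in _ + _ * X + _]fy [X in _ + _ * X]fz !mulr0 !addr0.
by rewrite [LHS]linearZ /= rmorph1; apply: mulr1.
Qed.

Lemma antiaut_w : exists f : {linear B -> B},
  [/\ [/\ f w = w, f w' = w', f y = y & f z = z],
      forall u v, f (u * v) = f v * f u & involutive f].
Proof.
have [f [fx fy fz fM ff]] := antiaut_exists presB; exists f; split=> //.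
have fw : f w = w by rewrite linearD linearZ /= fx fy.
have fB u v c : f u = u -> f v = v -> f (u - c *: v) = u - c *: v.
  by move=> fu fv; rewrite linearB linearZ /= fu fv.
have fw' : f w' = w' by exact: fB fw fy.
by split.
Qed.

Lemma gens_span_r u : exists c : k, exists v1 v2 v3 : B,
  u = c%:A + (w * v1 + y * v2 + z * v3).
Proof.
have [f [[fw _ fy fz] fM ff]] := antiaut_w.
have f1 : f 1 = 1 by rewrite -[f 1]mulr1 -{2}[1]ff -fM mulr1 ff.
have [c [v1 [v2 [v3 E]]]] := gens_span presB (f u).
exists c, (f v1), (f v2), (f v3); apply: (can_inj ff); rewrite E.
by rewrite !linearD [f c%:A]linearZ /= !fM !ff fw fy fz f1.
Qed.

Lemma gens_syzygy_r v1 v2 v3 : w * v1 + y * v2 + z * v3 = 0 ->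
  exists s1 s2 s3 : B, [/\ v1 = z * s1 + w * s2 + y * s3,
    v2 = w' * s3 - b *: (y * s2) & v3 = - (w * s1) - e *: (z * s2) - z * s3].
Proof.
have [f [[fw fw' fy fz] fM ff]] := antiaut_w.
move=> /(congr1 f); rewrite linear0 !linearD /= !fM fw fy fz.
move=> /(gens_syzygy presB)[s1 [s2 [s3 [E1 E2 E3]]]].
exists (f s1), (f s2), (f s3); split; apply: (can_inj ff).
- by rewrite E1 !linearD /= !fM !ff fw fy fz.
- by rewrite E2 linearB [f (_ *: _)]linearZ /= !fM !ff fw' fy.
- by rewrite E3 !linearB linearN [f (_ *: _)]linearZ /= !fM !ff fw fz.
Qed.

Hypothesis b_neq0 : bB a != 0.

Lemma vy_syzygy_r s t : w' * s = b *: (y * t) -> exists u, s = w' * u /\ t = y * u.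
Proof.
have [f [[fw fw' fy fz] fM ff]] := antiaut_w.
move=> /(congr1 f); rewrite linearZ /= !fM fw' fy.
move=> /(vy_syzygy presB b_neq0)[u [E1 E2]].
by exists (f u); split; apply: (can_inj ff); rewrite fM ff ?fw' ?fy.
Qed.

Lemma mulz_inj_r u : z * u = 0 -> u = 0.
Proof.
have [f [[_ _ _ fz] fM ff]] := antiaut_w.
move=> /(congr1 f); rewrite linear0 fM fz => /(mulz_inj presB b_neq0) fu.
by rewrite -[u]ff fu linear0.
Qed.

Lemma B_regular : regular B 3.
Proof.
have [aug [aug_hom aug_scalar]] := B_augmentation.
have wE : w = w' + e *: y by rewrite subrK.
have zwE := relB_wz presB; have wwE := relB_ww presB; have vvE := relB_w'w' presB.
have ywE := relB_yw presB.
split.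
- by split; [exact: B_connected presB | exact: B_generated presB].
- by exists 3%N; apply: B_dim1 presB.
- split; first exact: B_gldim_le3 presB b_neq0.
  move=> m lt_m3 /(_ (triv_grmod aug_hom)) /(@pd_leW _ _ m 2 lt_m3).
  exact: (kosz_pd (hom_w presB) (hom_w' presB) (hom_y presB) (hom_z presB) wE wwE
    vvE ywE zwE aug_scalar (gens_span presB) (@gens_syzygy _ _ _ _ presB)
    (@koszul_syzygy _ _ _ _ presB b_neq0) (@mulz_inj _ _ _ _ presB b_neq0)).
- exact: B_polynomial_growth presB b_neq0.
- exact: (kosz_gorenstein (hom_w presB) (hom_w' presB) (hom_y presB) (hom_z presB) wE wwE
    vvE ywE zwE aug_hom aug_scalar (gens_span presB) (@gens_syzygy _ _ _ _ presB)
    (@koszul_syzygy _ _ _ _ presB b_neq0) (@mulz_inj _ _ _ _ presB b_neq0)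
    gens_span_r gens_syzygy_r vy_syzygy_r mulz_inj_r).
Qed.
End RegularB.

Lemma B_regularP (k : fieldType) (a : k) (B : gralg k) (xyz : 'I_3 -> B) :
  presented (fun=> 1%N) (relB a) xyz -> regular B 3 <-> bB a != 0.
Proof.
move=> presB; split=> [[_ _ _ growth _]|]; last exact: (B_regular presB).
by apply/eqP => b0; have := degenerate_B_growth presB b0.
Qed.

(** * Presentations of skew Clifford type *)

Section SignTwist.
Variables (k : fieldType) (J : choiceType) (deg : J -> nat) (s : k).
Local Notation F := (free_alg k J).

(* Sealed because comparing it by unfolding is expensive. *)
Lemma sign_twist_sig : {f : F -> F | linear f &
  forall t : seq J, f (word k t) = s ^+ (\sum_(j <- t) deg j)%N *: word k t}.
Proof.
exists (malg_ext (fun m : {fmonom J} => s ^+ (\sum_(j <- (m : seq J)) deg j)%N *: << m >> : F)).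
  exact: malg_ext_linear.
by move=> t; apply: malg_extU.
Qed.

(** The identity for [s = 1], and [u |-> (-1)^n u] in degree [n] for [s = -1]. The parameter treats
    [B] and its twist together. *)
Definition sign_twist : F -> F := s2val sign_twist_sig.

Lemma sign_twist_linear : linear sign_twist. Proof. exact: s2valP sign_twist_sig. Qed.

Lemma sign_twist_word t : sign_twist (word k t) = s ^+ (\sum_(j <- t) deg j)%N *: word k t.
Proof. exact: s2valP' sign_twist_sig t. Qed.

Lemma sign_twist1 : sign_twist 1 = 1.
Proof. by rewrite -word0 sign_twist_word big_nil expr0 scale1r. Qed.

Lemma sign_twist_gen p j : sign_twist (p * gen j) = s ^+ deg j *: (sign_twist p * gen j).
Proof.
elim/free_lin_ind: p => [|c p q IHp IHq|t].
- by rewrite mul0r (linear_fun0 sign_twist_linear) mul0r scaler0.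
- rewrite mulrDl -scalerAl !sign_twist_linear.
  apply: etrans (congr2 (fun u v => c *: u + v) IHp IHq) _.
  move: (sign_twist p) (sign_twist q) => u v; move: (gen j) => t.
  by rewrite mulrDl scalerDr -scalerAl !scalerA [c * _]mulrC.
- rewrite -word_rcons !sign_twist_word -scalerAl -word_rcons.
  by rewrite scalerA -exprD -cats1 big_cat big_seq1 addnC.
Qed.

Lemma sign_twist_gen1 j : sign_twist (gen j) = s ^+ deg j *: gen j.
Proof.
have := sign_twist_gen 1 j; move: (gen j) => t.
by rewrite mul1r sign_twist1 mul1r.
Qed.

Lemma sign_twistM p q : sign_twist (p * q) = sign_twist p * sign_twist q.
Proof.
elim/free_ind: q => [|c q r IHq IHr|q j IH]; first by rewrite sign_twist1 !mulr1.
- rewrite mulrDr malg_scalerAr !sign_twist_linear.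
  apply: etrans (congr2 (fun u v => c *: u + v) IHq IHr) _.
  by move: (sign_twist p) (sign_twist q) (sign_twist r) => u v t; rewrite mulrDr malg_scalerAr.
- have tE u : sign_twist (u * gen j) = s ^+ deg j *: (sign_twist u * gen j).
    exact: sign_twist_gen.
  move: (gen j) tE => t tE; rewrite mulrA; apply: etrans (tE _) _.
  apply: etrans (congr1 (fun u => _ *: (u * t)) IH) _.
  apply: etrans (_ : sign_twist p * (s ^+ deg j *: (sign_twist q * t)) = _).
    by rewrite malg_scalerAr mulrA.
  by congr (_ * _); apply/esym/tE.
Qed.

Lemma sign_twistK : s * s = 1 -> involutive sign_twist.
Proof.
move=> ss; elim/free_ind => [|c p q IHp IHq|p j IH]; first by rewrite !sign_twist1.
- by rewrite !sign_twist_linear IHp IHq.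
- have tE u : sign_twist (u * gen j) = s ^+ deg j *: (sign_twist u * gen j).
    exact: sign_twist_gen.
  have tZ c u : sign_twist (c *: u) = c *: sign_twist u.
    by rewrite -[c *: u]addr0 sign_twist_linear (linear_fun0 sign_twist_linear) addr0.
  move: (gen j) tE => t tE; apply: etrans (congr1 sign_twist (tE p)) _.
  apply: etrans (tZ _ _) _; apply: etrans (congr1 _ (tE _)) _.
  by rewrite IH scalerA -exprMn ss expr1n scale1r.
Qed.
End SignTwist.

Section CliffordNormal.
Variables (k : fieldType) (a s : k) (ss : s * s = 1).
Variables (F : lalgType k) (theta : F -> F).
Hypothesis scaleAr : forall (c : k) (u v : F), u * (c *: v) = c *: (u * v).
Hypotheses (theta_linear : linear theta) (theta1 : theta 1 = 1).
Hypotheses (thetaM : forall u v, theta (u * v) = theta u * theta v).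
Hypothesis thetaK : involutive theta.

Variables (R : F -> Prop) (x y z Y0 Y1 Y2 : F).
Local Notation S := (ideal_gen R).
Hypotheses (theta_x : forall p, theta (p * x) = s *: (theta p * x)).
Hypotheses (theta_y : forall p, theta (p * y) = s *: (theta p * y)).
Hypotheses (theta_z : forall p, theta (p * z) = s *: (theta p * z)).
Hypothesis theta_R : forall r, R r -> S (theta r).
Hypotheses (Sxx : S (x * x - (s * (a - 1)) *: Y0 - Y1)) (Syy : S (y * y - Y1)).
Hypotheses (Szz : S (z * z - Y0)) (Sxy : S (x * y + y * x - s *: Y0 + Y1)).
Hypotheses (Szx : S (z * x - s *: (x * z) - (s * a) *: Y2)).
Hypotheses (Syz : S (y * z - s *: (z * y) - Y2)).

Let S0 : S 0. Proof. exact: ideal_gen0. Qed.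
Let SD u v : S u -> S v -> S (u + v). Proof. exact: ideal_genD. Qed.
Let SB u v : S u -> S v -> S (u - v). Proof. exact: ideal_genB. Qed.
Let SZ (c : k) u : S u -> S (c *: u). Proof. exact: ideal_genZ. Qed.
Let SM u v : S u -> S (v * u). Proof. exact: ideal_genMl. Qed.
Let SMr u v : S u -> S (u * v). Proof. exact: ideal_genMr. Qed.

Let thetaZ (c : k) u : theta (c *: u) = c *: theta u.
Proof.
rewrite -[c *: u]addr0 theta_linear (linear_fun0 theta_linear).
by rewrite addr0.
Qed.

Let thetaD u v : theta (u + v) = theta u + theta v.
Proof. by rewrite -[u]scale1r theta_linear !scale1r. Qed.

Let S_theta u : S u -> S (theta u).
Proof.
elim/ideal_gen_ind: u / => [|u v|l r t Rr].
- by rewrite (linear_fun0 theta_linear).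
- by rewrite thetaD; apply: SD.
- by rewrite !thetaM; apply/SMr/SM/theta_R.
Qed.

(** Undoes the twist inside the Clifford presentation: if the twist is by [z |-> -z], the product of
    [B] by [z] on an element of degree [n] is [(-1)^n] times the twisted one. *)
Definition cliff_rho : 'I_3 -> F -> F :=
  op3 (fun v => v * x) (fun v => v * y) (fun v => theta v * z).

Let mulr_linear (q : F) : linear (fun v : F => v * q).
Proof. by move=> c u v; rewrite mulrDl scalerAl. Qed.

Let rho_z_linear : linear (fun v : F => theta v * z).
Proof. by move=> c u v; rewrite theta_linear mulrDl scalerAl. Qed.

Let rho_linear i : linear (cliff_rho i).
Proof. exact: (op3_linear (mulr_linear x) (mulr_linear y) rho_z_linear). Qed.

Definition cliff_normal (q : free_alg k 'I_3) : F := free_act cliff_rho q 1.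
Local Notation K := cliff_normal.

Lemma cliff_normalM q i : K (q * gen i) = cliff_rho i (K q).
Proof. by rewrite /K (free_actM rho_linear) free_act_gen. Qed.

Let rho_S i u : S u -> S (cliff_rho i u).
Proof.
move=> Su; move: i; apply: ord3_ind; rewrite /cliff_rho ?op3_0 ?op3_1 ?op3_2;
  by apply: SMr => //; apply: S_theta.
Qed.

(** Each relation of [B] acts as a combination of Clifford relations in which [Y0], [Y1], [Y2]
    cancel. *)
Let relB_S r v : relB a r -> S (free_act cliff_rho r v).
Proof.
move: r v; apply: relB_act_mod => // v; rewrite /= ?theta_x ?theta_y ?theta_z ?thetaK.
- have := SB (SD (SM v Sxy) (SM v Syy)) (SZ s (SM v Szz)); congr S.
  by rewrite ?(mulrDr, mulrN, scaleAr, mulrA) -!scalerAl; lin_over k F.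
- have := SB (SD (SM v Sxy) (SM v Sxx)) (SZ (s * a) (SM v Szz)); congr S.
  by rewrite ?(mulrDr, mulrN, scaleAr, mulrA) -!scalerAl; lin_over k F.
- have := SB (SM (theta v) Szx) (SZ (s * a) (SM (theta v) Syz)); congr S.
  rewrite ?(mulrDr, mulrN, scaleAr, mulrA) -!scalerAl.
  have zyE (u : F) : (s * a) *: (s *: u) = a *: u.
    by rewrite scalerA mulrAC ss mul1r.
  by rewrite !scalerBr zyE !scalerA; lin_over k F.
Qed.

Lemma cliff_normal_ideal q : ideal_gen (relB a) q -> S (K q).
Proof. exact: (free_act_ideal rho_linear S0 SD SZ rho_S relB_S 1). Qed.

(** Once this holds for all [p], the algebra presented by the Clifford relations is no larger than
    [B]. *)
Definition normalizable p := exists q, S (K q - p).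

Let normalizable_lin c p q : normalizable p -> normalizable q -> normalizable (c *: p + q).
Proof.
move=> [u Su] [v Sv]; exists (c *: u + v); rewrite /K free_act_linearl -/(K u) -/(K v).
have := SD (SZ c Su) Sv; congr S.
by move: (K u) (K v) => ? ?; lin_over k F.
Qed.

Let normalizable_mod p q : S (p - q) -> normalizable p -> normalizable q.
Proof.
move=> Spq [u Su]; exists u; have := SD Su Spq; congr S.
by rewrite addrA subrK.
Qed.

Let normalizable_rho i p : normalizable p -> normalizable (cliff_rho i p).
Proof.
move=> [u Su]; exists (u * gen i); rewrite cliff_normalM.
by rewrite -(linear_additive (rho_linear i)); apply: rho_S.
Qed.

(** The generator [z] acts by [v |-> theta v * z], so reaching [p * z] requires [theta p]; carrying
    both makes the property stable. *)
Definition bi_normalizable p := normalizable p /\ normalizable (theta p).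

Lemma bi_normalizable_lin c p q :
  bi_normalizable p -> bi_normalizable q -> bi_normalizable (c *: p + q).
Proof.
by move=> [p1 p2] [q1 q2]; split; rewrite ?theta_linear; apply: normalizable_lin.
Qed.

Let bi_normalizable_mod p q : S (p - q) -> bi_normalizable p -> bi_normalizable q.
Proof.
move=> Spq [p1 p2]; split; first exact: normalizable_mod p1.
apply: normalizable_mod p2; rewrite -scaleN1r -thetaZ -thetaD scaleN1r.
exact: S_theta.
Qed.

Let normalizableZ c p : normalizable p -> normalizable (c *: p).
Proof.
move=> np; rewrite -[_ *: _]addr0; apply: normalizable_lin => //.
by exists 0; rewrite /K free_act0l subrr.
Qed.

Lemma bi_normalizable_x p : bi_normalizable p -> bi_normalizable (p * x).
Proof.
move=> [p1 p2]; split; first by have := normalizable_rho (inord 0) p1; rewrite /cliff_rho op3_0.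
rewrite theta_x; apply: normalizableZ.
by have := normalizable_rho (inord 0) p2; rewrite /cliff_rho op3_0.
Qed.

Lemma bi_normalizable_y p : bi_normalizable p -> bi_normalizable (p * y).
Proof.
move=> [p1 p2]; split; first by have := normalizable_rho (inord 1) p1; rewrite /cliff_rho op3_1.
rewrite theta_y; apply: normalizableZ.
by have := normalizable_rho (inord 1) p2; rewrite /cliff_rho op3_1.
Qed.

Lemma bi_normalizable_z p : bi_normalizable p -> bi_normalizable (p * z).
Proof.
move=> [p1 p2]; split.
  by have := normalizable_rho (inord 2) p2; rewrite /cliff_rho op3_2 thetaK.
rewrite theta_z; apply: normalizableZ.
by have := normalizable_rho (inord 2) p1; rewrite /cliff_rho op3_2.
Qed.

Lemma bi_normalizable1 : bi_normalizable 1.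
Proof.
have n1 : normalizable 1 by exists 1; rewrite /K free_act1 subrr.
by split=> //; rewrite theta1.
Qed.

Lemma bi_normalizable_Y p : bi_normalizable p ->
  [/\ bi_normalizable (p * Y0), bi_normalizable (p * Y1) & bi_normalizable (p * Y2)].
Proof.
have nM u v : S (u - v) -> bi_normalizable (p * u) -> bi_normalizable (p * v).
  by move=> Suv; apply: bi_normalizable_mod; rewrite -mulrBr; apply: SM.
move=> np; split.
- by apply: nM Szz _; rewrite mulrA; do 2!apply: bi_normalizable_z.
- by apply: nM Syy _; rewrite mulrA; do 2!apply: bi_normalizable_y.
- apply: nM Syz _; rewrite mulrBr scaleAr !mulrA addrC -scaleNr.
  apply: bi_normalizable_lin.
    exact/bi_normalizable_y/bi_normalizable_z.
  exact/bi_normalizable_z/bi_normalizable_y.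
Qed.
End CliffordNormal.

Section CliffordPresentation.
Variables (k : fieldType) (a : k) (B : gralg k) (xyz : 'I_3 -> B).
Hypothesis presB : presented (fun=> 1%N) (relB a) xyz.
Variables (s : k) (J : choiceType) (deg : J -> nat).
Hypothesis ss : s * s = 1.
Local Notation F := (free_alg k J).
Local Notation theta := (@sign_twist k J deg s).

Variables (R : F -> Prop) (x y z Y0 Y1 Y2 : F).
Local Notation S := (ideal_gen R).
Hypotheses (theta_x : forall p, theta (p * x) = s *: (theta p * x)).
Hypotheses (theta_y : forall p, theta (p * y) = s *: (theta p * y)).
Hypotheses (theta_z : forall p, theta (p * z) = s *: (theta p * z)).
Hypothesis theta_R : forall r, R r -> S (theta r).
Hypotheses (Sxx : S (x * x - (s * (a - 1)) *: Y0 - Y1)) (Syy : S (y * y - Y1)).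
Hypotheses (Szz : S (z * z - Y0)) (Sxy : S (x * y + y * x - s *: Y0 + Y1)).
Hypotheses (Szx : S (z * x - s *: (x * z) - (s * a) *: Y2)).
Hypotheses (Syz : S (y * z - s *: (z * y) - Y2)).
Hypothesis gen_cases : forall j (P : F -> Prop),
  P x -> P y -> P z -> P Y0 -> P Y1 -> P Y2 -> P (gen j).

Let tlin : linear theta := @sign_twist_linear k J deg s.
Let t1 : theta 1 = 1 := sign_twist1 deg s.
Let tM u v : theta (u * v) = theta u * theta v := sign_twistM deg s u v.
Let tK : involutive theta := sign_twistK deg ss.
Let sAr (c : k) (u v : F) : u * (c *: v) = c *: (u * v) := malg_scalerAr c u v.
Local Notation K := (cliff_normal theta x y z).
Local Notation rho := (cliff_rho theta x y z).
Local Notation bi_normalizable := (@bi_normalizable k F theta R x y z).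

Let KM q i : K (q * gen i) = rho i (K q).
Proof. exact: (cliff_normalM tlin). Qed.

Let bi_normalizable_all p : bi_normalizable p.
Proof.
have nY := bi_normalizable_Y sAr tlin tM tK theta_y theta_z theta_R Syy Szz Syz.
elim/free_ind: p => [|c p q np nq|p j np].
- exact: (bi_normalizable1 t1 R x y z).
- exact (@bi_normalizable_lin _ _ _ tlin R x y z c p q np nq).
- have [n0 n1 n2] := nY _ _ np; pose P u := bi_normalizable (p * u).
  have nx : P x by exact (@bi_normalizable_x _ s _ _ tlin tM R x y z theta_x theta_R p np).
  have ny : P y by exact (@bi_normalizable_y _ s _ _ tlin tM R x y z theta_y theta_R p np).
  have nz : P z by exact (@bi_normalizable_z _ s _ _ tlin tM tK R x y z theta_z theta_R p np).
  exact (gen_cases j nx ny nz n0 n1 n2).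
Qed.

Variables (D : gralg k) (g : J -> D) (iota : {linear B -> D}) (epsD : D -> D).
Hypotheses (g_hom : forall j, hom (deg j) (g j)).
Hypothesis g_R : forall r, R r -> free_eval g r = 0.
Hypotheses (iota_bij : bijective iota) (iota1 : iota 1 = 1).
Hypotheses (epsD_lin : linear epsD) (epsD1 : epsD 1 = 1).
Hypothesis epsD_g : forall u j, epsD (u * g j) = s ^+ deg j *: (epsD u * g j).
Hypotheses (iota_x : forall u, iota (u * xB xyz) = iota u * free_eval g x).
Hypotheses (iota_y : forall u, iota (u * yB xyz) = iota u * free_eval g y).
Hypotheses (iota_z : forall u, iota (u * zB xyz) = epsD (iota u) * free_eval g z).

Let ev_theta p : free_eval g (theta p) = epsD (free_eval g p).
Proof.
elim/free_ind: p => [|c p q IHp IHq|p j IH].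
- by rewrite t1 rmorph1 epsD1.
- by rewrite tlin !linearP /= IHp IHq epsD_lin.
- apply: etrans (congr1 _ (sign_twist_gen deg s p j)) _.
  by rewrite linearZ !rmorphM /= free_eval_gen IH epsD_g.
Qed.

Let ev_K q : free_eval g (K q) = iota (free_eval xyz q).
Proof.
elim/free_ind: q => [|c p q IHp IHq|p i IH].
- by rewrite /K free_act1 !rmorph1 iota1.
- apply: etrans (congr1 (free_eval g) (free_act_linearl _ _ _ _ _)) _.
  apply: etrans (free_eval_linear g _ _ _) _.
  apply: etrans (congr2 (fun u v => c *: u + v) IHp IHq) _.
  by rewrite -linearP; congr (iota _); apply/esym/free_eval_linear.
rewrite KM rmorphM /= free_eval_gen; move: i; rewrite /cliff_rho.
apply: ord3_ind; rewrite ?op3_0 ?op3_1 ?op3_2 rmorphM /=.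
- exact: etrans (congr1 (fun u => u * free_eval g x) IH) (esym (iota_x _)).
- exact: etrans (congr1 (fun u => u * free_eval g y) IH) (esym (iota_y _)).
- apply: etrans (congr1 (fun u => u * free_eval g z) (ev_theta _)) _.
  exact: etrans (congr1 (fun u => epsD u * free_eval g z) IH) (esym (iota_z _)).
Qed.

(** If [p] evaluates to 0, choose [q] with [K q] congruent to [p]. Then [iota] of the value of [q]
    in [B] is 0, so [q] lies in the ideal of [relB], hence [K q], and with it [p], in the Clifford
    ideal. *)
Lemma cliff_presented : presented deg R g.
Proof.
have ev_S p : S p -> free_eval g p = 0.
  elim/ideal_gen_ind: p / => [|u v Eu Ev|l r t Rr]; first by rewrite linear0.
    by rewrite linearD /= Eu Ev addr0.
  by rewrite !rmorphM /= (g_R Rr) mulr0 mul0r.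
split=> // [u|p].
  have [iota' iotaK iotaK'] := iota_bij; exists (K (plift presB (iota' u))).
  by rewrite ev_K pliftK iotaK'.
split=> [ev_p|]; last exact: ev_S.
have [[q Sq] _] := bi_normalizable_all p.
have : free_eval g (K q) = 0.
  by rewrite -[K q](subrK p) linearD /= ev_p ev_S // addr0.
rewrite ev_K => iota0.
have /(pres_eq0 presB)/(cliff_normal_ideal ss sAr tlin tM tK theta_x theta_y theta_z theta_R
    Sxx Syy Szz Sxy Szx Syz) SK : free_eval xyz q = 0.
  by apply: (bij_inj iota_bij); rewrite iota0 linear0.
by rewrite -[p](subKr (K q)); apply: ideal_genB.
Qed.
End CliffordPresentation.

(** * Twists by an involution *)

(** As [tw_phi] is an involution, only the parity of degrees matters. Encoding parity by the
    involution [tw_sign] defines the twisted product on a plain algebra, for all elements and not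
    just homogeneous ones. *)
Record involutive_twist (k : fieldType) (A : algType k) := InvolutiveTwist {
  tw_phi : {lrmorphism A -> A};
  tw_sign : {lrmorphism A -> A};
  tw_two : 2%:R != 0 :> k;
  tw_phiK : involutive tw_phi;
  tw_signK : involutive tw_sign;
  tw_comm : forall u, tw_phi (tw_sign u) = tw_sign (tw_phi u)
}.

Definition twisted (k : fieldType) (A : algType k) (t : involutive_twist A) : Type := A.

Section Twisted.
Variables (k : fieldType) (A : algType k) (t : involutive_twist A).
Local Notation phi := (tw_phi t).
Local Notation sg := (tw_sign t).
Local Notation half := ((2%:R : k)^-1).
Implicit Types u v : A.

Definition ev_part u : A := half *: (u + sg u).
Definition od_part u : A := half *: (u - sg u).

(* With tw_sign u = (-1)^n u for u of degree n, this is u phi^n(v). *)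
Definition twist_mul u v : A := ev_part u * v + od_part u * phi v.

Let half2 : half + half = 1.
Proof. by rewrite -mulr2n -[half *+ 2]mulr_natr mulVf // (tw_two t). Qed.

Lemma ev_od u : ev_part u + od_part u = u.
Proof.
rewrite /ev_part /od_part -scalerDr addrACA subrr addr0 scalerDr -scalerDl.
by rewrite half2 scale1r.
Qed.

Lemma ev_part_linear : linear ev_part.
Proof. by move=> c u v; rewrite /ev_part linearP; lin_over k A. Qed.
Lemma od_part_linear : linear od_part.
Proof. by move=> c u v; rewrite /od_part linearP; lin_over k A. Qed.

Lemma ev_part_even u : sg u = u -> ev_part u = u /\ od_part u = 0.
Proof.
move=> E; have := ev_od u; rewrite /od_part E subrr scaler0 addr0 => evu.
by split.
Qed.

Lemma od_part_odd u : sg u = - u -> ev_part u = 0 /\ od_part u = u.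
Proof.
move=> E; have := ev_od u; rewrite {1}/ev_part E subrr scaler0 add0r => odu.
by split=> //; rewrite /ev_part E subrr scaler0.
Qed.

Lemma ev_part_phi u : ev_part (phi u) = phi (ev_part u).
Proof. by rewrite /ev_part [RHS]linearZ /= [phi (_ + _)]linearD /= tw_comm. Qed.
Lemma od_part_phi u : od_part (phi u) = phi (od_part u).
Proof. by rewrite /od_part [RHS]linearZ /= [phi (_ - _)]linearB /= tw_comm. Qed.

Lemma ev_part_sign u : ev_part (sg u) = ev_part u.
Proof. by rewrite /ev_part tw_signK addrC. Qed.
Lemma od_part_sign u : od_part (sg u) = - od_part u.
Proof. by rewrite /od_part tw_signK -scalerN opprB. Qed.

Let sg_ev u : sg (ev_part u) = ev_part u.
Proof. by rewrite /ev_part [LHS]linearZ /= [sg (_ + _)]linearD /= tw_signK addrC. Qed.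
Let sg_od u : sg (od_part u) = - od_part u.
Proof. by rewrite /od_part [LHS]linearZ /= [sg (_ - _)]linearB /= tw_signK -scalerN opprB. Qed.

Lemma evM u v : ev_part (u * v) = ev_part u * ev_part v + od_part u * od_part v.
Proof.
rewrite -{1}(ev_od u) -{1}(ev_od v).
move: (sg_ev u) (sg_ev v) (sg_od u) (sg_od v).
move: (ev_part u) (ev_part v) (od_part u) (od_part v) => p q r s Ep Eq Er Es.
have evE w1 w2 : sg w1 = w1 -> sg w2 = - w2 -> ev_part (w1 + w2) = w1.
  move=> /ev_part_even[E1 _] /od_part_odd[E2 _].
  by have := ev_part_linear 1 w1 w2; rewrite E1 E2 !scale1r addr0.
have -> : (p + r) * (q + s) = (p * q + r * s) + (p * s + r * q).
  by rewrite mulrDl !mulrDr; lin_over k A.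
apply: evE; rewrite linearD /= !rmorphM /= ?Ep ?Eq ?Er ?Es ?mulrNN //.
by rewrite mulrN mulNr opprD.
Qed.

Lemma odM u v : od_part (u * v) = ev_part u * od_part v + od_part u * ev_part v.
Proof.
apply: (addrI (ev_part (u * v))); rewrite ev_od evM -{1}(ev_od u) -{1}(ev_od v).
move: (ev_part u) (ev_part v) (od_part u) (od_part v) => p q r s.
by rewrite mulrDl !mulrDr; lin_over k A.
Qed.

HB.instance Definition _ := GRing.Lmodule.on (twisted t).

Lemma ev_part1 : ev_part 1 = 1 /\ od_part 1 = 0.
Proof. by apply: ev_part_even; rewrite rmorph1. Qed.

Lemma twist_mul_lin c u u' v :
  twist_mul (c *: u + u') v = c *: twist_mul u v + twist_mul u' v.
Proof.
rewrite /twist_mul ev_part_linear od_part_linear !mulrDl -!scalerAl.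
by lin_over k A.
Qed.

Lemma twist_mul_linr c u v v' :
  twist_mul u (c *: v + v') = c *: twist_mul u v + twist_mul u v'.
Proof.
rewrite /twist_mul linearP !mulrDr -!scalerAr.
by lin_over k A.
Qed.

Let evev u : ev_part (ev_part u) = ev_part u /\ od_part (ev_part u) = 0.
Proof. exact/ev_part_even/sg_ev. Qed.
Let odod u : ev_part (od_part u) = 0 /\ od_part (od_part u) = od_part u.
Proof. exact/od_part_odd/sg_od. Qed.
Let evD u v : ev_part (u + v) = ev_part u + ev_part v.
Proof. by rewrite -[u]scale1r ev_part_linear !scale1r. Qed.
Let odD u v : od_part (u + v) = od_part u + od_part v.
Proof. by rewrite -[u]scale1r od_part_linear !scale1r. Qed.

(** Parity is additive, and when [u] and [v] are both odd the two applications of [phi] to [q]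
    cancel. *)
Lemma twist_mulA : associative twist_mul.
Proof.
move=> u v q; rewrite /twist_mul !(evD, odD, evM, odM).
rewrite (evev u).1 (evev u).2 (odod u).1 (odod u).2 !mul0r !(addr0, add0r).
rewrite !ev_part_phi !od_part_phi !linearD /= !rmorphM /= tw_phiK.
move: (ev_part u) (ev_part v) (od_part u) (od_part v) => ? ? ? ?.
by rewrite !(mulrDl, mulrDr, mulrA); lin_over k A.
Qed.

Lemma twist_mul1 : left_id 1 twist_mul.
Proof. by move=> u; rewrite /twist_mul ev_part1.1 ev_part1.2 mul1r mul0r addr0. Qed.
Lemma twist_mulr1 : right_id 1 twist_mul.
Proof. by move=> u; rewrite /twist_mul rmorph1 !mulr1 ev_od. Qed.
Lemma twist_mulDl : left_distributive twist_mul +%R.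
Proof. by move=> u u' v; have := twist_mul_lin 1 u u' v; rewrite !scale1r. Qed.
Lemma twist_mulDr : right_distributive twist_mul +%R.
Proof. by move=> u v v'; have := twist_mul_linr 1 u v v'; rewrite !scale1r. Qed.

HB.instance Definition _ := GRing.Zmodule_isNzRing.Build (twisted t)
  twist_mulA twist_mul1 twist_mulr1 twist_mulDl twist_mulDr (oner_neq0 A).

Lemma twistedE (u v : twisted t) : u * v = twist_mul u v.
Proof. by []. Qed.

Let twist_scaleAl (c : k) (u v : twisted t) :
  c *: (u * v : twisted t) = (c *: u : twisted t) * v.
Proof.
have lin : linear (twist_mul^~ v) by move=> d q q'; apply: twist_mul_lin.
by have := twist_mul_lin c u 0 v; rewrite (linear_fun0 lin) !addr0 => E; apply/esym/E.
Qed.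
Let twist_scaleAr (c : k) (u v : twisted t) :
  c *: (u * v : twisted t) = u * (c *: v : twisted t).
Proof.
have lin : linear (twist_mul u) by move=> d q q'; apply: twist_mul_linr.
by have := twist_mul_linr c u v 0; rewrite (linear_fun0 lin) !addr0 => E; apply/esym/E.
Qed.

HB.instance Definition _ := GRing.Lmodule_isLalgebra.Build k (twisted t) twist_scaleAl.
HB.instance Definition _ := GRing.Lalgebra_isAlgebra.Build k (twisted t) twist_scaleAr.
End Twisted.

Section GradedTwist.
Variables (k : fieldType) (B : gralg k) (t : involutive_twist B).
Hypothesis phi_hom : forall n (u : B), hom n u -> hom n (tw_phi t u).
Hypothesis sign_hom : forall n (u : B), hom n u -> tw_sign t u = (-1) ^+ n *: u.

Lemma twist_mul_hom n u v : hom n u -> twist_mul t u v = u * iter n (tw_phi t) v.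
Proof.
move=> /sign_hom; rewrite -signr_odd.
have -> : iter n (tw_phi t) v = iter (odd n) (tw_phi t) v.
  elim: n => //= n ->; case: (odd n) => //=; exact: tw_phiK.
case: (odd n); rewrite ?expr1 ?expr0 ?scaleN1r ?scale1r /twist_mul.
  by move=> /od_part_odd[-> ->]; rewrite mul0r add0r.
by move=> /ev_part_even[-> ->]; rewrite mul0r addr0.
Qed.

Let thom n (u : twisted t) := hom n (u : B).

Lemma twisted_direct : direct_grading thom. Proof. exact: gr_direct. Qed.
Lemma twisted_scale n (c : k) (u : twisted t) : thom n u -> thom n (c *: u).
Proof. exact: homZ. Qed.
Lemma twisted_hom1 : thom 0%N 1. Proof. exact: gr_one. Qed.
Lemma twisted_homM m n (u v : twisted t) : thom m u -> thom n v -> thom (m + n)%N (u * v).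
Proof.
move=> hu hv; rewrite /thom twistedE (twist_mul_hom _ hu); apply: gr_mul => //.
by elim: {hu}m => //= m; apply: phi_hom.
Qed.

Definition twisted_gralg : gralg k :=
  GrAlg twisted_direct twisted_scale twisted_hom1 twisted_homM.

Lemma twisted_phi_linear : linear (tw_phi t : twisted_gralg -> twisted_gralg).
Proof. by move=> c u v; rewrite [LHS]linearP. Qed.

Lemma twisted_phi_mult :
  monoid_morphism (tw_phi t : twisted_gralg -> twisted_gralg).
Proof.
split; first exact: (rmorph1 (tw_phi t)).
move=> u v; rewrite !twistedE /twist_mul ev_part_phi od_part_phi.
by rewrite linearD /= !rmorphM.
Qed.

(** [phi] is an involution, so twisting by it a second time restores the product of [B]; the
    isomorphism is the identity map. *)
Lemma twisted_iso : exists phi : {lrmorphism twisted_gralg -> twisted_gralg},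
  graded_automorphism phi /\ iso_twist B phi.
Proof.
pose f : twisted_gralg -> twisted_gralg := tw_phi t.
pose fL := GRing.isLinear.Build k twisted_gralg twisted_gralg _ f twisted_phi_linear.
pose fM := GRing.isMonoidMorphism.Build twisted_gralg twisted_gralg f twisted_phi_mult.
pose phi : {lrmorphism twisted_gralg -> twisted_gralg} := HB.pack f fL fM.
exists phi; split.
  split; first by exists f => u; exact: (tw_phiK t u).
  by move=> n u; apply: phi_hom.
have idL : linear (fun u : B => u : twisted_gralg) by [].
pose F : {linear B -> twisted_gralg} := HB.pack (fun u : B => u : twisted_gralg)
  (GRing.isLinear.Build k B twisted_gralg _ (fun u : B => u : twisted_gralg) idL).
exists F; split=> //; first by exists (fun u => u).
move=> m u v hu; rewrite [RHS]twistedE [RHS](twist_mul_hom _ hu); congr (u * _).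
elim: {hu}m v => // m IH v; apply: etrans (IH v) _; apply: esym.
apply: etrans (iterSr _ _ _) _; congr (iter m _ _); exact: (tw_phiK t (iter m f v)).
Qed.
End GradedTwist.

(** * Matrices of the Clifford relations *)

Lemma sum_ord3 (V : nmodType) (f : 'I_3 -> V) :
  \sum_(l < 3) f l = f (inord 0) + f (inord 1) + f (inord 2).
Proof.
rewrite !big_ord_recr big_ord0 /= add0r; congr (f _ + f _ + f _);
  by apply/val_inj; rewrite /= inordK.
Qed.

(* With s = 1 these describe B, and with s = -1 its twist. *)
Definition cliff_mu (k : fieldType) (s : k) : 'M[k]_3 :=
  \matrix_(i, j) op3 (op3 1 1 (- s)) (op3 1 1 (- s)) (op3 (- s) (- s) 1) i j.

(** With [Y0 = z^2], [Y1 = y^2] and [Y2 = yz - s zy], the entries encode [x^2 = s(a-1) Y0 + Y1],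
    [xy + yx = s Y0 - Y1] and [zx - s xz = s a Y2]. The sign [s] appears because [z^2] changes sign
    in the twist. *)
Definition cliff_M (k : fieldType) (a s : k) (l : 'I_3) : 'M[k]_3 :=
  \matrix_(i, j) op3
    (op3 (op3 (2%:R * (s * (a - 1))) s 0) (op3 s 0 0) (op3 0 0 2%:R))
    (op3 (op3 2%:R (- 1) 0) (op3 (- 1) 2%:R 0) (op3 0 0 0))
    (op3 (op3 0 0 (- a)) (op3 0 0 1) (op3 (s * a) (- s) 0)) l i j.

Definition op3s := (op3_0, op3_1, op3_2).

Section CliffordMatrices.
Variables (k : fieldType) (a s : k).
Hypothesis ss : s * s = 1.

Lemma cliff_mu_skew : skew_parameter (cliff_mu s).
Proof.
have s_neq0 : s != 0 by apply: contra_eq_neq ss => ->; rewrite mul0r eq_sym oner_eq0.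
split.
- apply: ord3_ind; apply: ord3_ind; rewrite mxE ?op3s ?oppr_eq0 ?oner_eq0 //.
- by apply: ord3_ind; apply: ord3_ind => _; rewrite !mxE !op3s ?mulrNN ?mul1r.
- by apply: ord3_ind; rewrite mxE !op3s.
Qed.

Lemma cliff_M_symmetric l : mu_symmetric (cliff_mu s) (cliff_M a s l).
Proof.
move: l; apply: ord3_ind; apply: ord3_ind; apply: ord3_ind; rewrite !mxE !op3s;
  by rewrite ?(mul1r, mulr0, mulrNN, mulr1, mulNr, mulrA, ss).
Qed.

Section Relations.
Variables (F : lalgType k) (S : F -> Prop) (gX gY : 'I_3 -> F).
Local Notation x := (gX (inord 0)).
Local Notation y := (gX (inord 1)).
Local Notation z := (gX (inord 2)).

Definition cliff_rel (i j : 'I_3) : F := gX i * gX j + cliff_mu s i j *: (gX j * gX i)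
  - \sum_(l < 3) cliff_M a s l i j *: gY l.

Lemma cliff_rel_eq0 :
  gY (inord 0) = z * z -> gY (inord 1) = y * y ->
  gY (inord 2) = y * z - s *: (z * y) ->
  x * x = (s * (a - 1)) *: (z * z) + y * y -> x * y + y * x = s *: (z * z) - y * y ->
  z * x - s *: (x * z) = (s * a) *: (y * z - s *: (z * y)) ->
  forall i j, cliff_rel i j = 0.
Proof.
move=> E0 E1 E2 Exx Exy Ezx.
have sK (u : F) : s *: (s *: u) = u by rewrite scalerA ss scale1r.
have {}Exy : x * y = s *: (z * z) - y * y - y * x by rewrite -Exy addrK.
have Exz : x * z = s *: (z * x) - a *: (y * z - s *: (z * y)).
  have -> : a *: (y * z - s *: (z * y)) = s *: ((s * a) *: (y * z - s *: (z * y))).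
    by rewrite [RHS]scalerA mulrA ss mul1r.
  by rewrite -Ezx scalerBr sK; lin_over k F.
have {}Ezx : z * x = (s * a) *: (y * z - s *: (z * y)) + s *: (x * z).
  by rewrite -Ezx subrK.
have Ezy : z * y = s *: (y * z) - s *: (y * z - s *: (z * y)).
  by rewrite scalerBr sK; lin_over k F.
apply: ord3_ind; apply: ord3_ind; rewrite /cliff_rel sum_ord3 !mxE !op3s ?E0 ?E1 ?E2.
- by rewrite Exx; lin_over k F.
- by rewrite Exy; lin_over k F.
- by rewrite {1}Exz; lin_over k F.
- by rewrite Exy; lin_over k F.
- by lin_over k F.
- by lin_over k F.
- by rewrite Ezx; lin_over k F.
- by rewrite {1}Ezy; lin_over k F.
- by lin_over k F.
Qed.

Hypotheses (SZ : forall (c : k) u, S u -> S (c *: u)).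
Hypothesis two : 2%:R != 0 :> k.

(** The diagonal relations give only twice the squares, so 2 must be invertible. *)
Lemma cliff_rel_mod : (forall i j, S (cliff_rel i j)) ->
  [/\ S (x * x - (s * (a - 1)) *: gY (inord 0) - gY (inord 1)),
      S (y * y - gY (inord 1)), S (z * z - gY (inord 0)),
      S (x * y + y * x - s *: gY (inord 0) + gY (inord 1))
    & S (z * x - s *: (x * z) - (s * a) *: gY (inord 2)) /\
      S (y * z - s *: (z * y) - gY (inord 2))].
Proof.
move=> H.
have half u v : u = 2%:R *: v -> S u -> S v.
  by move=> -> /(SZ 2%:R^-1); rewrite scalerA mulVf ?scale1r.
have same u v : u = v -> S u -> S v by move=> ->.
split; [| | | |split].
- apply: half (H (inord 0) (inord 0)); rewrite /cliff_rel sum_ord3 !mxE !op3s; lin_over k F.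
- apply: half (H (inord 1) (inord 1)); rewrite /cliff_rel sum_ord3 !mxE !op3s; lin_over k F.
- apply: half (H (inord 2) (inord 2)); rewrite /cliff_rel sum_ord3 !mxE !op3s; lin_over k F.
- apply: same (H (inord 0) (inord 1)); rewrite /cliff_rel sum_ord3 !mxE !op3s; lin_over k F.
- apply: same (H (inord 2) (inord 0)); rewrite /cliff_rel sum_ord3 !mxE !op3s; lin_over k F.
- apply: same (H (inord 1) (inord 2)); rewrite /cliff_rel sum_ord3 !mxE !op3s; lin_over k F.
Qed.

(** The relations are homogeneous of degree 2, where [theta] is multiplication by [s^2 = 1]. *)
Lemma cliff_rel_twist (theta : F -> F) : linear theta ->
  (forall u v : F, theta (u * v) = theta u * theta v) ->
  (forall (c : k) (u v : F), u * (c *: v) = c *: (u * v)) ->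
  (forall i, theta (gX i) = s *: gX i) -> (forall l, theta (gY l) = gY l) ->
  forall i j, theta (cliff_rel i j) = cliff_rel i j.
Proof.
move=> thetaL thetaM scAr tX tY i j.
have tXX i' j' : theta (gX i' * gX j') = gX i' * gX j'.
  by rewrite thetaM !tX scAr -scalerAl scalerA ss scale1r.
have tlin c u v : theta (c *: u + v) = c *: theta u + theta v by exact: thetaL.
have t0 : theta 0 = 0 by exact: linear_fun0.
have tD u v : theta (u + v) = theta u + theta v by rewrite -[u]scale1r tlin !scale1r.
have tZ c u : theta (c *: u) = c *: theta u by rewrite -[c *: u]addr0 tlin t0 !addr0.
have tB u v : theta (u - v) = theta u - theta v by rewrite -!scaleN1r tD tZ.
by rewrite /cliff_rel sum_ord3 tB !tD !tZ !tXX !tY.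
Qed.
End Relations.

Lemma cliff_rel_map (F F' : lalgType k) (f : {linear F -> F'}) (gX gY : 'I_3 -> F)
    (hX hY : 'I_3 -> F') i j : (forall u v, f (u * v) = f u * f v) ->
  (forall i, f (gX i) = hX i) -> (forall l, f (gY l) = hY l) ->
  f (cliff_rel gX gY i j) = cliff_rel hX hY i j.
Proof.
move=> fM fX fY; rewrite /cliff_rel !sum_ord3 linearB /= !linearD /= !linearZ /=.
by rewrite !fM !fX !fY.
Qed.
End CliffordMatrices.

Lemma cliff_mu_minus1 (k : fieldType) : cliff_mu (-1 : k) = const_mx 1.
Proof.
apply/matrixP; apply: ord3_ind; apply: ord3_ind; by rewrite !mxE !op3s ?opprK.
Qed.

Lemma ycomb1 (k : fieldType) n (V : lmodType k) (y : 'I_n -> V) i : ycomb 1%:M y i = y i.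
Proof.
rewrite /ycomb (bigD1 i) //= mxE eqxx scale1r big1 ?addr0 // => l.
by rewrite mxE eq_sym => /negbTE ->; rewrite scale0r.
Qed.

Section SkewCliffordStructure.
Variables (k : fieldType) (a : k) (B : gralg k) (xyz : 'I_3 -> B).
Hypothesis presB : presented (fun=> 1%N) (relB a) xyz.
Variables (s : k) (ss : s * s = 1) (two : 2%:R != 0 :> k).
Local Notation F := (cliff_free k 3).
Local Notation deg := (@cliff_deg 3).
Local Notation theta := (@sign_twist k (cliff_gens 3) deg s).

Variables (N : F -> Prop) (D : gralg k) (X : 'I_3 -> D).
Local Notation x := (X (inord 0)).
Local Notation y := (X (inord 1)).
Local Notation z := (X (inord 2)).
Definition cliff_Y : 'I_3 -> D := op3 (z * z) (y * y) (y * z - s *: (z * y)).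
Local Notation Y := cliff_Y.
Local Notation g := (fun j : cliff_gens 3 => match j with inl i => X i | inr i => Y i end).

Hypothesis X_hom : forall i, hom 1 (X i).
Hypotheses (Dxx : x * x = (s * (a - 1)) *: (z * z) + y * y).
Hypotheses (Dxy : x * y + y * x = s *: (z * z) - y * y).
Hypotheses (Dzx : z * x - s *: (x * z) = (s * a) *: (y * z - s *: (z * y))).
Hypothesis N_normality : forall p, N p -> normality_rel 1%:M p.
Hypothesis N_eval : forall p, N p -> free_eval g p = 0.
Hypothesis N_theta : forall p, N p -> exists c, theta p = c *: p.
Hypothesis Y_normal : forall l u, exists v, Y l * u = v * Y l.
Hypothesis Y_normal' : forall l u, exists v, u * Y l = Y l * v.

Variables (iota : {linear B -> D}) (epsD : D -> D).
Hypotheses (iota_bij : bijective iota) (iota1 : iota 1 = 1).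
Hypotheses (epsD_lin : linear epsD) (epsD1 : epsD 1 = 1).
Hypothesis epsD_X : forall u i, epsD (u * X i) = s *: (epsD u * X i).
Hypotheses (iota_x : forall u, iota (u * xB xyz) = iota u * x).
Hypotheses (iota_y : forall u, iota (u * yB xyz) = iota u * y).
Hypotheses (iota_z : forall u, iota (u * zB xyz) = epsD (iota u) * z).

Local Notation R := (fun p => quadratic_rel (cliff_mu s) (cliff_M a s) p \/ N p).

Let g_hom j : hom (deg j) (g j).
Proof.
case: j => [i|l]; first exact: X_hom.
move: l; apply: ord3_ind; rewrite /Y !op3s; [| |apply: homB; last apply: homZ];
  by apply: (@gr_mul _ _ 1 1).
Qed.

Let quad_eval i j : free_eval g (@cliff_rel k a s F (@genX k 3) (@genY k 3) i j) = 0.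
Proof.
apply: etrans (@cliff_rel_map k a s F D (free_eval g) _ _ X Y i j _ _ _) _.
- by move=> u v; rewrite rmorphM.
- by move=> i'; apply: free_eval_gen.
- by move=> l; apply: free_eval_gen.
- by apply: (cliff_rel_eq0 ss _ _ _ Dxx Dxy Dzx); rewrite /Y op3s.
Qed.

Let g_R r : R r -> free_eval g r = 0.
Proof.
case=> [[i [j ->]]|]; last exact: N_eval.
exact: quad_eval.
Qed.

Let theta_R r : R r -> ideal_gen R (theta r).
Proof.
case=> [[i [j E]]|Nr]; last first.
  by have [c ->] := N_theta Nr; apply/ideal_genZ/ideal_gen_sub; right.
suff -> : theta r = r by apply: ideal_gen_sub; left; exists i, j.
rewrite E; apply: (@cliff_rel_twist k a s ss F (@genX k 3) (@genY k 3) theta).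
- exact: sign_twist_linear.
- exact: sign_twistM.
- exact: malg_scalerAr.
- by move=> i'; apply: etrans (sign_twist_gen1 _ _ _) _; rewrite expr1.
- by move=> l; apply: etrans (sign_twist_gen1 _ _ _) _; rewrite expr2 ss scale1r.
Qed.

Let epsD_g u j : epsD (u * g j) = s ^+ deg j *: (epsD u * g j).
Proof.
case: j => [i|l]; first exact: epsD_X.
have eZ c v : epsD (c *: v) = c *: epsD v.
  by rewrite -[c *: v]addr0 epsD_lin (linear_fun0 epsD_lin) addr0.
have eXX i j : epsD (u * (X i * X j)) = epsD u * (X i * X j).
  by rewrite !mulrA !epsD_X -!scalerAl scalerA ss scale1r.
rewrite expr2 ss scale1r; move: l; apply: ord3_ind; rewrite /Y op3s ?eXX //.
rewrite !mulrBr -!scalerAr addrC -scaleNr epsD_lin !eXX addrC scaleNr.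
by [].
Qed.

(** [N] will be empty for [B] and consist of the centrality relations for the twist. The bijection
    [iota] from [B], which respects right multiplication by generators up to the sign operator
    [epsD], excludes further relations in [D]. *)
Lemma skew_clifford_structure : gsca_with (cliff_mu s) (cliff_M a s) 1%:M N X Y.
Proof.
have [Sxx Syy Szz Sxy [Szx Syz]] := @cliff_rel_mod k a s F (ideal_gen R) (@genX k 3)
  (@genY k 3) (@ideal_genZ k F R) two
  (fun i j => ideal_gen_sub (or_introl (ex_intro _ i (ex_intro _ j erefl)))).
have tX i p := sign_twist_gen deg s p (inl i : cliff_gens 3).
have eX i : free_eval g (@genX k 3 i) = X i by exact: free_eval_gen.
split.
- by split; [exact: cliff_mu_skew | move=> l; apply: cliff_M_symmetric].
- exact: N_normality.
- apply: (@cliff_presented k a B xyz presB s _ deg ss R _ _ _ _ _ _ (tX _) (tX _) (tX _)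
    theta_R Sxx Syy Szz Sxy Szx Syz _ D g iota epsD g_hom g_R iota_bij iota1 epsD_lin
    epsD1 epsD_g).
  + by move=> [i|l] P; [move: i | move: l]; apply: ord3_ind.
  + by move=> u; rewrite eX iota_x.
  + by move=> u; rewrite eX iota_y.
  + by move=> u; rewrite eX iota_z.
- move=> l; exists (fun i => (1%:M : 'M[k]_3) l i).
  by rewrite -[RHS]/(ycomb 1%:M (ycomb 1%:M Y) l) !ycomb1.
- move=> l; rewrite ycomb1; split=> u.
    by have [v ->] := Y_normal l u; exists v; rewrite subrr; apply: ideal_gen0.
  by have [v ->] := Y_normal' l u; exists v; rewrite subrr; apply: ideal_gen0.
Qed.
End SkewCliffordStructure.

Lemma free_hom_gen (k : fieldType) (n : nat) (j : cliff_gens n) :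
  free_hom (@cliff_deg n) (cliff_deg j) (gen j : cliff_free k n).
Proof.
move=> w; rewrite /gen => /(fsubsetP (@msuppU_le _ _ _ _)); rewrite in_fset1 => /eqP ->.
by rewrite fmuE big_seq1.
Qed.

Lemma free_hom0 (k : fieldType) (I : choiceType) (deg : I -> nat) n :
  free_hom deg n (0 : free_alg k I).
Proof. by move=> w; rewrite msupp0. Qed.

Lemma centrality_normality (k : fieldType) n (p : cliff_free k n) :
  centrality_rel p -> normality_rel 1%:M p.
Proof.
move=> [l [j ->]]; exists l, j, (gen j), 0; split.
- exact: free_hom_gen.
- exact: free_hom0.
- exact: ideal_gen0.
- by left; rewrite ycomb1 subr0.
Qed.

Lemma commutator_twist (k : fieldType) (F : lalgType k) (theta : F -> F) (u v : F) (c : k) :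
  linear theta -> (forall u v : F, theta (u * v) = theta u * theta v) ->
  (forall (c : k) (u v : F), u * (c *: v) = c *: (u * v)) ->
  theta u = u -> theta v = c *: v -> theta (u * v - v * u) = c *: (u * v - v * u).
Proof.
move=> thetaL thetaM scAr tu tv.
by rewrite (linear_additive thetaL) !thetaM tu tv scAr -scalerAl scalerBr.
Qed.

(** * The normal element [yz - zy], and diagonal automorphisms *)

Section Commutator.
Variables (k : fieldType) (A : algType k) (v y z : A) (e b : k).
Hypothesis b_neq0 : b != 0.
Hypothesis rel_vv : v * v = b *: (y * y).
Hypothesis rel_yv : y * v = z * z - e *: (y * y) - v * y.
Hypothesis rel_vz : v * z = z * v - e *: (y * z - z * y).
Local Notation q := (y * z - z * y).

Let yyz := rel_yyz b_neq0 rel_vv rel_yv rel_vz.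

(** [q y + y q] is the commutator of [y^2] and [z]; in the next lemma [q z + z q] is that of [y] and
    [z^2]. *)
Lemma commutator_skew_y : q * y = - (y * q).
Proof. by expand_words; rewrite yyz; lin_over k A. Qed.

Lemma commutator_skew_z : q * z = - (z * q).
Proof.
by expand_words; rewrite -(rel_zzy b_neq0 rel_vv rel_yv); lin_over k A.
Qed.

(** Moving [v] to the left with [zv = vz + e q] and [rel_yv] leaves [-v q + e(q y + y q)], up to
    commutators of [y^2] and [z]; the last term vanishes by [commutator_skew_y]. *)
Lemma commutator_skew_v : q * v = - (v * q).
Proof.
have zv : z * v = v * z + e *: q by rewrite rel_vz subrK.
have -> : q * v = (y * v) * z - z * (y * v) + e *: (y * q).
  by rewrite mulrBl -!mulrA zv mulrDr -scalerAr; lin_over k A.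
rewrite rel_yv -[y * q]opprK -commutator_skew_y; expand_words.
rewrite zv; expand_words; rewrite yyz; lin_over k A.
Qed.
End Commutator.

Section SignAutomorphisms.
Variables (k : fieldType) (a : k) (B : gralg k) (xyz : 'I_3 -> B).
Hypothesis presB : presented (fun=> 1%N) (relB a) xyz.
Local Notation x := (xB xyz).
Local Notation y := (yB xyz).
Local Notation z := (zB xyz).
Local Notation w' := (vB a xyz).

(** Each relation is homogeneous for the parity in [z] and for the joint parity in [x] and [y]. *)
Lemma diagonal_aut (sx sy sz : k) : sx * sx = 1 -> sy = sx -> sz * sz = 1 ->
  exists f : {lrmorphism B -> B}, forall i, f (xyz i) = op3 sx sy sz i *: xyz i.
Proof.
move=> sxx -> szz.
have sqE c (u v : B) : c * c = 1 -> (c *: u) * (c *: v) = u * v.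
  by move=> cc; rewrite -scalerAl -scalerAr scalerA cc scale1r.
have [|||f [fx fy fz]] := @B_alg_map k a B xyz presB B (sx *: x) (sx *: y) (sz *: z).
- by rewrite !sqE // (relB1 presB).
- by rewrite !sqE // (relB2 presB).
- rewrite -!scalerAl -!scalerAr !scalerA [sz * sx]mulrC -!scalerBr (relB3 presB).
  by rewrite !scalerA [_ * a]mulrC.
by exists f; apply: ord3_ind; rewrite op3s.
Qed.

Lemma diagonal_aut_hcomp (f : {lrmorphism B -> B}) (c : 'I_3 -> k) :
  (forall i, f (xyz i) = c i *: xyz i) -> forall n u, hcomp n (f u) = f (hcomp n u).
Proof.
move=> fE n u; move: n; elim/(pres_ind presB): u => [|d u v IHu IHv|u i IH] n.
- rewrite rmorph1 (hcomp_id _ (gr_one B)); case: eqP => _; by rewrite ?rmorph1 ?rmorph0.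
- by rewrite !linearP /= IHu IHv.
have hi := hom_xyz presB i; rewrite rmorphM /= fE -scalerAr linearZ /=.
case: n => [|n]; first by rewrite !(hcompMr_small _ hi) // scaler0 rmorph0.
by rewrite -addn1 !(hcompMr _ _ hi) rmorphM /= IH fE scalerAr.
Qed.

Lemma diagonal_aut_hom (f : {lrmorphism B -> B}) (c : 'I_3 -> k) :
  (forall i, f (xyz i) = c i *: xyz i) -> forall n u, hom n u -> hom n (f u).
Proof.
move=> fE n u hu; have := diagonal_aut_hcomp fE n u.
by rewrite (hcomp_id _ hu) eqxx => <-; apply: hcomp_hom.
Qed.

Lemma sign_aut_hom (f : {lrmorphism B -> B}) : (forall i, f (xyz i) = - xyz i) ->
  forall n u, hom n u -> f u = (-1) ^+ n *: u.
Proof.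
move=> fE n u hu.
have H : forall n u, f (hcomp n u) = (-1) ^+ n *: hcomp n u.
  move=> {hu}n {}u; move: n; elim/(pres_ind presB): u => [|d u v IHu IHv|u i IH] n.
  - rewrite (hcomp_id _ (gr_one B)); case: eqP => [->|_]; first by rewrite rmorph1 scale1r.
    by rewrite rmorph0 scaler0.
  - rewrite [hcomp n _]linearP /= [LHS]linearP /= IHu IHv scalerDr !scalerA.
    by rewrite [d * _]mulrC.
  have hi := hom_xyz presB i; case: n => [|n].
    by rewrite !(hcompMr_small _ hi) // rmorph0 scaler0.
  by rewrite -addn1 (hcompMr _ _ hi) rmorphM /= IH fE addn1 exprS mulN1r scaleNr mulrN scalerAl.
by have := H n u; rewrite (hcomp_id _ hu) eqxx.
Qed.

Lemma diagonal_aut_comm (f g : {lrmorphism B -> B}) (c d : 'I_3 -> k) :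
  (forall i, f (xyz i) = c i *: xyz i) -> (forall i, g (xyz i) = d i *: xyz i) ->
  forall u, f (g u) = g (f u).
Proof.
move=> fE gE u; elim/(pres_ind presB): u => [|r u v IHu IHv|u i IH].
- by rewrite !rmorph1.
- by rewrite !linearP /= IHu IHv.
- by rewrite !rmorphM /= IH fE gE !linearZ /= fE gE !scalerA mulrC.
Qed.

Lemma diagonal_autK (f : {lrmorphism B -> B}) (c : 'I_3 -> k) :
  (forall i, f (xyz i) = c i *: xyz i) -> (forall i, c i * c i = 1) -> involutive f.
Proof.
move=> fE cc u; elim/(pres_ind presB): u => [|r u v IHu IHv|u i IH].
- by rewrite !rmorph1.
- by rewrite !linearP /= IHu IHv.
- by rewrite !rmorphM /= IH fE linearZ /= fE scalerA cc scale1r.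
Qed.

Hypothesis b_neq0 : bB a != 0.
Hypothesis two : 2%:R != 0 :> k.

Let vv := relB_w'w' presB.
Let yv := relB_yw' presB.
Let vz := relB_zw' presB.

Lemma yy_central u : y * y * u = u * (y * y).
Proof.
elim/(B_ind presB): u => [|c u v IHu IHv|u IH|u IH|u IH].
- by rewrite mulr1 mul1r.
- by rewrite mulrDr mulrDl -scalerAr -scalerAl IHu IHv.
- by rewrite mulrA IH -!mulrA [y * (y * w')]mulrA (rel_yyv b_neq0 vv) !mulrA.
- by rewrite mulrA IH -!mulrA.
- by rewrite mulrA IH -!mulrA [y * (y * z)]mulrA (rel_yyz b_neq0 vv yv vz) !mulrA.
Qed.

Lemma zz_central u : z * z * u = u * (z * z).
Proof.
elim/(B_ind presB): u => [|c u v IHu IHv|u IH|u IH|u IH].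
- by rewrite mulr1 mul1r.
- by rewrite mulrDr mulrDl -scalerAr -scalerAl IHu IHv.
- by rewrite mulrA IH -!mulrA [z * (z * w')]mulrA (rel_zzv b_neq0 vv yv vz) !mulrA.
- by rewrite mulrA IH -!mulrA [z * (z * y)]mulrA (rel_zzy b_neq0 vv yv) !mulrA.
- by rewrite mulrA IH -!mulrA.
Qed.

Lemma yz_skew (f : {lrmorphism B -> B}) : (forall i, f (xyz i) = - xyz i) ->
  forall u, (y * z - z * y) * u = f u * (y * z - z * y).
Proof.
move=> fE; pose q := y * z - z * y.
have fy : f y = - y by exact: fE.
have fz : f z = - z by exact: fE.
have fw' : f w' = - w'.
  have fx : f x = - x by exact: fE.
  rewrite -[w'](addrK ((a - 1) *: y)) -(xE a) linearB linearZ /= fx fy.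
  by rewrite scalerN opprB opprK addrC.
have Ey : q * y = f y * q by rewrite fy mulNr; apply: commutator_skew_y b_neq0 vv yv vz.
have Ez : q * z = f z * q by rewrite fz mulNr; apply: commutator_skew_z b_neq0 vv yv.
have Ev : q * w' = f w' * q.
  by rewrite fw' mulNr; apply: commutator_skew_v b_neq0 vv yv vz.
move=> u; rewrite -/q; move: q Ey Ez Ev => q Ey Ez Ev.
elim/(B_ind presB): u => [|c u v IHu IHv|u IH|u IH|u IH].
- by rewrite rmorph1 mulr1 mul1r.
- by rewrite [f _]linearP /= mulrDr mulrDl -scalerAr -scalerAl IHu IHv.
- by rewrite rmorphM /= mulrA IH -mulrA Ev mulrA.
- by rewrite rmorphM /= mulrA IH -mulrA Ey mulrA.
- by rewrite rmorphM /= mulrA IH -mulrA Ez mulrA.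
Qed.
End SignAutomorphisms.

(** * The Clifford structures on B and on its twist *)

Section CliffordB.
Variables (k : fieldType) (a : k) (B : gralg k) (xyz : 'I_3 -> B).
Hypothesis presB : presented (fun=> 1%N) (relB a) xyz.
Hypothesis b_neq0 : bB a != 0.
Hypothesis two : 2%:R != 0 :> k.
Local Notation x := (xB xyz).
Local Notation y := (yB xyz).
Local Notation z := (zB xyz).

Lemma sign_aut_exists : exists f : {lrmorphism B -> B}, forall i, f (xyz i) = - xyz i.
Proof.
have [|//||f fE] := @diagonal_aut k a B xyz presB (- 1) (- 1) (- 1); rewrite ?mulrNN ?mulr1 //.
exists f => i; rewrite fE -[RHS]scaleN1r; congr (_ *: _).
by move: i; apply: ord3_ind; rewrite op3s.
Qed.

Lemma B_graded_skew_clifford : graded_skew_clifford B.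
Proof.
have [sg sgE] := sign_aut_exists.
have sgK : involutive sg.
  apply: (diagonal_autK presB (c := fun=> - 1)) => i; first by rewrite sgE scaleN1r.
  by rewrite mulrNN mulr1.
have nY l : exists f : B -> B, involutive f /\
    forall u, cliff_Y 1 xyz l * u = f u * cliff_Y 1 xyz l.
  move: l; apply: ord3_ind; rewrite /cliff_Y op3s.
  - by exists id; split=> // u; exact: (zz_central presB b_neq0 u).
  - by exists id; split=> // u; exact: (yy_central presB b_neq0 u).
  - by exists sg; split=> // u; rewrite scale1r; exact: (yz_skew presB b_neq0 sgE u).
exists 3%N, (cliff_mu 1), (cliff_M a 1), 1%:M, (fun=> False), xyz, (cliff_Y 1 xyz).
have id_bij : bijective (mklin (@linear_id _ B)) by exists id.
apply: (@skew_clifford_structure k a B xyz presB 1 _ two _ B xyz _ _ _ _ _ _ _ _ _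
  (mklin (@linear_id _ B)) id id_bij erefl (fun _ _ _ => erefl)); rewrite ?mul1r ?scale1r //.
- exact: hom_xyz presB.
- exact: (relB_xx presB).
- exact: relB1 presB.
- exact: relB3 presB.
- by move=> l u; have [f [_ E]] := nY l; exists (f u).
- by move=> l u; have [f [fK E]] := nY l; exists (f u); rewrite E fK.
- by move=> u i; rewrite scale1r.
Qed.

Lemma z_sign_exists : exists f : {lrmorphism B -> B},
  forall i, f (xyz i) = op3 1 1 (- 1) i *: xyz i.
Proof. by apply: (diagonal_aut presB); rewrite ?mulrNN ?mulr1. Qed.

Lemma B_twist_exists : exists t : involutive_twist B,
  (forall i, tw_phi t (xyz i) = op3 1 1 (- 1) i *: xyz i) /\
  (forall i, tw_sign t (xyz i) = - xyz i).
Proof.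
have [phi phiE] := z_sign_exists; have [sg sgE] := sign_aut_exists.
have sgE' i : sg (xyz i) = - 1 *: xyz i by rewrite sgE scaleN1r.
have phiK : involutive phi.
  apply: (diagonal_autK presB phiE); apply: ord3_ind; rewrite op3s ?mulr1 //.
  by rewrite mulrNN mulr1.
have sgK : involutive sg by apply: (diagonal_autK presB sgE') => i; rewrite mulrNN mulr1.
by exists (InvolutiveTwist two phiK sgK (diagonal_aut_comm presB phiE sgE')).
Qed.

Section TwistOfB.
Variable t : involutive_twist B.
Hypotheses (phiE : forall i, tw_phi t (xyz i) = op3 1 1 (- 1) i *: xyz i).
Hypotheses (sgE : forall i, tw_sign t (xyz i) = - xyz i).
Let phi_hom := diagonal_aut_hom presB phiE.
Let sg_hom := sign_aut_hom presB sgE.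
Local Notation D := (twisted_gralg phi_hom sg_hom).
Local Notation phi := (tw_phi t).
Local Notation sg := (tw_sign t).

Let X (i : 'I_3) : D := xyz i.
Let phi_x : phi x = x. Proof. by rewrite [LHS]phiE op3s scale1r. Qed.
Let phi_y : phi y = y. Proof. by rewrite [LHS]phiE op3s scale1r. Qed.
Let phi_z : phi z = - z. Proof. by rewrite [LHS]phiE op3s scaleN1r. Qed.

Let mulD1 (u v : B) : hom 1 u -> (u : D) * v = u * phi v :> B.
Proof. exact: (twist_mul_hom sg_hom). Qed.

Let mulD2 (u v : B) : hom 2 u -> (u : D) * v = u * v :> B.
Proof.
by move=> hu; apply: etrans (twist_mul_hom sg_hom v hu) _; rewrite /= tw_phiK.
Qed.

Let sg_twist (u v : B) : sg ((u : D) * v) = (sg u : D) * sg v.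
Proof.
rewrite !twistedE /twist_mul linearD /= !rmorphM /= -tw_comm.
by rewrite /ev_part /od_part !linearZ /= [sg (u + _)]linearD [sg (u - _)]linearB.
Qed.

Let hx := hom_x presB. Let hy := hom_y presB. Let hz := hom_z presB.
Let Dxx : (x : D) * x = x * x :> B. Proof. by rewrite mulD1 // phi_x. Qed.
Let Dxy : (x : D) * y = x * y :> B. Proof. by rewrite mulD1 // phi_y. Qed.
Let Dxz : (x : D) * z = - (x * z) :> B. Proof. by rewrite mulD1 // phi_z mulrN. Qed.
Let Dyx : (y : D) * x = y * x :> B. Proof. by rewrite mulD1 // phi_x. Qed.
Let Dyy : (y : D) * y = y * y :> B. Proof. by rewrite mulD1 // phi_y. Qed.
Let Dyz : (y : D) * z = - (y * z) :> B. Proof. by rewrite mulD1 // phi_z mulrN. Qed.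
Let Dzx : (z : D) * x = z * x :> B. Proof. by rewrite mulD1 // phi_x. Qed.
Let Dzy : (z : D) * y = z * y :> B. Proof. by rewrite mulD1 // phi_y. Qed.
Let Dzz : (z : D) * z = - (z * z) :> B. Proof. by rewrite mulD1 // phi_z mulrN. Qed.

Let Y : 'I_3 -> D := cliff_Y (- 1) X.

(** Each [Y l] has degree 2, so multiplying by it on the left is untwisted; on the right, [phi] hits
    it when [u] is odd. For [z^2] and [y^2], central in [B], nothing changes as [phi] fixes them.
    For [yz - zy], the sign from [phi] cancels the one from anticommuting with odd elements. *)
Let Y_central l (u : D) : Y l * u = u * Y l.
Proof.
have H (c : B) (f : B -> B) : hom 2 c -> (forall u, c * u = f u * c) ->
    (forall u, f u = ev_part t u + od_part t u /\ phi c = c \/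
      f u = ev_part t u - od_part t u /\ phi c = - c) -> (c : D) * u = u * (c : D).
  move=> hc cE fE; apply: etrans (mulD2 _ hc) _; rewrite twistedE /twist_mul cE.
  by case: (fE u) => -[-> ->]; rewrite mulrDl ?mulrN ?mulNr.
have ev2 u' : u' = ev_part t u' + od_part t u' by rewrite ev_od.
have sgD u' : sg u' = ev_part t u' - od_part t u'.
  rewrite {1}[u'](ev2 u') linearD /=; congr (_ + _).
    by rewrite /ev_part linearZ linearD /= tw_signK addrC.
  by rewrite /od_part linearZ linearB /= tw_signK -scalerN opprB.
move: l; apply: ord3_ind; rewrite /Y /cliff_Y op3s.
- have -> : X (inord 2) * X (inord 2) = - (z * z) :> B by exact: Dzz.
  apply: (H _ id) => [|v|v].
  + exact/homN/(gr_mul hz hz).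
  + by rewrite mulNr mulrN (zz_central presB b_neq0).
  + by left; split; [apply: ev2 | rewrite linearN rmorphM /= phi_z mulrNN].
- have -> : X (inord 1) * X (inord 1) = y * y :> B by exact: Dyy.
  apply: (H _ id) => [|v|v].
  + exact: (gr_mul hy hy).
  + exact: (yy_central presB b_neq0).
  + by left; split; [apply: ev2 | rewrite rmorphM /= phi_y].
- have -> : X (inord 1) * X (inord 2) - (- 1) *: (X (inord 2) * X (inord 1))
      = - (y * z - z * y) :> B.
    rewrite scaleN1r opprK opprB addrC; congr (_ + _); [exact: Dzy | exact: Dyz].
  apply: (H _ sg) => [|v|v].
  + exact: (homN (homB (gr_mul hy hz) (gr_mul hz hy))).
  + by rewrite mulNr mulrN (yz_skew presB b_neq0 sgE).
  + right; split; first exact: sgD.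
    by rewrite linearN linearB /= !rmorphM /= phi_y phi_z mulrN mulNr opprK opprB addrC.
Qed.

Lemma twist_graded_clifford : graded_clifford D.
Proof.
exists 3%N, (cliff_M a (- 1)), X, Y; rewrite -cliff_mu_minus1.
have idL : linear (fun u : B => u : D) by [].
pose iota : {linear B -> D} := mklin idL.
have iota_bij : bijective iota by exists (fun u => u).
have ss : (- 1) * (- 1) = 1 :> k by rewrite mulrNN mulr1.
apply: (@skew_clifford_structure k a B xyz presB (- 1) ss two _ D X _ _ _ _ _ _ _ _ _
  iota sg iota_bij erefl).
- exact: hom_xyz presB.
- apply: etrans Dxx _; rewrite (relB_xx presB); apply: esym.
  apply: etrans (congr2 (fun p q : B => (- 1 * (a - 1)) *: p + q) Dzz Dyy) _; lin_over k B.
- apply: etrans (congr2 (fun p q : B => p + q) Dxy Dyx) _; rewrite (relB1 presB).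
  apply: esym; apply: etrans (congr2 (fun p q : B => - 1 *: p - q) Dzz Dyy) _; lin_over k B.
- apply: etrans (congr2 (fun p q : B => p - (- 1) *: q) Dzx Dxz) _.
  apply: etrans (_ : a *: (y * z - z * y) = _); first by rewrite -(relB3 presB); lin_over k B.
  apply: esym.
  apply: etrans (congr2 (fun p q : B => (- 1 * a) *: (p - (- 1) *: q)) Dyz Dzy) _.
  lin_over k B.
- exact: centrality_normality.
- move=> _ [l [j ->]]; set g := fun j : cliff_gens 3 => _.
  have evC u v : free_eval g (u * v - v * u)
      = free_eval g u * free_eval g v - free_eval g v * free_eval g u.
    by apply: etrans (raddfB _ _ _) _; congr (_ - _); apply: (rmorphM (free_eval g)).
  have eY : free_eval g (genY k l) = Y l by exact: free_eval_gen.
  by apply: etrans (evC _ _) _; rewrite eY Y_central subrr.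
- move=> _ [l [j ->]]; exists ((- 1) ^+ cliff_deg j).
  apply: (@commutator_twist k (cliff_free k 3)).
  + exact: sign_twist_linear.
  + exact: sign_twistM.
  + exact: malg_scalerAr.
  + by apply: etrans (sign_twist_gen1 _ _ _) _; rewrite expr2 ss scale1r.
  + exact: sign_twist_gen1.
- by move=> l u; exists u; apply: Y_central.
- by move=> l u; exists u; rewrite Y_central.
- by move=> c u v; exact: (linearP sg c u v).
- exact: (rmorph1 sg).
- by move=> u i; rewrite [LHS]sg_twist sgE scaleN1r; exact: mulrN.
- by move=> u; apply: esym; rewrite twistedE /twist_mul [phi _]phi_x -mulrDl ev_od.
- by move=> u; apply: esym; rewrite twistedE /twist_mul [phi _]phi_y -mulrDl ev_od.
- move=> u; apply: esym; rewrite twistedE /twist_mul [phi _]phi_z.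
  by rewrite ev_part_sign od_part_sign mulrNN -mulrDl ev_od.
Qed.
End TwistOfB.
End CliffordB.

Theorem lemma4p2 (k : closedFieldType) (char_k : 2%N \notin [pchar k])
    (a : k) (ha : a * (a - 1) != 0)
    (B : gralg k) (xyz : 'I_3 -> B)
    (presB : presented (fun=> 1%N) (relB a) xyz) :
  (regular B 3 <-> a ^+ 2 - a + 1 != 0) /\
  (regular B 3 ->
     graded_skew_clifford B /\
     exists (D : gralg k) (phi : {lrmorphism D -> D}),
       [/\ graded_clifford D, graded_automorphism phi & iso_twist B phi]).
Proof.
split; first exact: B_regularP presB.
move=> /(B_regularP presB) b_neq0; have two : 2%:R != 0 :> k.
  by apply: contra char_k; rewrite inE.
split; first exact: B_graded_skew_clifford presB b_neq0 two.
have [t [phiE sgE]] := B_twist_exists presB two.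
have [phi [phi_aut phi_iso]] :=
  twisted_iso (diagonal_aut_hom presB phiE) (sign_aut_hom presB sgE).
exists (twisted_gralg (diagonal_aut_hom presB phiE) (sign_aut_hom presB sgE)), phi.
by split=> //; apply: twist_graded_clifford.
Qed.
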